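(* Work in the setting of the context. Assume: (i) $G(\theta,\cdot)$ is $\mathbb P^Z$-integrable for every $\theta\in\Theta$, and $G(\theta_k,\cdot)\to G(\theta,\cdot)$ in $\mathbb P^Z$-probability whenever $\theta_k\to\theta$ in $\Theta$. (ii) There is a strictly positive square $\mathbb P^Z$-integrable $\xi^G:\mathbb R^d\to\mathbb R$ with $\sup_{\theta\in\Theta}|G(\theta,z)|\le\xi^G(z)$ for all $z\in\mathbb R^d$. (iii) $H(\theta,t,\cdot)$ is Borel measurable for all $(\theta,t)\in\Theta\times\mathbb R$, and $H(\theta,\overline\psi(\theta),\cdot)$ is $\mathbb P^Z$-integrable for all $\theta\in\Theta$. (iv) There are nonnegative square $\mathbb P^Z$-integrable $L_1,L_2$ with $|H(\theta,t,z)-H(\vartheta,s,z)|^2\le L_1(z)^2|G(\theta,z)-G(\vartheta,z)|^2+L_2(z)^2|t-s|^2$ for all $\theta,\vartheta\in\Theta$, $t,s\in\mathbb R$, $z\in\mathbb R^d$. (v) $\psi_{H,\Theta}$ has a unique minimizer $\theta^*$ over $\Theta$. (vi) For every $\delta>0$ there exist an at most countable $\mathcal C(\mathcal U_\delta)\subseteq\mathcal U_\delta$ and $(\mathbb P^Z)^n$-null sets $N_n^\delta$ ($n\in\mathbb N$) such that $\inf_{\vartheta\in\mathcal C(\mathcal U_\delta)}\{\mathbb E[|G(\theta,Z_1)-G(\vartheta,Z_1)|]+\max_{1\le j\le n}|G(\theta,z_j)-G(\vartheta,z_j)|\}=0$ for all $\theta\in\mathcal U_\delta$, $n\in\mathbb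 N$, $(z_1,\dots,z_n)\in\mathbb R^{dn}\setminus N_n^\delta$. (vii) There exist $\beta\in\,]0,1]$, $\overline M_1,\overline M^1>0$ and square $\mathbb P^Z$-integrable positive envelopes $\xi^G_\delta$ of $\mathbb F^\Theta_\delta$ ($\delta\in\,]0,\Delta(\Theta)]$) such that $\|(L_1\vee1)\xi^G_\delta\|_{\mathbb P^Z,2}\le\overline M_1\delta^\beta$ and $J(\mathbb F^\Theta_\delta,\xi^G_\delta,1/8)\vee J(\mathbb F^\Theta,\xi^G,1/8)\le\overline M^1$ for all $\delta\in\,]0,\Delta(\Theta)]$. (viii) There exist $\delta_1>0$, $K_{\delta_1}\ge0$ and a Borel measurable $m_{\Theta\times\mathbb R}:\Theta\times\mathbb R\to\mathbb R$ such that $|m_{\Theta\times\mathbb R}(\theta,\overline\psi(\theta)+x)-m_{\Theta\times\mathbb R}(\theta^*,\overline\psi(\theta^* )+x)|\le K_{\delta_1}\|(\theta-\theta^*,\overline\psi(\theta)-\overline\psi(\theta^* ))\|_{m+1}$ for all $(\theta,x)\in\Theta\times[-\delta_1,\delta_1]$, and $\mathbb E[H(\theta,t,Z_1)]-\mathbb E[H(\theta,s,Z_1)]=\int_s^t m_{\Theta\times\mathbb R}(\theta,u)\,du$ for all $\theta\in\Theta$ and $t>s$. Let $a,b,\varepsilon>0$, write $\mathfrak l_2:=\mathbf 1_{]0,\infty[}(\mathbb E[L_2(Z_1)])$, and let $n\in\mathbb N$ with $n\ge\max\{\overline M_b^2\Delta(\Theta)^{2\beta}/2,\ \mathfrak l_2\,a^2/\delta_1^2\}$.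 For $\delta\in\,]0,\Delta(\Theta)]$ put $$p_n(\delta):=\mathbb P^*\Big(\Big\{\sup_{\theta\in\mathcal U_\delta}|\mathbb G^{G,H}_n(\theta,\cdot)-\mathbb G^{G,H}_n(\theta^*,\cdot)|>\varepsilon\,n^{-\beta/(4-2\beta)}\Big\}\cap\Omega_{n,a}\cap\Omega^n_{\delta,b}\Big).$$ Then: 1) For every $\delta\in\,]0,\Delta(\Theta)]$, $\ p_n(\delta)\le\big[\overline M_b\,\overline\eta_n(a,b,\delta)+\mathfrak l_2M_{a,b}\big]\,\delta^\beta\,n^{\beta/(4-2\beta)}/\varepsilon$. 2) For every $\delta\in\,]0,\Delta(\Theta)]$ and $t>0$ such that $\delta<\Big(\frac{\varepsilon}{\mathfrak l_2M_{a,b}+\overline M_b\,\eta_{t,n}(a,b,\delta)}\Big)^{1/\beta}n^{-1/(4-2\beta)}$, where $\eta_{t,n}(a,b,\delta):=1+2(t+1)\overline\eta_n(a,b,\delta)$, $$p_n(\delta)\le\exp\Big(\frac{\mathfrak l_2M_{a,b}\,\mathfrak g(t)}{\overline M_b}\Big)\exp\Big(-\frac{\varepsilon\,\mathfrak g(t)}{n^{\beta/(4-2\beta)}\,\delta^\beta\,\overline M_b}\Big)+\mathbb P\big(\Omega\setminus B_n^{\xi^G_{a,b,\delta}}\big).$$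
   Context: Setting. $(\Omega,\mathcal F,\mathbb P)$ is a complete atomless probability space and $(Z_j)_{j\in\mathbb N}$ are i.i.d. $d$-dimensional random vectors on it with common distribution $\mathbb P^Z$; $\mathbb P^*$ is the outer probability of $\mathbb P$. $\Theta\subset\mathbb R^m$ is compact with Euclidean diameter $\Delta(\Theta)>0$; $\|\cdot\|_k$ is the Euclidean norm on $\mathbb R^k$. $x\wedge y$, $x\vee y$ denote min and max, $x^+=x\vee0$. $\|f\|_{\mathbb Q,2}=(\int f^2\,d\mathbb Q)^{1/2}$. $G:\Theta\times\mathbb R^d\to\mathbb R$ and $H:\Theta\times\mathbb R\times\mathbb R^d\to\mathbb R$ are mappings, $\overline\psi(\theta):=\mathbb E[G(\theta,Z_1)]$, $\psi_{H,\Theta}(\theta):=\mathbb E[H(\theta,\overline\psi(\theta),Z_1)]$. The compound empirical process is $\mathbb G^{G,H}_n(\theta,\omega):=\frac1{\sqrt n}\sum_{j=1}^n\Big(H\big(\theta,\frac1n\sum_{k=1}^nG(\theta,Z_k(\omega)),Z_j(\omega)\big)-\psi_{H,\Theta}(\theta)\Big)$. Notation. $\mathcal U_\delta:=\{\theta\in\Theta:\|\theta-\theta^*\|_m\le\delta\}$; $\mathbb F^\Theta:=\{G(\theta,\cdot):\theta\in\Theta\}$; $\mathbb F^\Theta_\delta:=\{G(\theta,\cdot)-G(\theta^*,\cdot):\theta\in\mathcal U_\delta\}$. $(\mathbb P_n-\mathbb P)(f):=\frac1n\sum_{j=1}^n(f(Z_j)-\mathbb E[f(Z_j)])$. Entropy.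 A positive envelope of a class $\mathbb F$ of Borel functions on $\mathbb R^d$ is a strictly positive Borel function $C_{\mathbb F}$ with $\sup_{h\in\mathbb F}|h|\le C_{\mathbb F}$. $N(\eta,\mathbb F,L^2(\mathbb Q))$ is the minimal number of closed $L^2(\mathbb Q)$-balls of radius $\eta$ with centers in $\mathbb F$ needed to cover $\mathbb F$ ($\infty$ if no finite cover exists). $\mathcal M_{\rm fin}$ is the set of probability measures on $\mathcal B(\mathbb R^d)$ with finite support. $J(\mathbb F,C_{\mathbb F},\delta):=\int_0^\delta\sup_{\mathbb Q\in\mathcal M_{\rm fin}}\sqrt{\ln\big(2N(\varepsilon\|C_{\mathbb F}\|_{\mathbb Q,2},\mathbb F,L^2(\mathbb Q))\big)}\,d\varepsilon$. Events (with $\beta$ from (vii)). $\Omega_{n,a}:=\{\sup_{\theta\in\Theta}|(\mathbb P_n-\mathbb P)(G(\theta,\cdot))|\le a/\sqrt n\}$; $\Omega^n_{\delta,b}:=\{\sup_{\theta\in\mathcal U_\delta}|(\mathbb P_n-\mathbb P)(G(\theta,\cdot)-G(\theta^*,\cdot))|\le b\delta^\beta/\sqrt n\}$; $B_n^\xi:=\{\frac1n\sum_{j=1}^n\xi(Z_j)^2\le2\,\mathbb E[\xi(Z_1)^2]\}$. Functions and constants. $\xi^G_{a,b,\delta}:=\sqrt{(L_1\vee1)^2(\xi^G_\delta)^2+L_2^2\,(b+\overline M_1)^2\,\delta^{2\beta}}$; $M_{a,b}:=K_{\delta_1}a[\Delta(\Theta)^{1-\beta}+\overline M_1]+b\,\mathbb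 E[L_2(Z_1)]$; $\overline M_b:=\overline M_1(1+\|L_2\|_{\mathbb P^Z,2})+b\|L_2\|_{\mathbb P^Z,2}$; $\mathfrak g(t):=\frac{t^2}{8(t+1)(5t+28)}$; $\overline\eta_n(a,b,\delta):=64\sqrt2\,\overline M^1+32\sqrt{\ln(24)+[\ln(a/b)-\ln(\sqrt n\,\delta^\beta)]^+}$. *)

(* Defs.v *)
From HB Require Import structures.
From mathcomp Require Import all_boot all_order all_algebra.
From mathcomp Require Import all_classical all_reals all_analysis.

Set Implicit Arguments.
Unset Strict Implicit.
Unset Printing Implicit Defensive.

Import Order.TTheory GRing.Theory Num.Theory.
Import numFieldNormedType.Exports.

Local Open Scope classical_set_scope.
Local Open Scope ring_scope.

(* R^k is 'rV[R]_k; its topology in the library is that of the sup norm, which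
   is the Euclidean one, and [borel R k] is R^k with its Borel sigma-algebra. *)
Notation borel R k := (g_sigma_algebraType (@open 'rV[R]_k)).

Section Euclidean.
Context {R : realType}.

Definition enorm {k} (v : 'rV[R]_k) : R := Num.sqrt (\sum_(i < k) v ord0 i ^+ 2).

Definition diam {k} (A : set 'rV[R]_k) : R :=
  sup [set enorm (x - y) | x in A & y in A].

(* {theta in Theta : ||theta - theta0|| <= delta} *)
Definition nbhd {k} (Theta : set 'rV[R]_k) (theta0 : 'rV[R]_k) (delta : R) :
    set 'rV[R]_k :=
  [set theta | Theta theta /\ enorm (theta - theta0) <= delta].

End Euclidean.

Section Probability.
Context {d : measure_display} {T : measurableType d} {R : realType}.

Definition atomless (P : probability T R) : Prop :=
  forall A, measurable A -> (0 < P A)%E ->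
  exists B, [/\ measurable B, B `<=` A, (0 < P B)%E & (P B < P A)%E].

Definition mutually_independent {d'} {T' : measurableType d'}
    (P : probability T R) (X : nat -> {RV P >-> T'}) : Prop :=
  forall (J : seq nat) (A : nat -> set T'),
  uniq J -> (forall j, measurable (A j)) ->
  P (\bigcap_(j in [set` J]) (X j @^-1` A j)) =
    (\prod_(j <- J) P (X j @^-1` A j))%E.
Arguments mutually_independent {d'} {T'} P X.

(* Equality of laws is only asked on measurable sets: a measure of the library
   is unspecified elsewhere. *)
Definition iid_with_law {d'} {T' : measurableType d'} (P : probability T R)
    (X : nat -> {RV P >-> T'}) (Q : probability T' R) : Prop :=
  mutually_independent P X /\
  forall j A, measurable A -> distribution P (X j) A = Q A.

Definition mean (P : probability T R) (X : T -> R) : R := fine 'E_P[X]%E.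

Definition L2norm (Q : {measure set T -> \bar R}) (f : T -> R) : \bar R :=
  'N[Q]_2%:E [EFin \o f]%E.

End Probability.
Arguments mutually_independent {d T R d' T'} P X.
Arguments iid_with_law {d T R d' T'} P X Q.

Section ProductPower.
Context {d : measure_display} {T : measurableType d} {R : realType}.

Definition tuple_cons n (p : T * n.-tuple T) : n.+1.-tuple T :=
  [the n.+1.-tuple T of p.1 :: p.2].

Lemma measurable_tuple_cons n : measurable_fun setT (@tuple_cons n).
Proof. exact: (measurable_cons measurable_fst measurable_snd). Qed.

HB.instance Definition _ n :=
  @isMeasurableFun.Build _ _ (T * n.-tuple T)%type (n.+1.-tuple T) (@tuple_cons n)
    (@measurable_tuple_cons n).

Fixpoint power_measure (Q : probability T R) (n : nat) :
    probability (n.-tuple T) R :=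
  match n with
  | 0 => \d_([tuple] : 0.-tuple T)
  | n'.+1 => distribution (Q \x power_measure Q n')%E (@tuple_cons n')
  end.

End ProductPower.

Section Classes.
Context {R : realType} {m k : nat}.
Implicit Types (G : 'rV[R]_m -> 'rV[R]_k -> R) (Theta : set 'rV[R]_m).

Definition param_class G Theta : set ('rV[R]_k -> R) :=
  [set G theta | theta in Theta].

Definition centered_class G Theta thetas (delta : R) : set ('rV[R]_k -> R) :=
  [set (fun z => G theta z - G thetas z) | theta in nbhd Theta thetas delta].

End Classes.

Section Entropy.
Context {R : realType} {k : nat}.
Implicit Types (F : set ('rV[R]_k -> R)) (C : 'rV[R]_k -> R).
Implicit Type Q : probability (borel R k) R.

Definition pos_envelope F C : Prop :=
  [/\ measurable_fun [set: borel R k] C,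
      forall z, 0 < C z &
      forall f z, F f -> `|f z| <= C z].

(* Least number of closed L^2(Q)-balls of radius eta with centres in F that
   cover F; +oo, the infimum of the empty set, if no finite cover exists. *)
Definition covering_number (eta : \bar R) F Q : \bar R :=
  ereal_inf [set N%:R%:E | N in [set N : nat |
    exists2 c : 'I_N -> 'rV[R]_k -> R, (forall i, F (c i)) &
      forall f, F f ->
        exists i, (L2norm Q (fun z => f z - c i z)%R <= eta)%E]].

Definition finitely_supported : set (probability (borel R k) R) :=
  [set Q | exists2 S : set 'rV[R]_k, finite_set S & Q S = 1%E].

Definition entropy_integral F C (delta : R) : \bar R :=
  (\int[lebesgue_measure]_(e in `]0%R, delta])
    ereal_sup [set
      lne (2%:E * covering_number (e%:E * L2norm Q C) F Q) `^ 2^-1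
      | Q in finitely_supported])%E.

End Entropy.

(* Sequences are indexed from 0: the Z_1, ..., Z_n of the mathematics are
   Z 0, ..., Z n.-1. *)
Section EmpiricalProcess.
Context {d : measure_display} {Omega : measurableType d} {R : realType}.
Context (P : probability Omega R) {m k : nat}.
Context (Z : nat -> {RV P >-> borel R k}).
Context (G : 'rV[R]_m -> 'rV[R]_k -> R) (H : 'rV[R]_m -> R -> 'rV[R]_k -> R).
Implicit Types (theta : 'rV[R]_m) (f : 'rV[R]_k -> R) (n : nat) (w : Omega).

Definition psibar theta : R := mean P (fun w => G theta (Z 0%N w)).

Definition psiH theta : R := mean P (fun w => H theta (psibar theta) (Z 0%N w)).

(* (P_n - P)(f) *)
Definition empirical_dev n f w : R :=
  n%:R^-1 * \sum_(j < n) (f (Z j w) - mean P (f \o Z j)).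

Definition compound_process n theta w : R :=
  (Num.sqrt n%:R)^-1 *
  \sum_(j < n)
    (H theta (n%:R^-1 * \sum_(i < n) G theta (Z i w)) (Z j w) - psiH theta).

Definition event_global (Theta : set 'rV[R]_m) n (a : R) : set Omega :=
  [set w | (ereal_sup [set `|empirical_dev n (G theta) w|%:E | theta in Theta]
            <= (a / Num.sqrt n%:R)%:E)%E].

Definition event_local (Theta : set 'rV[R]_m) (thetas : 'rV[R]_m)
    (beta : R) n (delta b : R) : set Omega :=
  [set w | (ereal_sup
              [set `|empirical_dev n (fun z => G theta z - G thetas z) w|%:E
              | theta in nbhd Theta thetas delta]
            <= (b * delta `^ beta / Num.sqrt n%:R)%:E)%E].

Definition event_square n f : set Omega :=
  [set w | n%:R^-1 * \sum_(j < n) f (Z j w) ^+ 2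
           <= 2 * mean P (fun w' => f (Z 0%N w') ^+ 2)].

End EmpiricalProcess.

(* [EL2] stands for E[L_2(Z_1)], [nL2] for the L^2(P^Z)-norm of L_2, [Delta]
   for the diameter of Theta, [Mlo] and [Mup] for the constants written M
   with a lower, resp. upper, index 1. *)
Section Constants.
Context {R : realType}.
Implicit Types a b beta delta t K Delta Mlo Mup : R.

Definition xi_ab {T : Type} (L1 L2 xi : T -> R) Mlo beta b delta (z : T) : R :=
  Num.sqrt (Num.max (L1 z) 1 ^+ 2 * xi z ^+ 2
            + L2 z ^+ 2 * (b + Mlo) ^+ 2 * delta `^ (2 * beta)).

Definition M_ab K Delta beta Mlo (EL2 : R) a b : R :=
  K * a * (Delta `^ (1 - beta) + Mlo) + b * EL2.

Definition Mbar Mlo (nL2 : R) b : R := Mlo * (1 + nL2) + b * nL2.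

Definition gfrak t : R := t ^+ 2 / (8 * (t + 1) * (5 * t + 28)).

Definition etabar Mup beta (n : nat) a b delta : R :=
  64 * Num.sqrt 2 * Mup
  + 32 * Num.sqrt (ln 24 + Num.max
           (ln (a / b) - ln (Num.sqrt n%:R * delta `^ beta)) 0).

Definition eta_t Mup beta t (n : nat) a b delta : R :=
  1 + 2 * (t + 1) * etabar Mup beta n a b delta.

End Constants.

(* Main.v *)
From HB Require Import structures.
Require Import Defs.
From mathcomp Require Import all_boot all_order all_algebra.
From mathcomp Require Import all_classical all_reals all_analysis.
From mathcomp Require Import measurable_realfun.
From mathcomp Require Import ring lra.

(* On Omega_{n,a} and Omega^n_{delta,b} the sample mean of G(theta*, .) is within
   a' = a / sqrt n of its expectation and the sample means of G(theta, .) and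
   G(theta*, .) differ by at most D = (b + M_1) delta^beta.  So, up to a drift of
   l_2 M_{a,b} delta^beta controlled by (viii), the increment of the compound
   process is a centred empirical sum over the class of functions
     H(theta, psi* + a' q + D r, .) - H(theta*, psi* + a' q, .),  q, r in [-1, 1],
   whose envelope is xi_{a,b,delta} and which is covered by a product of a cover
   of the class of the G(theta, .) and of grids for q and r; the grid for q costs
   the term ln(a / b) - ln(sqrt n delta^beta).  By (vi) the supremum may be taken
   over a countable subclass.

   The tail of this supremum is bounded without integrating it.  Comparing the
   sample with an independent copy, for which Chebyshev's inequality controls one
   fixed function with probability at least 1/4, and exchanging coordinates of the
   two samples reduces the claim to counting the sign vectors for which some
   Rademacher sum is large; that count is bounded by dyadic chaining. *)

Set Implicit Arguments.
Unset Strict Implicit.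
Unset Printing Implicit Defensive.

Import Order.TTheory GRing.Theory Num.Theory.
Import numFieldNormedType.Exports.
Local Open Scope classical_set_scope.
Local Open Scope ring_scope.

(** * Chaining for Rademacher sums *)

(** The obstacle is that [H] is evaluated at a random second argument. Replacing it by the
    coordinates q and r makes the class deterministic, at the cost of a range a' for q that need not
    be small compared with delta^beta. Both terms of a member of the class carry the same shift a'
    q, so it cancels in the envelope, and in the chaining bound a enters only through the size of a
    grid. Levels are measured in units of s = [Mb] delta^beta, a bound for the L^2 norm of the
    envelope; y is the level left once the drift is subtracted. The first claim splits according to
    whether the sum of squares exceeds 2 (y / eta) n s^2, each part having probability at most eta /
    (2 y). The second splits at 2 n s^2 and uses the tail e^(-y / 40), where 1 / 40 is the supremum
    of [gfrak], so that one estimate serves every t. As the supremum of the process need not be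
    measurable, its event is covered by a null set and a measurable set of samples, and only this
    cover is estimated. *)

Section Rademacher.
Context {R : realType}.

Lemma fact2_ge k : (2 ^ k * k`! <= k.*2`!)%N.
Proof.
elim: k => // k IH; rewrite doubleS !factS expnS.
rewrite (_ : 2 * 2 ^ k * (k.+1 * k`!) = k.*2.+2 * (2 ^ k * k`!))%N; last first.
  by rewrite -muln2; ring.
rewrite leq_mul2l/=; apply: (leq_trans IH); exact: leq_pmull.
Qed.

(** Odd terms cancel, and x^(2k) / (2k)! is at most (x^2 / 2)^k / k! by [fact2_ge]; hence 2k terms
    on the left face k terms on the right. *)
Lemma exp_coeff_cosh_le (x : R) k :
  series (exp_coeff x) k.*2 + series (exp_coeff (- x)) k.*2 <=
  2 * series (exp_coeff (x ^+ 2 / 2)) k.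
Proof.
elim: k => [|k IH]; first by rewrite /series/= !big_geq// mulr0 addr0.
have sS (u : R^nat) m : series u m.+1 = series u m + u m.
  by rewrite /series/= big_nat_recr.
rewrite doubleS !sS mulrDr.
have -> (a b c d e f : R) : a + b + c + (d + e + f) = (a + d) + (b + e) + (c + f).
  by ring.
have -> : exp_coeff x k.*2.+1 + exp_coeff (- x) k.*2.+1 = 0.
  rewrite /exp_coeff /= -mulrDl (_ : _ + _ = 0) ?mul0r//.
  by rewrite !exprS -mul2n !exprM sqrrN; ring.
have -> : exp_coeff x k.*2 + exp_coeff (- x) k.*2 = 2 * ((x ^+ 2) ^+ k / k.*2`!%:R).
  by rewrite /exp_coeff /= -mul2n !exprM sqrrN; ring.
rewrite addr0; apply: lerD => //; rewrite /exp_coeff /=.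
rewrite ler_pM2l// expr_div_n -mulrA ler_wpM2l//.
  by rewrite exprn_ge0// sqr_ge0.
rewrite -natrX -invfM -natrM lef_pV2 ?posrE ?ltr0n ?muln_gt0 ?expn_gt0 ?fact_gt0//.
by rewrite ler_nat fact2_ge.
Qed.

Lemma expR_cosh_le (x : R) : expR x + expR (- x) <= 2 * expR (x ^+ 2 / 2).
Proof.
have cvgx y : (series (exp_coeff y)) @ \oo --> (expR y : R).
  exact: is_cvg_series_exp_coeff.
(* Only partial sums of even length are compared, so the limit is taken along them. *)
have dbl : ((fun n => n.*2) @ \oo --> \oo)%classic.
  move=> A [k _ kA]; exists k => // j /= kj; apply: kA => /=.
  by rewrite (leq_trans kj)// -addnn leq_addr.
have h0 : (series (exp_coeff x) \+ series (exp_coeff (- x))) @ \oo -->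
    (expR x + expR (- x) : R) by exact: cvgD.
have h := cvg_comp _ _ dbl h0.
have <- := cvg_lim (@Rhausdorff R) h.
apply: limr_le; first by apply: cvgP h.
near=> n; apply: (le_trans (exp_coeff_cosh_le x n)).
rewrite ler_pM2l//.
apply: (nondecreasing_cvgn_le (u_ := series (exp_coeff (x ^+ 2 / 2)))).
  apply: nondecreasing_series => k _ _; rewrite /exp_coeff/= divr_ge0//.
  by rewrite exprn_ge0// divr_ge0// sqr_ge0.
apply: cvgP; exact: cvgx.
Unshelve. all: by end_near. Qed.

Definition rsign {n} (s : {ffun 'I_n -> bool}) (j : 'I_n) : R := (-1) ^+ (s j).

Definition rsum {n} (c : 'I_n -> R) (s : {ffun 'I_n -> bool}) : R :=
  \sum_(j < n) rsign s j * c j.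

(** Independence of the signs in counting form: the exponential is a product over coordinates, so
    the sum over all sign vectors is a product of sums of two terms, each at most 2 e^(c_j^2 /
    2). *)
Lemma sum_expR_rsum n (c : 'I_n -> R) :
  \sum_(s : {ffun 'I_n -> bool}) expR (rsum c s) <=
  2 ^+ n * expR (\sum_(j < n) c j ^+ 2 / 2).
Proof.
rewrite (eq_bigr (fun s : {ffun 'I_n -> bool} =>
   \prod_(j < n) expR ((-1) ^+ (s j) * c j))); last first.
  by move=> s _; rewrite expR_sum.
rewrite -(bigA_distr_bigA (fun j (b : bool) => expR ((-1) ^+ b * c j))).
have -> : (2 : R) ^+ n = \prod_(j < n) 2 by rewrite prodr_const card_ord.
rewrite expR_sum -big_split /=; apply: ler_prod => j _.
rewrite big_bool /= expr1 expr0 mul1r mulN1r addr_ge0 ?expR_ge0//=.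
by rewrite addrC expR_cosh_le.
Qed.

(** The Chernoff bound for uniform signs, with the probability multiplied by 2^n to become a
    cardinality. *)
Lemma rsum_gt_card n (c : 'I_n -> R) (V u : R) : 0 < V -> 0 <= u ->
  \sum_(j < n) c j ^+ 2 <= V ->
  #|[set s | rsum c s > u]%SET|%:R <= 2 ^+ n * expR (- (u ^+ 2 / (2 * V))) :> R.
Proof.
move=> V0 u0 cV; set S := finset _.
have [->|un0] := eqVneq u 0.
  rewrite expr0n/= mul0r oppr0 expR0 mulr1 -natrX ler_nat.
  by rewrite (leq_trans (max_card _))// card_ffun card_bool card_ord.
(* Minimizes l^2 V / 2 - l u. *)
pose l := u / V.
have l0 : 0 <= l by rewrite divr_ge0// ltW.
have : #|S|%:R * expR (l * u) <= 2 ^+ n * expR (l ^+ 2 * V / 2).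
  apply: (@le_trans _ _ (\sum_(s : {ffun 'I_n -> bool})
      expR (rsum (fun j => l * c j) s))).
    rewrite (bigID (mem S)) /= -[leLHS]addr0; apply: lerD; last first.
      by apply: sumr_ge0 => s _; exact: expR_ge0.
    rewrite mulr_natl -sumr_const; apply: ler_sum => s; rewrite inE => /ltW us.
    rewrite ler_expR [leRHS](_ : _ = l * rsum c s) ?ler_wpM2l//.
    by rewrite /rsum mulr_sumr; apply: eq_bigr => j _; rewrite mulrCA.
  apply: (le_trans (sum_expR_rsum _)); rewrite ler_pM2l ?exprn_gt0// ler_expR.
  rewrite -mulr_suml ler_pM2r ?invr_gt0//.
  rewrite (eq_bigr (fun j => l ^+ 2 * c j ^+ 2)); last by move=> j _; rewrite exprMn.
  by rewrite -mulr_sumr ler_wpM2l// sqr_ge0.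
rewrite -ler_pdivlMr ?expR_gt0// => /le_trans; apply.
rewrite -expRN -[leLHS]mulrA -expRD; apply: ler_wpM2l; first exact: exprn_ge0.
rewrite ler_expR /l le_eqVlt; apply/orP; left; apply/eqP; field.
by rewrite gt_eqF.
Qed.

Lemma abs_rsum_gt_card n (c : 'I_n -> R) (V u : R) : 0 < V -> 0 <= u ->
  \sum_(j < n) c j ^+ 2 <= V ->
  #|[set s | `|rsum c s| > u]%SET|%:R <=
    2 ^+ n * (2 * expR (- (u ^+ 2 / (2 * V)))) :> R.
Proof.
move=> V0 u0 cV; pose c' j := - c j.
have c'V : \sum_(j < n) c' j ^+ 2 <= V.
  by under eq_bigr do rewrite sqrrN.
have h1 := rsum_gt_card V0 u0 cV.
have h2 := rsum_gt_card V0 u0 c'V.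
have -> : 2 ^+ n * (2 * expR (- (u ^+ 2 / (2 * V)))) =
  2 ^+ n * expR (- (u ^+ 2 / (2 * V))) + 2 ^+ n * expR (- (u ^+ 2 / (2 * V))).
  by ring.
apply: le_trans (lerD h1 h2); rewrite -natrD ler_nat.
apply: leq_trans (leq_card_setU _ _).1; apply: subset_leq_card.
apply/fintype.subsetP => s; rewrite !inE.
have -> : rsum c' s = - rsum c s.
  by rewrite /rsum -sumrN; apply: eq_bigr => j _; rewrite mulrN.
by rewrite lter_normr /=.
Qed.

Lemma abs_rsumB n (c d : 'I_n -> R) s :
  `|rsum c s| <= `|rsum (fun j => c j - d j) s| + `|rsum d s|.
Proof.
rewrite (_ : rsum c s = rsum (fun j => c j - d j) s + rsum d s) ?ler_normD//.
by rewrite /rsum -big_split/=; apply: eq_bigr => j _; ring.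
Qed.

(** Crude, but it serves only for the remainder of a truncated chain, where n is fixed and V tends
    to 0 with the truncation level. *)
Lemma abs_rsum_le n (c : 'I_n -> R) V s : 0 <= V ->
  \sum_(j < n) c j ^+ 2 <= V ^+ 2 -> `|rsum c s| <= n%:R * V.
Proof.
move=> V0 cV; rewrite /rsum; apply: (le_trans (ler_norm_sum _ _ _)).
rewrite mulr_natl -[X in V *+ X]card_ord -sumr_const; apply: ler_sum => j _.
rewrite normrM /rsign normrX normrN1 expr1n mul1r.
rewrite -ler_sqr ?nnegrE// real_normK ?num_real//.
rewrite (le_trans _ cV)// (bigD1 j)//= lerDl.
by apply: sumr_ge0 => *; exact: sqr_ge0.
Qed.

Lemma sum_half_pow_le1 K : \sum_(k < K) (2 ^+ k.+1)^-1 <= 1 :> R.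
Proof.
have -> : \sum_(k < K) (2 ^+ k.+1)^-1 = 1 - (2 ^+ K)^-1 :> R.
  elim: K => [|K IH]; first by rewrite big_ord0 expr0 invr1 subrr.
  rewrite big_ord_recr /= IH exprS.
  by field; rewrite expf_neq0// pnatr_eq0.
by rewrite gerBl invr_ge0 exprn_ge0.
Qed.

Section Chaining.
Context {I : Type} {n : nat} (x : I -> 'I_n -> R) (V tau B : R).
Context (N : nat -> nat) (c : forall k, 'I_(N k) -> I) (b : nat -> R).
Hypothesis V_gt0 : 0 < V.
Hypothesis xV : forall i, \sum_(j < n) x i j ^+ 2 <= V.
Hypothesis cover : forall k i, exists l : 'I_(N k),
  \sum_(j < n) (x i j - x (c l) j) ^+ 2 <= V * (4 ^+ k.+1)^-1.
Hypothesis b_ge0 : forall k, 0 <= b k.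
Hypothesis b_tail : forall k,
  (N k)%:R * (2 * expR (- (b k ^+ 2 * 4 ^+ k / 2))) <= expR (- tau) * (2 ^+ k.+1)^-1.
Hypothesis b_sum : forall K, \sum_(k < K) b k <= B.

Let p k i : 'I_(N k) := projT1 (cid (cover k i)).

(** The links of the chain. The predecessor of a centre is the one assigned to that centre, not to
    the original index. Hence level k has only [N k] links, and the union bound involves no product
    of two covering numbers. *)
Let v (k : nat) : 'I_(N k) -> 'I_n -> R :=
  match k return 'I_(N k) -> 'I_n -> R with
  | 0 => fun l => x (c l)
  | k'.+1 => fun l j => x (c l) j - x (c (p k' (c l))) j
  end.

Let v_norm k (l : 'I_(N k)) : \sum_(j < n) v l j ^+ 2 <= V * (4 ^+ k)^-1.
Proof.
case: k l => [|k] l /=; first by rewrite expr0 invr1 mulr1.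
by rewrite /p; case: cid.
Qed.

Let bad k := [set s | [exists l : 'I_(N k), `|rsum (v l) s| > Num.sqrt V * b k]]%SET.

Let card_bad k : #|bad k|%:R <= 2 ^+ n * (expR (- tau) * (2 ^+ k.+1)^-1).
Proof.
apply: (@le_trans _ _ (\sum_(l < N k) #|[set s | `|rsum (v l) s| > Num.sqrt V * b k]%SET|%:R)).
  rewrite -natr_sum ler_nat.
  have -> : bad k = (\bigcup_(l < N k) [set s | `|rsum (v l) s| > Num.sqrt V * b k]%SET)%SET.
    apply/setP => s; rewrite inE; apply/existsP/bigcupP => [[l sl]|[l _]].
      by exists l; rewrite ?inE.
    by rewrite inE; exists l.
  elim/big_ind2: _ => [|A1 a1 A2 a2 h1 h2|//]; first by rewrite cards0.
  by rewrite (leq_trans (leq_card_setU _ _))// leq_add.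
apply: (@le_trans _ _ (\sum_(l < N k) 2 ^+ n * (2 * expR (- (b k ^+ 2 * 4 ^+ k / 2))))).
  apply: ler_sum => l _.
  have V4 : 0 < V * (4 ^+ k)^-1 by rewrite mulr_gt0 ?invr_gt0 ?exprn_gt0.
  have u0 : 0 <= Num.sqrt V * b k by rewrite mulr_ge0 ?sqrtr_ge0.
  have := abs_rsum_gt_card V4 u0 (v_norm l).
  rewrite exprMn (sqr_sqrtr (ltW V_gt0)) (_ : V * b k ^+ 2 / (2 * (V / 4 ^+ k)) = b k ^+ 2 * 4 ^+ k / 2)//.
  by field; rewrite expf_neq0 ?gt_eqF.
rewrite sumr_const card_ord -[leLHS]mulr_natl [leLHS]mulrCA.
by rewrite ler_wpM2l// exprn_ge0.
Qed.

(** Telescoping from a centre of level K down to level 0, each link contributing at most its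
    threshold. *)
Let center_bound s K : (forall k, (k <= K)%N -> s \notin bad k) ->
  forall l : 'I_(N K), `|rsum (x (c l)) s| <= Num.sqrt V * \sum_(k < K.+1) b k.
Proof.
have nb k (l : 'I_(N k)) : s \notin bad k -> `|rsum (v l) s| <= Num.sqrt V * b k.
  by rewrite inE negb_exists => /forallP /(_ l); rewrite -leNgt.
elim: K => [|K IH] good l.
  by rewrite big_ord_recr big_ord0 /= add0r; apply: (nb 0%N l); exact: good.
rewrite big_ord_recr /= mulrDr addrC.
apply: (le_trans (abs_rsumB _ (x (c (p K (c l)))) _)); apply: lerD.
  by apply: (nb K.+1 l); exact: good.
by apply: IH => k kK; apply: good; rewrite leqW.
Qed.

(* A fixed sign vector for which some sum exceeds the bound does so by a positive
   gap, while truncating the chain at level K changes that sum by at most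
   n sqrt V 2^-(K+1).  Hence some link of the chain is already too large. *)
Lemma chaining :
  #|[set s | `[< exists i, Num.sqrt V * B < `|rsum (x i) s| >]]%SET|%:R
  <= 2 ^+ n * expR (- tau) :> R.
Proof.
set S := finset _.
have wit s : s \in S -> exists k, s \in bad k.
  rewrite inE => /asboolP[i iB]; apply: contrapT => /forallNP nobad.
  set g := `|rsum (x i) s| - Num.sqrt V * B.
  have g0 : 0 < g by rewrite subr_gt0.
  have [K] : exists K : nat, n%:R * Num.sqrt V / g < K%:R.
    by exists (Num.bound (n%:R * Num.sqrt V / g)); apply: archi_boundP;
      rewrite divr_ge0 ?mulr_ge0 ?sqrtr_ge0// ltW.
  rewrite ltr_pdivrMr// => Kg.
  have good k : (k <= K)%N -> s \notin bad k by move=> _; apply/negP/nobad.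
  have h1 := center_bound good (p K i).
  have h2 := abs_rsumB (x i) (x (c (p K i))) s.
  have h3 : `|rsum (fun j => x i j - x (c (p K i)) j) s| <= n%:R * (Num.sqrt V * (2 ^+ K.+1)^-1).
    apply: abs_rsum_le; first by rewrite mulr_ge0 ?sqrtr_ge0// invr_ge0 exprn_ge0.
    rewrite /p; case: cid => l /= /le_trans; apply.
    rewrite exprMn (sqr_sqrtr (ltW V_gt0)) exprVn (_ : 4 = 2 ^+ 2 :> R); last by ring.
    by rewrite -!exprM mulnC.
  have h4 : Num.sqrt V * \sum_(k < K.+1) b k <= Num.sqrt V * B.
    by rewrite ler_wpM2l ?sqrtr_ge0.
  have h5 : n%:R * (Num.sqrt V * (2 ^+ K.+1)^-1) < g.
    rewrite mulrA ltr_pdivrMr ?exprn_gt0// (lt_trans Kg)// mulrC ltr_pM2l//.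
    by rewrite -natrX ltr_nat; exact: ltnW (ltn_expl K.+1 _).
  by move: h5; rewrite /g; lra.
(* One bad level for each sign vector of [S]. There are finitely many sign vectors, so these levels
   are bounded and a finite union of the sets [bad k] covers [S]. *)
pose w s := if pselect (s \in S) is left h then projT1 (cid (wit s h)) else 0%N.
pose K := (\max_(s : {ffun 'I_n -> bool}) w s).+1.
have sub : (S \subset \bigcup_(k < K) bad k)%SET.
  apply/fintype.subsetP => s sS; apply/finset.bigcupP.
  have wb : s \in bad (w s) by rewrite /w; case: pselect => // h; case: cid.
  have wK : (w s < K)%N by rewrite ltnS; exact: (leq_bigmax (F := w)).
  by exists (Ordinal wK).
apply: (@le_trans _ _ (\sum_(k < K) #|bad k|%:R)).
  rewrite -natr_sum ler_nat (leq_trans (subset_leq_card sub))//.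
  elim/big_ind2: _ => [|A1 a1 A2 a2 h1 h2|//]; first by rewrite cards0.
  by rewrite (leq_trans (leq_card_setU _ _))// leq_add.
apply: (@le_trans _ _ (\sum_(k < K) 2 ^+ n * (expR (- tau) * (2 ^+ k.+1)^-1))).
  by apply: ler_sum => k _.
rewrite -mulr_sumr ler_wpM2l ?exprn_ge0// -mulr_sumr.
by rewrite -[leRHS]mulr1 ler_wpM2l ?expR_ge0// sum_half_pow_le1.
Qed.

End Chaining.

End Rademacher.

(** * Powers of a probability measure and samples *)

Section PowerMeasure.
Context {R : realType}.
Local Open Scope ereal_scope.

Section One.
Context {d} {T : measurableType d} (Q : probability T R).
Implicit Types n : nat.

Lemma measurable_tuple_cons_preimage n (D : set (n.+1.-tuple T)) :
  measurable D -> measurable (@tuple_cons _ T n @^-1` D).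
Proof. by move=> mD; rewrite -[X in measurable X]setTI; exact: measurable_tuple_cons. Qed.

Lemma xsection_tuple_cons n (D : set (n.+1.-tuple T)) x :
  xsection (@tuple_cons _ T n @^-1` D) x = [set t | D (tuple_cons (x, t))].
Proof. by apply/seteqP; split => t; rewrite /xsection /= inE. Qed.

Lemma measurable_slice n (D : set (n.+1.-tuple T)) x :
  measurable D -> measurable [set t : n.-tuple T | D (tuple_cons (x, t))].
Proof.
move=> mD; rewrite -xsection_tuple_cons; apply: measurable_xsection.
exact: measurable_tuple_cons_preimage.
Qed.

Lemma measurable_power_slice n (D : set (n.+1.-tuple T)) : measurable D ->
  measurable_fun [set: T] (fun x => power_measure Q n [set t | D (tuple_cons (x, t))]).
Proof.
move=> mD.
have := measurable_fun_xsection (power_measure Q n) (measurable_tuple_cons_preimage mD).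
by congr (measurable_fun _ _); apply/funext => x /=; rewrite xsection_tuple_cons.
Qed.

Lemma power_measureS n (D : set (n.+1.-tuple T)) : measurable D ->
  power_measure Q n.+1 D =
  \int[Q]_x power_measure Q n [set t | D (tuple_cons (x, t))].
Proof.
move=> mD; rewrite /= /distribution /pushforward /product_measure1 /=.
by apply: eq_integral => x _; rewrite /= xsection_tuple_cons.
Qed.

Lemma ge0_integral_power_measureS n (f : n.+1.-tuple T -> \bar R) :
  measurable_fun setT f -> (forall t, 0 <= f t) ->
  \int[power_measure Q n.+1]_t f t =
  \int[Q]_x \int[power_measure Q n]_t f (tuple_cons (x, t)).
Proof.
move=> mf f0; rewrite /= ge0_integral_distribution// fubini_tonelli1//=.
exact: measurableT_comp.
Qed.

(** The map may depend on the coordinate, as an exchange at selected indices does. The induction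
    removes the first coordinate and shifts the family [g]. *)
Lemma power_measure_map (g : nat -> T -> T) n :
  (forall j, measurable_fun setT (g j)) ->
  (forall j A, measurable A -> Q (g j @^-1` A) = Q A) ->
  forall D : set (n.-tuple T), measurable D ->
  power_measure Q n [set u | D [tuple g (val j) (tnth u j) | j < n]] = power_measure Q n D.
Proof.
move=> + + D; elim: n g D => [|n IH] g D mg gQ mD.
  by rewrite (_ : [set u | _] = D)//; apply/seteqP; split => u /=;
    rewrite [X in D X -> _]tuple0 [in X in _ -> X]tuple0.
have tcE x (t : n.-tuple T) : [tuple g (val j) (tnth (tuple_cons (x, t)) j) | j < n.+1] =
    tuple_cons (g 0%N x, [tuple g (val j).+1 (tnth t j) | j < n]).
  apply: eq_from_tnth => j; rewrite tnth_mktuple.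
  case: (unliftP ord0 j) => [i|] ->; last by rewrite /tuple_cons /= !tnth0.
  by rewrite /tuple_cons /= !tnthS tnth_mktuple.
have mmap : measurable_fun setT (fun u : n.+1.-tuple T => [tuple g (val j) (tnth u j) | j < n.+1]).
  apply/measurable_fun_tnthP => i.
  rewrite (_ : _ \o _ = g (val i) \o @tnth _ T ^~ i); last first.
    by apply/funext => u /=; rewrite tnth_mktuple.
  by apply: measurableT_comp => //; exact: measurable_tnth.
rewrite power_measureS; last by rewrite -[X in measurable X]setTI; exact: mmap.
transitivity (\int[Q]_x power_measure Q n [set t | D (tuple_cons (g 0%N x, t))]).
  apply: eq_integral => x _.
  rewrite -(IH (fun j => g j.+1) [set t | D (tuple_cons (g 0%N x, t))])//; last first.
    exact: measurable_slice.
    by move=> j A; exact: gQ.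
  by apply: congr1; apply/seteqP; split => t /=; rewrite tcE.
rewrite power_measureS//.
pose g0 : {mfun T >-> T} := HB.pack (g 0%N) (isMeasurableFun.Build _ _ _ _ _ (mg 0%N)).
transitivity (\int[distribution Q g0]_x
   power_measure Q n [set t | D (tuple_cons (x, t))]).
  by rewrite ge0_integral_distribution//; exact: measurable_power_slice.
by apply: eq_measure_integral => A mA _; exact: gQ.
Qed.

(** The additive constant makes the induction close: with the first coordinate x fixed, integrating
    out the others is the same statement with c + f x in place of c. For c = 0 this is the variance
    of a centred sum. *)
Lemma integral_power_sqr_sum (f : T -> R) (v : R) n (c : R) :
  measurable_fun setT f -> (\int[Q]_x (f x)%:E = 0)%E ->
  Q.-integrable setT (EFin \o f) ->
  Q.-integrable setT (fun x => (f x ^+ 2)%:E) ->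
  \int[Q]_x (f x ^+ 2)%:E = v%:E ->
  \int[power_measure Q n]_t ((c + \sum_(j < n) f (tnth t j)) ^+ 2)%:E =
  (c ^+ 2 + n%:R * v)%:E.
Proof.
move=> mf f0 intf intf2 fv.
have msum k c' : measurable_fun setT
    (fun t : k.-tuple T => ((c' + \sum_(j < k) f (tnth t j)) ^+ 2)%:E).
  apply/measurable_EFinP; apply: measurable_funX; apply: measurable_funD => //.
  by apply: measurable_sum => j; apply: measurableT_comp => //; exact: measurable_tnth.
elim: n c => [|n IH] c.
  rewrite /= integral_dirac//=; last exact: (msum 0%N c).
  by rewrite diracT mul1e big_ord0 addr0 mul0r addr0.
rewrite ge0_integral_power_measureS//; last by move=> t; rewrite lee_fin sqr_ge0.
transitivity (\int[Q]_x ((f x ^+ 2)%:E + ((2 * c)%:E * (f x)%:E + (c ^+ 2 + n%:R * v)%:E))).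
  apply: eq_integral => x _.
  rewrite -!EFinM -!EFinD [RHS](_ : _ = ((c + f x) ^+ 2 + n%:R * v)%:E); last by congr EFin; ring.
  rewrite -IH; apply: eq_integral => t _.
  rewrite big_ord_recl tnth0 addrA; congr (((_ + _) ^+ 2)%:E).
  by apply: eq_bigr => j _; rewrite /tuple_cons /= tnthS.
have h0 : Q.-integrable setT (EFin \o cst (c ^+ 2 + n%:R * v)%R).
  by apply: finite_measure_integrable_cst.
have h1 : Q.-integrable setT (fun x => (2 * c)%:E * (f x)%:E).
  exact: integrableZl.
rewrite integralD//=; last exact: integrableD.
rewrite integralD//= integralZl//= f0 mule0 add0e fv.
rewrite integral_cst//= probability_setT mule1 -EFinD; congr EFin.
by rewrite mulrS; ring.
Qed.

End One.

(** * Samples of pairs and exchange of their components *)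

Section Pair.
Context {d} {T : measurableType d} (Q : probability T R).

Let QQ : probability (T * T)%type R := (Q \x Q)%E.

Lemma measurable_map_tuple {d1 d2} {T1 : measurableType d1} {T2 : measurableType d2}
   (f : T1 -> T2) n : measurable_fun setT f ->
  measurable_fun setT (fun u : n.-tuple T1 => [tuple f (tnth u j) | j < n]).
Proof.
move=> mf; apply/measurable_fun_tnthP => i.
rewrite (_ : _ \o _ = f \o @tnth _ T1 ^~ i); last first.
  by apply/funext => u /=; rewrite tnth_mktuple.
by apply: measurableT_comp => //; exact: measurable_tnth.
Qed.

Lemma power_measure_pair n (A B : set (n.-tuple T)) :
  measurable A -> measurable B ->
  power_measure QQ n [set u | A [tuple (tnth u j).1 | j < n] /\ B [tuple (tnth u j).2 | j < n]]
  = power_measure Q n A * power_measure Q n B.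
Proof.
elim: n A B => [|n IH] A B mA mB.
  rewrite /= !diracE -EFinM -natrM; congr (_%:R%:E).
  rewrite mulnb; congr nat_of_bool; apply/idP/andP => [|[]]; rewrite !inE /=.
    by rewrite [X in A X /\ _]tuple0 [X in _ /\ B X]tuple0.
  by move=> ? ?; rewrite [X in A X /\ _]tuple0 [X in _ /\ B X]tuple0.
have tc1 (p : T * T) (t : n.-tuple (T * T)) (f : T * T -> T) :
    [tuple f (tnth (tuple_cons (p, t)) j) | j < n.+1] =
    tuple_cons (f p, [tuple f (tnth t j) | j < n]).
  apply: eq_from_tnth => j; rewrite tnth_mktuple.
  case: (unliftP ord0 j) => [i|] ->; last by rewrite /tuple_cons /= !tnth0.
  by rewrite /tuple_cons /= !tnthS tnth_mktuple.
rewrite power_measureS; last first.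
  apply: measurableI; rewrite -[X in measurable X]setTI.
    by apply: (measurable_map_tuple measurable_fst).
  by apply: (measurable_map_tuple measurable_snd).
transitivity (\int[QQ]_p (power_measure Q n [set t | A (tuple_cons (p.1, t))] *
    power_measure Q n [set t | B (tuple_cons (p.2, t))])).
  apply: eq_integral => p _.
  rewrite -(IH [set t | A (tuple_cons (p.1, t))] [set t | B (tuple_cons (p.2, t))])//; try exact: measurable_slice.
  by apply: congr1; apply/seteqP; split => t /=; rewrite (tc1 _ _ fst) (tc1 _ _ snd).
rewrite /= fubini_tonelli1/=; last 2 first.
- apply: emeasurable_funM.
    apply: (measurableT_comp (measurable_power_slice Q mA)) => //.
  apply: (measurableT_comp (measurable_power_slice Q mB)) => //.
- by move=> x; rewrite mule_ge0.
rewrite /fubini_F /=.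
under eq_integral => x _.
  rewrite ge0_integralZl//; last exact: measurable_power_slice.
  over.
rewrite ge0_integralZr//; first by rewrite -!power_measureS.
- exact: measurable_power_slice.
- by apply: integral_ge0.
Qed.

(** Rectangles determine the product measure. The identity attaches the independent copy index by
    index, so that one index can be exchanged without touching the others. *)
Lemma power_measure_pairE n (D : set (n.-tuple T * n.-tuple T)) : measurable D ->
  power_measure QQ n [set u | D ([tuple (tnth u j).1 | j < n], [tuple (tnth u j).2 | j < n])]
  = (power_measure Q n \x power_measure Q n) D.
Proof.
move=> mD; pose F (u : n.-tuple (T * T)) :=
  ([tuple (tnth u j).1 | j < n], [tuple (tnth u j).2 | j < n]).
have mF : measurable_fun setT F.
  by apply: measurable_fun_pair; apply: measurable_map_tuple.
pose FF : {mfun _ >-> _} := HB.pack F (isMeasurableFun.Build _ _ _ _ _ mF).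
symmetry; apply: (@product_measure_unique _ _ _ _ _ _ _ (distribution (power_measure QQ n) FF)) => //.
by move=> A B mA mB; rewrite -power_measure_pair.
Qed.

Definition pair_swap {X : Type} (b : bool) (p : X * X) : X * X :=
  if b then (p.2, p.1) else p.

Lemma measurable_pair_swap b : measurable_fun setT (@pair_swap T b).
Proof. case: b; last exact: measurable_id.
exact: (measurable_fun_pair measurable_snd measurable_fst). Qed.

Lemma power_measure_swap n (b : nat -> bool) (D : set (n.-tuple (T * T))) : measurable D ->
  power_measure QQ n [set u | D [tuple (pair_swap (b j) (tnth u j)) | j < n]]
  = power_measure QQ n D.
Proof.
apply: (power_measure_map (g := fun j p => pair_swap (b j) p)).
  by move=> j; exact: measurable_pair_swap.
move=> j A mA; case: (b j) => //.
pose SS : {mfun (T * T)%type >-> (T * T)%type} :=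
  HB.pack (@pair_swap T true) (isMeasurableFun.Build _ _ _ _ _ (measurable_pair_swap true)).
symmetry; apply: (@product_measure_unique _ _ _ _ _ _ _ (distribution QQ SS)) => // B C mB mC.
rewrite -/QQ /= /distribution /pushforward /= (_ : _ @^-1` _ = C `*` B).
  by rewrite product_measure1E// muleC.
by apply/seteqP; split => -[x y] /= [].
Qed.

End Pair.
End PowerMeasure.

(** * The law of a finite sample *)

Section Law.
Context {R : realType} {d d'} {T : measurableType d} {T' : measurableType d'}.
Context (P : probability T R) (Q : probability T' R) (X : nat -> {RV P >-> T'}).
Hypothesis X_iid : iid_with_law P X Q.
Local Open Scope ereal_scope.

(** The pi-system on which laws of finite samples are compared. The sides are indexed by nat so that
    [mutually_independent] applies to them directly. *)
Definition tuple_box n (B : nat -> set T') : set (n.-tuple T') :=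
  [set t | forall j : 'I_n, B j (tnth t j)].
Arguments tuple_box : clear implicits.

Lemma measurable_tuple_box n (B : nat -> set T') :
  (forall j, measurable (B j)) -> measurable (tuple_box n B).
Proof.
move=> mB; rewrite (_ : tuple_box n B = \bigcap_(j in [set: 'I_n]) (@tnth _ T' ^~ j @^-1` B j)).
  apply: fin_bigcap_measurable => // j _; rewrite -[X in measurable X]setTI.
  exact: measurable_tnth.
by apply/seteqP; split => t /= h j; [move=> _|]; exact: h.
Qed.

Lemma measurable_tupleE n :
  @measurable _ (n.-tuple T') =
  <<s [set A | exists2 B, forall j, measurable (B j) & A = tuple_box n B] >>.
Proof.
apply/seteqP; split.
  apply: smallest_sub; first exact: smallest_sigma_algebra.
  move=> A; rewrite -bigcup_seq => -[/= i _ [B mB <-]]; apply: sub_sigma_algebra.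
  exists (fun j => if j == val i then B else setT); first by move=> j; case: ifP.
  apply/seteqP; split => t /=; rewrite /tuple_box /=.
    by move=> [_ Bt] j; case: ifPn => // /eqP/val_inj ->.
  by move=> /(_ i); rewrite eqxx.
apply: smallest_sub; first exact: sigma_algebra_measurable.
by move=> A [B mB ->]; exact: measurable_tuple_box.
Qed.

Lemma power_measure_box n B : (forall j, measurable (B j)) ->
  power_measure Q n (tuple_box n B) = \prod_(j <- iota 0 n) Q (B j).
Proof.
move=> mB; rewrite -[n in iota _ n]subn0 -/(index_iota 0 n) big_mkord.
elim: n B mB => [|n IH] B mB.
  by rewrite big_ord0 /= diracE mem_set// /tuple_box /= => -[].
rewrite power_measureS; last exact: measurable_tuple_box.
rewrite big_ord_recl /=.
rewrite -(IH (fun j => B j.+1))//.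
rewrite -[RHS](_ : \int[Q]_x ((\1_(B 0%N) x)%:E * power_measure Q n (tuple_box n (fun j => B j.+1))) = _); last first.
  by rewrite ge0_integralZr//; [rewrite integral_indic ?setIT|exact/measurable_EFinP].
apply: eq_integral => x _; rewrite indicE.
have [xB|xB] := boolP (x \in B 0%N).
  rewrite mul1e; apply: congr1; apply/seteqP; split => t /= h j.
    by have := h (lift ord0 j); rewrite /tuple_cons /= tnthS.
  case: (unliftP ord0 j) => [i|] ->; rewrite /tuple_cons /=; last by rewrite tnth0; rewrite inE in xB.
  by rewrite tnthS; exact: h.
rewrite mul0e (_ : [set t | _] = set0) ?measure0//.
apply/seteqP; split => t //= /(_ ord0); rewrite tnth0 => h.
by move: xB; rewrite notin_setE.
Qed.

Lemma measurable_tuple_RV n : measurable_fun setT (fun w => [tuple X j w | j < n]).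
Proof.
apply/measurable_fun_tnthP => i; rewrite (_ : _ \o _ = X i)//.
by apply/funext => w /=; rewrite tnth_mktuple.
Qed.

Lemma tuple_law n (A : set (n.-tuple T')) : measurable A ->
  P [set w | A [tuple X j w | j < n]] = power_measure Q n A.
Proof.
move=> mA.
pose XX : {mfun T >-> n.-tuple T'} := HB.pack (fun w => [tuple X j w | j < n])
  (isMeasurableFun.Build _ _ _ _ _ (measurable_tuple_RV (n := n))).
apply: (measure_unique _ (fun=> setT) (measurable_tupleE n) _ _ _ (distribution P XX)) => //.
- move=> A1 A2 [B1 mB1 ->] [B2 mB2 ->]; exists (fun j => B1 j `&` B2 j).
    by move=> j; exact: measurableI.
  apply/seteqP; split => t /=.
    by move=> [h1 h2] j; split; [exact: h1|exact: h2].
  by move=> h; split => j; have [] := h j.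
- move=> i; exists (fun=> setT) => //.
  by apply/seteqP; split.
- by rewrite bigcup_const//; exists 0%N.
- move=> C [B mB ->]; transitivity (\prod_(j <- iota 0 n) Q (B j)); last first.
    by symmetry; exact: power_measure_box.
  case: X_iid => ind law.
  rewrite (eq_bigr (fun j => P (X j @^-1` B j))); last first.
    by move=> j _; exact/esym/law.
  rewrite -ind ?iota_uniq//.
  suff -> : \bigcap_(j in [set` iota 0 n]) X j @^-1` B j = XX @^-1` tuple_box n B by [].
  apply/seteqP; split => w /=; last first.
    move=> h j; rewrite /= mem_iota/= add0n => jn.
    by have := h (Ordinal jn); rewrite tnth_mktuple.
  by move=> h j; rewrite tnth_mktuple; apply: h; rewrite /= mem_iota/= add0n.
- move=> k; apply: (@le_lt_trans _ _ 1); last exact: ltry.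
  exact: (@probability_le1 _ _ _ (distribution P XX)).
Qed.

End Law.

(** [E] need not be measurable; its outer probability is bounded through a measurable cover. The
    negligible [N] is first enlarged to a measurable null set, and [F] takes up what is not
    expressed through the sample. *)
Lemma outer_tuple_le {R : realType} {d d'} {T : measurableType d} {T' : measurableType d'}
    (P : probability T R) (Q : probability T' R) (X : nat -> {RV P >-> T'}) (n : nat)
    (E F : set T) (N B : set (n.-tuple T')) : iid_with_law P X Q ->
  (power_measure Q n).-negligible N -> measurable B -> measurable F ->
  (forall w, E w -> [\/ N [tuple X j w | j < n], B [tuple X j w | j < n] | F w]) ->
  ((P^*)%mu E <= power_measure Q n B + P F)%E.
Proof.
move=> X_iid [N' [mN' N'0 NN']] mB mF EBF.
pose zt w := [tuple X j w | j < n].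
have mzt (A : set (n.-tuple T')) : measurable A -> measurable [set w | A (zt w)].
  by move=> mA; rewrite -[X in measurable X]setTI; exact: (measurable_tuple_RV X measurableT mA).
pose G := [set w | N' (zt w)] `|` [set w | B (zt w)] `|` F.
have mG : measurable G by apply: measurableU => //; apply: measurableU; exact: mzt.
apply: (@le_trans _ _ ((P^*)%mu G)).
  apply: le_mu_ext => w Ew; have [/NN' ?|?|?] := EBF w Ew; first by left; left.
    by left; right.
  by right.
rewrite measurable_mu_extE//.
have mNB : measurable ([set w | N' (zt w)] `|` [set w | B (zt w)]).
  by apply: measurableU; exact: mzt.
apply: (le_trans (measureU2 P mNB mF)).
apply: leeD2r; apply: (le_trans (measureU2 P (mzt _ mN') (mzt _ mB))).
have e : (P [set w | N' (zt w)] + P [set w | B (zt w)] = power_measure Q n B)%E.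
  by rewrite (tuple_law X_iid mN') (tuple_law X_iid mB) [X in (X + _)%E]N'0 add0e.
by rewrite -e.
Qed.

(** * Symmetrization *)

Section Markov.
Context {R : realType} {d} {T : measurableType d} (mu : {measure set T -> \bar R}).
Local Open Scope ereal_scope.

Lemma markov_gt (f : T -> R) (c a : R) : measurable_fun setT f ->
  (forall x, (0 <= f x)%R) -> (0 < a)%R -> \int[mu]_x (f x)%:E <= c%:E ->
  mu [set x | (a < f x)%R] <= (c / a)%:E.
Proof.
move=> mf f0 a0 fc; rewrite EFinM lee_pdivlMr//.
have mA : measurable [set x | (a < f x)%R].
  rewrite -[X in measurable X]setTI.
  exact: (measurable_fun_ltr (measurable_cst a) mf).
apply: le_trans fc; rewrite muleC -[X in mu X]setIT -integral_indic// -ge0_integralZl_EFin//; last 2 first.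
- exact/measurable_EFinP.
- exact: ltW.
apply: ge0_le_integral => //.
- by move=> x _; rewrite mule_ge0// lee_fin ltW.
- by apply: emeasurable_funM => //; exact/measurable_EFinP.
- exact/measurable_EFinP.
move=> x _; rewrite indicE -EFinM lee_fin.
have [|_] := boolP (x \in _); last by rewrite mulr0.
by rewrite inE mulr1 => /ltW.
Qed.

End Markov.

Lemma countable_bigcup_measurable {d} {T : measurableType d} {I : Type}
    (S : set I) (F : I -> set T) : countable S ->
  (forall i, S i -> measurable (F i)) -> measurable (\bigcup_(i in S) F i).
Proof.
move=> /countable_injP[f finj] mF.
rewrite (_ : \bigcup_(i in S) F i = \bigcup_n \bigcup_(i in [set i | S i /\ f i = n]) F i).
  apply: bigcupT_measurable => n.
  have [[i [Si fi]]|none] := pselect (exists i, S i /\ f i = n).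
    rewrite (_ : [set _ | _] = [set i]); first by rewrite bigcup_set1; exact: mF.
    apply/seteqP; split => j /=; last by move=> ->.
    by move=> [Sj fj]; apply: finj; rewrite ?inE// fi.
  rewrite (_ : [set _ | _] = set0) ?bigcup_set0//.
  by apply/seteqP; split => j //= h; apply: none; exists j.
apply/seteqP; split => x.
  by move=> [i Si Fx]; exists (f i) => //; exists i.
by move=> [n _ [i [Si _] Fx]]; exists i.
Qed.

Section Symmetrization.
Context {R : realType} {d} {T : measurableType d} (Q : probability T R).

Lemma integral_power_sum (f : T -> R) (v : R) n : measurable_fun setT f ->
  (forall x, 0 <= f x) -> (\int[Q]_x (f x)%:E = v%:E)%E ->
  (\int[power_measure Q n]_t (\sum_(j < n) f (tnth t j))%:E = (n%:R * v)%:E)%E.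
Proof.
move=> mf f0 fv.
have msum k : measurable_fun setT
    (fun t : k.-tuple T => (\sum_(j < k) f (tnth t j))%:E).
  apply/measurable_EFinP.
  by apply: measurable_sum => j; apply: measurableT_comp => //; exact: measurable_tnth.
have sum0 k (t : k.-tuple T) : 0 <= \sum_(j < k) f (tnth t j) by apply: sumr_ge0.
elim: n => [|n IH].
  under eq_integral do rewrite big_ord0.
  by rewrite integral0 mul0r.
rewrite ge0_integral_power_measureS//.
transitivity (\int[Q]_x ((f x)%:E + (n%:R * v)%:E))%E.
  apply: eq_integral => x _; rewrite -IH.
  transitivity (\int[power_measure Q n]_t ((f x)%:E + (\sum_(j < n) f (tnth t j))%:E))%E.
    apply: eq_integral => t _.
    rewrite big_ord_recl tnth0 -EFinD; congr ((_ + _)%:E).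
    by apply: eq_bigr => j _; rewrite /tuple_cons /= tnthS.
  rewrite ge0_integralD//=; first by rewrite integral_cst//= probability_setT mule1.
  all: try exact: msum.
  - by move=> t _; rewrite lee_fin f0.
  - by move=> t _; rewrite lee_fin sum0.
have v0 : 0 <= v by rewrite -lee_fin -fv; apply: integral_ge0 => x _; rewrite lee_fin.
rewrite ge0_integralD//=; last 2 first.
- exact/measurable_EFinP.
- by move=> x _; rewrite lee_fin mulr_ge0.
- rewrite integral_cst//= probability_setT mule1 fv -EFinD; congr EFin.
  by rewrite mulrS; ring.
- by move=> x _; rewrite lee_fin f0.
- by move=> t; rewrite lee_fin sum0.
Qed.

Context {I : Type} (S : set I) (h : I -> T -> R) (X : T -> R) (s : R).
Hypothesis S_countable : countable S.
Hypothesis mh : forall i, S i -> measurable_fun setT (h i).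
Hypothesis mX : measurable_fun setT X.
Hypothesis hX : forall i z, S i -> `|h i z| <= X z.
Hypothesis s_gt0 : 0 < s.
Hypothesis Xs : (\int[Q]_z (X z ^+ 2)%:E <= (s ^+ 2)%:E)%E.

Lemma measurable_dev n (a : R) (b : I -> R) : measurable
  [set z : n.-tuple T | exists2 i, S i & a < `|\sum_(j < n) (h i (tnth z j) - b i)|].
Proof.
rewrite (_ : [set z | _] = \bigcup_(i in S) [set z : n.-tuple T | a < `|\sum_(j < n) (h i (tnth z j) - b i)|]); last first.
  by apply/seteqP; split => z /= [i Si ai]; exists i.
apply: countable_bigcup_measurable => // i Si; rewrite -[X in measurable X]setTI.
apply: (measurable_fun_ltr (measurable_cst a)) => //.
apply: measurableT_comp => //; apply: measurable_sum => j; apply: measurable_funB => //.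
by apply: measurableT_comp; [exact: mh|exact: measurable_tnth].
Qed.

Lemma centered_moments (f : T -> R) : measurable_fun setT f ->
  (\int[Q]_z (f z ^+ 2)%:E <= (s ^+ 2)%:E)%E ->
  let mf := fine (\int[Q]_z (f z)%:E) in
  [/\ Q.-integrable setT (EFin \o f),
      (\int[Q]_z (f z - mf)%:E = 0)%E,
      Q.-integrable setT (fun z => ((f z - mf) ^+ 2)%:E) &
      exists2 v, (\int[Q]_z ((f z - mf) ^+ 2)%:E = v%:E)%E & v <= s ^+ 2].
Proof.
move=> mf fs mu.
have mf2 : measurable_fun setT (fun z => (f z ^+ 2)%:E).
  by apply/measurable_EFinP; exact: measurable_funX.
have if2 : Q.-integrable setT (fun z => (f z ^+ 2)%:E).
  apply/integrableP; split => //.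
  apply: le_lt_trans (ltry (s ^+ 2)); apply: le_trans fs.
  rewrite le_eqVlt; apply/orP; left; apply/eqP; apply: eq_integral => z _.
  by rewrite gee0_abs// lee_fin sqr_ge0.
have ic (c : R) : Q.-integrable setT (fun=> c%:E).
  exact: finite_measure_integrable_cst.
have if1 : Q.-integrable setT (EFin \o f).
  apply: (@le_integrable _ _ _ _ _ measurableT _ (fun z => ((f z ^+ 2)%:E + 1%:E)%E)) => //.
  - exact/measurable_EFinP.
  - move=> z _ /=; rewrite lee_fin [leRHS]ger0_norm; last by rewrite addr_ge0// sqr_ge0.
    rewrite -(@real_normK _ (f z)) ?num_real//; have := sqr_ge0 (`|f z| - 1); nra.
  - exact: integrableD.
have fmu : (\int[Q]_z (f z)%:E = mu%:E)%E.
  by rewrite fineK//; exact: integrable_fin_num.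
clearbody mu; split => //.
- under eq_integral do rewrite EFinB.
  by rewrite integralB//= fmu integral_cst//= probability_setT mule1 subee.
- apply: (@eq_integrable _ _ _ _ _ measurableT (fun z => (f z ^+ 2)%:E + ((- 2 * mu)%:E * (f z)%:E + (mu ^+ 2)%:E))%E).
    by move=> z _; rewrite -EFinM -!EFinD; congr EFin; ring.
  by apply: integrableD => //; apply: integrableD => //; exact: integrableZl.
- exists (fine (\int[Q]_z (f z ^+ 2)%:E) - mu ^+ 2).
  transitivity (\int[Q]_z ((f z ^+ 2)%:E + ((- 2 * mu)%:E * (f z)%:E + (mu ^+ 2)%:E)))%E.
    by apply: eq_integral => z _; rewrite -EFinM -!EFinD; congr EFin; ring.
  rewrite integralD//=; last by apply: integrableD => //; exact: integrableZl.
  rewrite integralD//=; last exact: integrableZl.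
  rewrite integralZl//= fmu integral_cst//= probability_setT mule1.
  rewrite EFinB fineK; last exact: integrable_fin_num.
  by rewrite -EFinM -EFinD; congr (_ + _%:E)%E; ring.
  apply: (@le_trans _ _ (fine (\int[Q]_z (f z ^+ 2)%:E)%E)).
    by rewrite gerBl sqr_ge0.
  by rewrite -lee_fin fineK//; exact: integrable_fin_num.
Qed.

Let m i := fine (\int[Q]_z (h i z)%:E)%E.

Let h_sqr i : S i -> (\int[Q]_z (h i z ^+ 2)%:E <= (s ^+ 2)%:E)%E.
Proof.
move=> Si; apply: le_trans Xs; apply: ge0_le_integral => //.
- by move=> z _; rewrite lee_fin sqr_ge0.
- by apply/measurable_EFinP; apply: measurable_funX; exact: mh.
- by apply/measurable_EFinP; exact: measurable_funX.
move=> z _; rewrite lee_fin -(real_normK (num_real (h i z))).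
by rewrite lerXn2r ?nnegrE ?(le_trans (normr_ge0 (h i z)))// hX.
Qed.

Let X_sqr_int : exists2 v, (\int[Q]_z (X z ^+ 2)%:E = v%:E)%E & v <= s ^+ 2.
Proof.
have fin : (\int[Q]_z (X z ^+ 2)%:E)%E \is a fin_num.
  rewrite ge0_fin_numE; first exact: le_lt_trans Xs (ltry _).
  by apply: integral_ge0 => z _; rewrite lee_fin sqr_ge0.
exists (fine (\int[Q]_z (X z ^+ 2)%:E)%E); first by rewrite fineK.
by rewrite -lee_fin fineK.
Qed.

(** Chebyshev's bound fails with probability at most 1/4 and Markov's bound for the sum of squares
    with probability at most 1/2, which leaves 1/4. The second condition is there because the count
    of signs depends on the squares of both samples. *)
Let ghost n i : (0 < n)%N -> S i ->
  ((1 / 4)%:E <= power_measure Q n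
     [set z | (`|\sum_(j < n) (h i (tnth z j) - m i)| <= 2 * Num.sqrt n%:R * s)%R
              /\ (\sum_(j < n) X (tnth z j) ^+ 2 <= 2 * n%:R * s ^+ 2)%R])%E.
Proof.
move=> n0 Si; set G := [set z | _].
have n0R : 0 < n%:R :> R by rewrite ltr0n.
have [ih h0 ih2 [v hv vs]] := centered_moments (mh Si) (h_sqr Si).
have [w Xw ws] := X_sqr_int.
have mhc : measurable_fun setT (fun z => h i z - m i) by apply: measurable_funB => //; exact: mh.
pose f1 (z : n.-tuple T) := (0 + \sum_(j < n) (h i (tnth z j) - m i)) ^+ 2.
pose f2 (z : n.-tuple T) := \sum_(j < n) X (tnth z j) ^+ 2.
have mf1 : measurable_fun setT f1.
  apply: measurable_funX; apply: measurable_funD => //.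
  by apply: measurable_sum => j; apply: (measurableT_comp mhc); exact: measurable_tnth.
have mf2 : measurable_fun setT f2.
  apply: measurable_sum => j; apply: measurable_funX.
  by apply: (measurableT_comp mX); exact: measurable_tnth.
pose A1 := [set z | (2 * Num.sqrt n%:R * s) ^+ 2 < f1 z].
pose A2 := [set z | 2 * n%:R * s ^+ 2 < f2 z].
have mA1 : measurable A1.
  by rewrite -[X in measurable X]setTI; exact: (measurable_fun_ltr (measurable_cst _) mf1).
have mA2 : measurable A2.
  by rewrite -[X in measurable X]setTI; exact: (measurable_fun_ltr (measurable_cst _) mf2).
have GE : G = ~` (A1 `|` A2).
  rewrite /G /A1 /A2 /f1 /f2; apply/seteqP; split => z /=.
    move=> [h1 h2] []; last by rewrite ltNge h2.
    rewrite add0r -[X in _ < X]real_normK ?num_real// ltr_sqr ?nnegrE ?mulr_ge0 ?sqrtr_ge0 ?(ltW s_gt0)//.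
    by rewrite ltNge h1.
  move=> /not_orP [/negP + /negP]; rewrite -!leNgt => h1 h2; split => //.
  move: h1; rewrite add0r -[X in X <= _]real_normK ?num_real// ler_sqr ?nnegrE//.
  by rewrite ?mulr_ge0 ?sqrtr_ge0 ?(ltW s_gt0).
have mG : measurable G by rewrite GE; apply: measurableC; exact: measurableU.
have p1 : (power_measure Q n A1 <= (1 / 4)%:E)%E.
  have a0 : 0 < (2 * Num.sqrt n%:R * s) ^+ 2 by rewrite exprn_gt0// !mulr_gt0// sqrtr_gt0.
  have i1 : (\int[power_measure Q n]_z (f1 z)%:E <= (n%:R * v)%:E)%E.
    rewrite /f1 (integral_power_sqr_sum n 0 mhc h0 _ ih2 hv) ?expr0n/= ?add0r//.
    rewrite (_ : EFin \o _ = (EFin \o h i) \- (EFin \o cst (m i)))%E//.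
    by apply: integrableB => //; exact: finite_measure_integrable_cst.
  apply: le_trans (markov_gt mf1 (fun=> sqr_ge0 _) a0 i1) _.
  rewrite lee_fin ler_pdivrMr// !exprMn sqr_sqrtr ?ler0n//.
  rewrite (_ : 1 / 4 * (2 ^+ 2 * n%:R * s ^+ 2) = n%:R * s ^+ 2); last by field.
  by rewrite ler_pM2l.
have p2 : (power_measure Q n A2 <= (1 / 2)%:E)%E.
  have a0 : 0 < 2 * n%:R * s ^+ 2 by rewrite !mulr_gt0// exprn_gt0.
  have i1 : (\int[power_measure Q n]_z (f2 z)%:E <= (n%:R * w)%:E)%E.
    by rewrite (integral_power_sum n (measurable_funX 2 mX) (fun x => sqr_ge0 (X x)) Xw).
  have f20 z : 0 <= f2 z by apply: sumr_ge0 => j _; exact: sqr_ge0.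
  apply: le_trans (markov_gt mf2 f20 a0 i1) _.
  rewrite lee_fin ler_pdivrMr//.
  rewrite (_ : 1 / 2 * (2 * n%:R * s ^+ 2) = n%:R * s ^+ 2); last by field.
  by rewrite ler_pM2l.
have : (1 <= power_measure Q n G + (power_measure Q n A1 + power_measure Q n A2))%E.
  rewrite -(probability_setT (power_measure Q n)) -(setvU (A1 `|` A2)) -GE.
  apply: (le_trans (measureU2 _ _ _)) => //; first exact: measurableU.
  by rewrite leeD2l// measureU2.
move=> /le_trans /(_ (leeD2l _ (leeD p1 p2))).
rewrite -EFinD -leeBlDr// -EFinB; apply: le_trans.
by rewrite lee_fin; lra.
Qed.

Let QQ : probability (T * T)%type R := (Q \x Q)%E.

Let rsum_swap n (i : I) (sg : {ffun 'I_n -> bool}) (b : nat -> bool) (u : n.-tuple (T * T)) :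
  (forall j, b (val j) = sg j) ->
  \sum_(j < n) (h i (pair_swap (b j) (tnth u j)).1 - h i (pair_swap (b j) (tnth u j)).2)
  = rsum (fun j => h i (tnth u j).1 - h i (tnth u j).2) sg.
Proof.
move=> bsg; apply: eq_bigr => j _; rewrite bsg /rsign /pair_swap.
by case: (sg j) => /=; rewrite ?expr1 ?expr0 ?mulN1r ?mul1r ?opprB.
Qed.

(* The function witnessing the deviation depends on the sample [z] only, so the
   bound for the independent copy is needed for one function at a time. *)
Lemma symmetrization_tail n (c1 y tau : R) : (0 < n)%N -> 0 <= c1 ->
  (forall u : n.-tuple (T * T),
     \sum_(j < n) (X (tnth u j).1 ^+ 2 + X (tnth u j).2 ^+ 2) <= (c1 + 2) * n%:R * s ^+ 2 ->
     #|[set sg : {ffun 'I_n -> bool} | `[< exists2 i, S i &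
        (y - 2) * Num.sqrt n%:R * s
          < `|rsum (fun j => h i (tnth u j).1 - h i (tnth u j).2) sg| >]]%SET|%:R
     <= 2 ^+ n * expR (- tau) :> R) ->
  (power_measure Q n
    ([set z | exists2 i, S i & (y * Num.sqrt n%:R * s
         < `|\sum_(j < n) (h i (tnth z j) - fine (\int[Q]_z (h i z)%:E)%E)|)%R]
     `&` [set z | (\sum_(j < n) X (tnth z j) ^+ 2 <= c1 * n%:R * s ^+ 2)%R])
   <= (4 * expR (- tau))%:E)%E.
Proof.
move=> n0 c10 signs; set E := _ `&` _.
pose Xb (c : R) (z : n.-tuple T) := \sum_(j < n) X (tnth z j) ^+ 2 <= c * n%:R * s ^+ 2.
have mXb c : measurable [set z | Xb c z].
  rewrite -[X in measurable X]setTI; apply: measurable_fun_ler => //.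
  apply: measurable_sum => j; apply: measurable_funX.
  by apply: (measurableT_comp mX); exact: measurable_tnth.
have mE : measurable E by apply: measurableI; [exact: (measurable_dev _ (fun i => m i))|exact: (mXb c1)].
pose D1 := [set p : n.-tuple T * n.-tuple T |
  exists2 i, S i & (y - 2) * Num.sqrt n%:R * s
         < `|\sum_(j < n) (h i (tnth p.1 j) - h i (tnth p.2 j))|].
pose D := D1 `&` [set p : n.-tuple T * n.-tuple T |
  \sum_(j < n) (X (tnth p.1 j) ^+ 2 + X (tnth p.2 j) ^+ 2) <= (c1 + 2) * n%:R * s ^+ 2].
have mt1 (f : T -> R) (j : 'I_n) : measurable_fun setT f ->
    measurable_fun setT (fun p : n.-tuple T * n.-tuple T => f (tnth p.1 j)).
  move=> mf; apply: (measurableT_comp mf).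
  by apply: (measurableT_comp (measurable_tnth j)).
have mt2 (f : T -> R) (j : 'I_n) : measurable_fun setT f ->
    measurable_fun setT (fun p : n.-tuple T * n.-tuple T => f (tnth p.2 j)).
  move=> mf; apply: (measurableT_comp mf).
  by apply: (measurableT_comp (measurable_tnth j)).
have mD : measurable D.
  apply: measurableI.
    rewrite (_ : D1 = \bigcup_(i in S) [set p : n.-tuple T * n.-tuple T |
         (y - 2) * Num.sqrt n%:R * s
         < `|\sum_(j < n) (h i (tnth p.1 j) - h i (tnth p.2 j))|]); last first.
      by apply/seteqP; split => z /= [i Si ai]; exists i.
    apply: countable_bigcup_measurable => // i Si; rewrite -[X in measurable X]setTI.
    apply: (measurable_fun_ltr (measurable_cst _)) => //.
    apply: measurableT_comp => //; apply: measurable_sum => j.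
    by apply: measurable_funB; [exact: (mt1 _ _ (mh Si))|exact: (mt2 _ _ (mh Si))].
  rewrite -[X in measurable X]setTI; apply: measurable_fun_ler => //.
  apply: measurable_sum => j; apply: measurable_funD; apply: measurable_funX.
    exact: mt1.
  exact: mt2.
(* For every sample in [E] the section of [D] contains the good event of [ghost]: the copy deviates
   by at most 2 sqrt(n) s, so the difference of the two sums keeps the level y - 2, and the squares
   of the copy add at most 2 n s^2. *)
have step1 : ((1 / 4)%:E * power_measure Q n E <= (power_measure Q n \x power_measure Q n) D)%E.
  rewrite -[X in power_measure Q n X]setIT -integral_indic// -ge0_integralZl_EFin//; last first.
    exact/measurable_EFinP.
  apply: ge0_le_integral => //.
  - by apply: emeasurable_funM => //; exact/measurable_EFinP.
  - exact: measurable_fun_xsection.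
  move=> z _; rewrite indicE; have [|_] := boolP (z \in E); last by rewrite mule0.
  rewrite inE mule1 => -[[i Si yi] zX].
  apply: le_trans (ghost n0 Si) _; apply: le_measure; rewrite ?inE.
  - apply: measurableI; last exact: (mXb 2).
    rewrite -[X in measurable X]setTI; apply: measurable_fun_ler => //.
    apply: measurableT_comp => //; apply: measurable_sum => j; apply: measurable_funB => //.
    by apply: (measurableT_comp (mh Si)); exact: measurable_tnth.
  - exact: measurable_xsection.
  move=> z' /= [h1 h2]; rewrite /xsection /= inE; split => /=.
    exists i => //.
    have : `|\sum_(j < n) (h i (tnth z j) - m i)| <=
      `|\sum_(j < n) (h i (tnth z j) - h i (tnth z' j))| + `|\sum_(j < n) (h i (tnth z' j) - m i)|.
      rewrite (_ : \sum_(j < n) (h i (tnth z j) - m i) =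
        \sum_(j < n) (h i (tnth z j) - h i (tnth z' j)) + \sum_(j < n) (h i (tnth z' j) - m i)).
        exact: ler_normD.
      by rewrite -big_split; apply: eq_bigr => j _ /=; ring.
    move: yi h1; rewrite -/(m i).
    set a1 := `| _ |; set a2 := `| _ |; set a3 := `| _ |.
    rewrite !mulrBl -!mulrA; lra.
  rewrite big_split /= (_ : (c1 + 2) * n%:R * s ^+ 2 = c1 * n%:R * s ^+ 2 + 2 * n%:R * s ^+ 2); last by ring.
  by apply: lerD; [exact: zX|exact: h2].
(* All 2^n exchanges preserve the law and the sum of squares. Summing over them turns the
   probability into the integral of a count of sign vectors, which [signs] bounds for each fixed
   sample of pairs. *)
have step2 : ((power_measure Q n \x power_measure Q n) D <= (expR (- tau))%:E)%E.
  rewrite -power_measure_pairE// -/QQ; set D' := [set u | _].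
  have mD' : measurable D'.
    have mF : measurable_fun setT (fun u : n.-tuple (T * T) =>
      ([tuple (tnth u j).1 | j < n], [tuple (tnth u j).2 | j < n])).
      by apply: measurable_fun_pair; [exact: (measurable_map_tuple measurable_fst)|exact: (measurable_map_tuple measurable_snd)].
    by rewrite -[X in measurable X]setTI; exact: mF.
  (* Exchanges are indexed by nat; the default concerns only indices from n on, which are never
     read. *)
  pose b (sg : {ffun 'I_n -> bool}) (k : nat) := if insub k is Some j then sg j else false.
  have bE sg (j : 'I_n) : b sg (val j) = sg j by rewrite /b valK.
  pose Dsg sg := [set u | D' [tuple pair_swap (b sg j) (tnth u j) | j < n]].
  have mDsg sg : measurable (Dsg sg).
    have mF : measurable_fun setT (fun u : n.-tuple (T * T) => [tuple pair_swap (b sg j) (tnth u j) | j < n]).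
      apply/measurable_fun_tnthP => j.
      rewrite (_ : _ \o _ = pair_swap (b sg j) \o @tnth _ (T * T)%type ^~ j).
        by apply: measurableT_comp; [exact: measurable_pair_swap|exact: measurable_tnth].
      by apply/funext => u /=; rewrite tnth_mktuple.
    by rewrite -[X in measurable X]setTI; exact: mF.
  have ED sg : power_measure QQ n (Dsg sg) = power_measure QQ n D' by exact: power_measure_swap.
  have DsgE sg u : Dsg sg u ->
      \sum_(j < n) (X (tnth u j).1 ^+ 2 + X (tnth u j).2 ^+ 2) <= (c1 + 2) * n%:R * s ^+ 2 /\
      exists2 i, S i & (y - 2) * Num.sqrt n%:R * s
          < `|rsum (fun j => h i (tnth u j).1 - h i (tnth u j).2) sg|.
    move=> -[[i1 Si hi] hX']; split.
      apply: le_trans hX'; apply: ler_sum => j _; rewrite /= !tnth_mktuple.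
      by rewrite /pair_swap; case: (b sg j) => //=; rewrite addrC.
    exists i1 => //; move: hi; rewrite -(rsum_swap i1 u (bE sg)).
    by under eq_bigr do rewrite /= !tnth_mktuple.
  have : (\sum_(sg : {ffun 'I_n -> bool}) power_measure QQ n (Dsg sg) <= (2 ^+ n * expR (- tau))%:E)%E.
    under eq_bigr do rewrite -[X in power_measure QQ n X]setIT -integral_indic//.
    rewrite -ge0_integral_sum//; last first.
      by move=> sg; exact/measurable_EFinP.
    apply: (@le_trans _ _ (\int[power_measure QQ n]_u (2 ^+ n * expR (- tau))%:E)%E); last first.
      by rewrite integral_cst//= probability_setT mule1.
    apply: ge0_le_integral => //.
    - by move=> u _; apply: sume_ge0 => sg _; rewrite lee_fin.
    - by apply: emeasurable_sum => sg; exact/measurable_EFinP.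
    move=> u _; rewrite sumEFin lee_fin.
    have [ok|nok] := pselect (\sum_(j < n) (X (tnth u j).1 ^+ 2 + X (tnth u j).2 ^+ 2) <= (c1 + 2) * n%:R * s ^+ 2).
      apply: le_trans (signs u ok).
      rewrite -sum1_card natr_sum [leRHS]big_mkcond /=; apply: ler_sum => sg _.
      rewrite indicE inE; case: asboolP => [_|hno]; first by rewrite lern1; case: (_ \in _).
      rewrite memNset//= => /DsgE [_ hyes]; exact: hno.
    rewrite big1 ?mulr_ge0 ?exprn_ge0 ?expR_ge0// => sg _.
    by rewrite indicE memNset// => /DsgE [].
  under eq_bigr do rewrite ED.
  rewrite big_const cardE -cardT card_ffun card_bool card_ord.
  have -> : iter (2 ^ n) (adde (power_measure QQ n D')) 0%E = ((2 ^+ n)%:E * power_measure QQ n D')%E.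
    rewrite -natrX; elim: (2 ^ n)%N => [|k IH]; first by rewrite mul0e.
    by rewrite iterS IH mulrS EFinD ge0_muleDl// mul1e.
  by rewrite EFinM lee_pmul2l// lte_fin exprn_gt0.
move: (le_trans step1 step2); rewrite muleC -lee_pdivlMr// => /le_trans; apply.
by rewrite -EFinM lee_fin mul1r invrK mulrC.
Qed.

End Symmetrization.

(** * Covers from the entropy integral *)

Section FiniteMixture.
Context {R : realType} {d} {T : measurableType d}.
Context (l : nat) (w : nat -> R) (p : nat -> T).
Hypothesis w_ge0 : forall j, 0 <= w j.
Hypothesis w_sum : \sum_(j < l) w j = 1.

(** The points [p j] may coincide, as sample points do; the masses at equal points add up. *)
Definition mixture : set T -> \bar R :=
  msum (fun j => mscale (NngNum (w_ge0 j)) (dirac (p j))) l.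

HB.instance Definition _ := Measure.on mixture.

Lemma mixture_setT : mixture setT = 1%E.
Proof.
rewrite /mixture /msum /=; under eq_bigr do rewrite /mscale /= diracT mule1.
by rewrite sumEFin w_sum.
Qed.

Lemma mixture_support (S : set T) : (forall j, (j < l)%N -> S (p j)) -> mixture S = 1%E.
Proof.
move=> pS; rewrite -mixture_setT /mixture /msum; apply: eq_bigr => j _.
have Dp A : A (p j) -> mscale (NngNum (w_ge0 j)) \d_(p j) A = (w j)%:E.
  by move=> Ap; rewrite /mscale /= diracE mem_set// mule1.
by transitivity (w j)%:E; [apply: Dp; exact: pS|exact/esym/Dp].
Qed.

Lemma L2norm_mixture (f : T -> R) : measurable_fun setT f ->
  L2norm mixture f = ((\sum_(j < l) w j * f (p j) ^+ 2) `^ 2^-1)%:E.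
Proof.
move=> mf; rewrite /L2norm unlock -poweR_EFin; congr poweR.
rewrite ge0_integral_measure_sum//; last first.
- apply: (@measurableT_comp _ _ _ _ _ _ (fun x : \bar R => x `^ 2)%E) => //.
    exact: measurable_poweR.
  by apply: measurableT_comp => //; exact/measurable_EFinP.
- by move=> x _; exact: poweR_ge0.
rewrite -sumEFin; apply: eq_bigr => j _.
have mf2 : measurable_fun setT (fun x => (`|(EFin \o f) x| `^ 2)%E).
  apply: (@measurableT_comp _ _ _ _ _ _ (fun x : \bar R => x `^ 2)%E) => //.
    exact: measurable_poweR.
  by apply: measurableT_comp => //; exact/measurable_EFinP.
rewrite ge0_integral_mscale//; last by move=> x _; exact: poweR_ge0.
rewrite integral_dirac// diracT mul1e /= -EFinM; congr (_ * _)%:E.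
by rewrite powR_mulrn// real_normK ?num_real.
Qed.

End FiniteMixture.

Section Entropy.
Context {R : realType} {k : nat}.
Implicit Types (F : set ('rV[R]_k -> R)) (C : 'rV[R]_k -> R).

(** The integrand of [entropy_integral]. *)
Definition sup_entropy F C (e : R) : \bar R :=
  (ereal_sup [set lne (2%:E * covering_number (e%:E * L2norm Q C) F Q) `^ 2^-1
      | Q in @finitely_supported R k])%E.

Lemma covering_number_antitone F (Q : probability (borel R k) R) (e1 e2 : \bar R) :
  (e1 <= e2)%E -> (covering_number e2 F Q <= covering_number e1 F Q)%E.
Proof.
move=> e12; apply: ereal_inf_le_tmp => _ [N [c Fc cov]] <-; exists N => //; exists c => // f Ff.
by have [i fi] := cov f Ff; exists i; exact: le_trans fi e12.
Qed.

Lemma covering_number_ge1 F (Q : probability (borel R k) R) e f : F f ->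
  (1 <= covering_number e F Q)%E.
Proof.
move=> Ff; apply: le_ereal_inf_tmp => _ [N [c _ cov]] <-.
have [i _] := cov f Ff; rewrite lee_fin -[1]/(1%:R) ler_nat.
by case: i => i; case: N {c cov}.
Qed.

Lemma lne2_ge0 (x : \bar R) : (1 <= x)%E -> (0 <= lne (2%:E * x))%E.
Proof.
move=> x1; rewrite lne_ge0 -[1%E]mule1; apply: lee_pmul => //.
by rewrite lee_fin ler1n.
Qed.

Lemma sqrt_lne2_le (x y : \bar R) : (1 <= x)%E -> (x <= y)%E ->
  (lne (2%:E * x) `^ 2^-1 <= lne (2%:E * y) `^ 2^-1)%E.
Proof.
move=> x1 xy; have y1 := le_trans x1 xy.
have dbl (z : \bar R) : (1 <= z)%E -> (2%:E * z)%E \in `[0%E, +oo%E].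
  by move=> z1; rewrite in_itv /= leey andbT mule_ge0// (le_trans _ z1).
apply: gt0_ler_poweR => //.
- by rewrite in_itv /= lne2_ge0// leey.
- by rewrite in_itv /= lne2_ge0// leey.
by rewrite lee_lne ?dbl// lee_pmul2l.
Qed.

(** A nonempty class has covering numbers at least 1, so the logarithms are nonnegative and the
    square root is monotone on them. *)
Lemma sup_entropy_antitone F C f e1 e2 : F f -> e1 <= e2 ->
  (sup_entropy F C e2 <= sup_entropy F C e1)%E.
Proof.
move=> Ff e12; apply: ge_ereal_sup => _ [Q SQ <-].
apply: (@le_trans _ _ (lne (2%:E * covering_number (e1%:E * L2norm Q C) F Q) `^ 2^-1)%E); last first.
  by apply: ereal_sup_ubound; exists Q.
apply: sqrt_lne2_le; first exact: covering_number_ge1 Ff.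
by apply: covering_number_antitone; rewrite lee_wpmul2r ?Lnorm_ge0.
Qed.

(** Superlevel sets are intervals. This makes the entropy integrand measurable although it is a
    supremum over uncountably many laws. *)
Lemma measurable_antitone (f : R -> \bar R) :
  (forall x y, x <= y -> (f y <= f x)%E) -> measurable_fun setT f.
Proof.
move=> fni mD; apply: (measurability _ (ErealGenOInfty.measurableE R)) => //.
move=> /= _ [_ [x ->]] <-; rewrite setTI; apply: is_interval_measurable => s t /=.
rewrite !in_itv /= !andbT => _ ft u /andP[_ ut].
by rewrite in_itv /= andbT; apply: (lt_le_trans ft); exact: fni.
Qed.

Lemma sup_entropy_ge0 F C e : (0 <= sup_entropy F C e)%E.
Proof.
pose Q : probability (borel R k) R := dirac (0 : borel R k).
have SQ : finitely_supported Q by exists [set 0] => //; rewrite /Q /= diracE mem_set.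
apply: le_trans (ereal_sup_ubound (imageP _ SQ)).
exact: poweR_ge0.
Qed.

(** On the interval from 2^-(j+4) to 2^-(j+3), of length 2^-(j+4), the antitone integrand is at
    least its value at the right end. The remaining integral is kept so that the induction can split
    off one interval at a time. *)
Lemma dyadic_entropy_integral F C f K : F f ->
  (\sum_(j < K) (((2 ^+ (j + 4))^-1)%:E * sup_entropy F C ((2 ^+ (j + 3))^-1)) +
   \int[lebesgue_measure]_(e in `]0%R, ((2 ^+ (K + 3))^-1)%R]) sup_entropy F C e
   <= entropy_integral F C (1 / 8)%R)%E.
Proof.
move=> Ff; have mA := measurable_antitone (fun x y => sup_entropy_antitone C Ff).
elim: K => [|K IH].
  rewrite big_ord0 add0e add0n /entropy_integral.
  by rewrite (_ : (2 ^+ 3)^-1 = 1 / 8 :> R)//; rewrite div1r; congr (_^-1); ring.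
apply: le_trans IH; rewrite big_ord_recr /= -addeA leeD2l//.
set e1 := (2 ^+ (K.+1 + 3))^-1; set e0 := (2 ^+ (K + 3))^-1.
have e1E : e1 = (2 ^+ (K + 4))^-1 by rewrite /e1 addSnnS.
have e0E : e0 = 2 * e1.
  rewrite /e1 /e0 addSn exprS invfM mulrA divff ?mul1r//; exact: lt0r_neq0.
have e10 : 0 < e1 by rewrite invr_gt0 exprn_gt0.
have -> : `]0, e0]%classic = `]0, e1]%classic `|` `]e1, e0]%classic :> set R.
  by rewrite -itv_bndbnd_setU// bnd_simp ?ltW// e0E; lra.
rewrite ge0_integral_setU//; last 3 first.
- exact: measurable_funTS.
- by move=> x _; exact: sup_entropy_ge0.
- rewrite disj_set2E; apply/eqP/seteqP; split => x //= [].
  by rewrite !in_itv/= => /andP[_ xe] /andP[+ _]; rewrite ltNge xe.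
rewrite addeC leeD2l// -e1E.
apply: (@le_trans _ _ (\int[lebesgue_measure]_(e in `]e1, e0]) sup_entropy F C e0)%E).
  rewrite integral_cst//= lebesgue_measure_itv/= lte_fin.
  rewrite ifT; last by rewrite e0E; lra.
  rewrite muleC (_ : (e0%:E - e1%:E)%E = e1%:E)//.
  by rewrite -EFinB e0E; congr EFin; lra.
apply: ge0_le_integral => //.
- by move=> x _; exact: sup_entropy_ge0.
- exact: measurable_funTS.
move=> x /=; rewrite in_itv /= => /andP[_ xe].
exact: (sup_entropy_antitone C Ff).
Qed.

(* Positive weights are allowed because the entropy is a supremum over all finitely
   supported laws: the factor (L_1 v 1)^2 is absorbed in the choice of the law. *)
Lemma entropy_covers F C f (M : R) :
  F f -> (forall g, F g -> measurable_fun [set: borel R k] g) ->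
  measurable_fun [set: borel R k] C ->
  (entropy_integral F C (1 / 8)%R <= M%:E)%E ->
  exists a : nat -> R, [/\ forall j, 0 <= a j,
    forall K, \sum_(j < K) (2 ^+ j)^-1 * a j <= 16 * M &
    forall j l (w : nat -> R) (p : nat -> 'rV[R]_k),
      (forall i, 0 < w i) -> (0 < l)%N ->
      exists N (c : 'I_N -> 'rV[R]_k -> R), [/\ (0 < N)%N, forall i, F (c i),
        ln (2 * N%:R) <= a j ^+ 2 &
        forall g, F g -> exists i,
          \sum_(q < l) w q * (g (p q) - c i (p q)) ^+ 2 <=
          ((2 ^+ (j + 3))^-1) ^+ 2 * \sum_(q < l) w q * C (p q) ^+ 2]].
Proof.
move=> Ff mF mC JM.
have bound K : (\sum_(j < K) (((2 ^+ (j + 4))^-1)%:E * sup_entropy F C ((2 ^+ (j + 3))^-1)) <= M%:E)%E.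
  apply: le_trans JM; apply: le_trans (dyadic_entropy_integral C K Ff).
  by rewrite leeDl//; apply: integral_ge0 => x _; exact: sup_entropy_ge0.
have Afin j : sup_entropy F C ((2 ^+ (j + 3))^-1) \is a fin_num.
  rewrite ge0_fin_numE ?sup_entropy_ge0// ltey; apply/eqP => Aoo.
  have := bound j.+1; rewrite big_ord_recr /= Aoo gt0_muley ?lte_fin ?invr_gt0 ?exprn_gt0//.
  rewrite addey ?leye_eq// gt_eqF// (lt_le_trans (ltNyr 0))// sume_ge0// => i _.
  by rewrite mule_ge0 ?sup_entropy_ge0// lee_fin.
(* The uniform square-root entropy at radius 2^-(j+3); the interval length 2^-(j+4) accounts for the
   factor 16 in the sum. *)
pose a j := fine (sup_entropy F C ((2 ^+ (j + 3))^-1)).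
have a0 j : 0 <= a j by rewrite fine_ge0// sup_entropy_ge0.
exists a; split => //.
  move=> K; have := bound K.
  under eq_bigr do rewrite -(fineK (Afin _)) -EFinM.
  rewrite sumEFin lee_fin => h.
  rewrite mulrC -ler_pdivrMr// mulr_suml; apply: le_trans h; rewrite le_eqVlt.
  apply/orP; left; apply/eqP; apply: eq_bigr => j _.
  rewrite exprD invfM -/(a j) (_ : 2 ^+ 4 = 16 :> R); last by ring.
  by rewrite mulrAC.
move=> j l w p w0 l0; set e := (2 ^+ (j + 3))^-1.
pose W := \sum_(q < l) w q.
have W0 : 0 < W.
  rewrite /W; case: l l0 {W} => // l _; rewrite big_ord_recl ltr_wpDr// sumr_ge0// => i _.
  exact: ltW.
(* Normalized weights define a finitely supported law. The covering inequality is homogeneous in the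
   weights, so the total [W] cancels at the end. *)
pose w' q := w q / W.
have w'0 q : 0 <= w' q by rewrite divr_ge0// ltW.
have w'1 : \sum_(q < l) w' q = 1 by rewrite -mulr_suml divff// gt_eqF.
pose Q : probability (borel R k) R :=
  HB.pack_for (probability (borel R k) R) (mixture (T := borel R k) l p w'0)
    (Measure_isProbability.Build _ _ _ (mixture (T := borel R k) l p w'0) (mixture_setT (T := borel R k) p w'0 w'1)).
have QL2 g : measurable_fun [set: borel R k] g ->
    L2norm Q g = ((\sum_(q < l) w' q * g (p q) ^+ 2) `^ 2^-1)%:E.
  exact: L2norm_mixture.
have SQ : finitely_supported Q.
  exists (p @` `I_l); first exact: finite_image.
  by apply: mixture_support => // q ql; exists q.
set eta := (e%:E * L2norm Q C)%E.
have c1 : (1 <= covering_number eta F Q)%E by exact: covering_number_ge1 Ff.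
have le_a : (lne (2%:E * covering_number eta F Q) `^ 2^-1 <= (a j)%:E)%E.
  by rewrite fineK//; apply: (ereal_sup_ubound (imageP _ SQ)).
pose S := [set N : nat | exists2 c : 'I_N -> 'rV[R]_k -> R, (forall i, F (c i)) &
      forall f, F f -> exists i, (L2norm Q (fun z => f z - c i z)%R <= eta)%E].
(* Without a finite cover the entropy would be infinite, against [le_a]. The least size of a cover
   then realizes the infimum. *)
have [N1 SN1] : exists N, `[< S N >].
  apply: contrapT => /forallNP noN.
  have : covering_number eta F Q = +oo%E.
    rewrite /covering_number -/S (_ : S = set0) ?image_set0 ?ereal_inf0//.
    by apply/seteqP; split => N //= SN; apply: (noN N); apply/asboolP.
  by move=> coo; move: le_a; rewrite coo gt0_muley ?lte_fin//= invr_eq0 pnatr_eq0.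
have exS : exists N, `[< S N >] by exists N1.
have [N /asboolP SN Nmin] := ex_minnP exS.
have [c Fc cov] := SN.
have Ncov : (N%:R%:E <= covering_number eta F Q)%E.
  apply: le_ereal_inf_tmp => _ [N' SN' <-]; rewrite lee_fin ler_nat.
  by apply: Nmin; apply/asboolP.
have N0 : (0 < N)%N by have [[i iN] _] := cov f Ff; exact: leq_ltn_trans iN.
have N1R : 1 <= N%:R :> R by rewrite ler1n.
have lnN : 0 <= ln (2 * N%:R) :> R.
  by apply: ln_ge0; lra.
exists N, c; split => //.
  have : ((ln (2 * N%:R) `^ 2^-1)%:E <= (a j)%:E)%E.
    apply: le_trans le_a; rewrite -poweR_EFin -lne_EFin ?mulr_gt0 ?ltr0n//.
    by rewrite EFinM; apply: sqrt_lne2_le => //; rewrite lee_fin.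
  rewrite lee_fin powR12_sqrt// => h.
  by rewrite -(sqr_sqrtr lnN) lerXn2r ?nnegrE ?sqrtr_ge0.
move=> g Fg; have [i gi] := cov g Fg; exists i.
move: gi; rewrite /eta !QL2//; last by apply: measurable_funB; exact: mF.
have sw h : \sum_(q < l) w' q * h q = (\sum_(q < l) w q * h q) / W.
  by rewrite mulr_suml; apply: eq_bigr => q _; rewrite mulrAC.
rewrite -EFinM lee_fin !powR12_sqrt; last 2 first.
- by apply: sumr_ge0 => q _; rewrite mulr_ge0// sqr_ge0.
- by apply: sumr_ge0 => q _; rewrite mulr_ge0// sqr_ge0.
have e0 : 0 <= e by rewrite invr_ge0 exprn_ge0.
move=> h.
have : \sum_(q < l) w' q * (g (p q) - c i (p q)) ^+ 2 <= e ^+ 2 * \sum_(q < l) w' q * C (p q) ^+ 2.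
  have s1 : 0 <= \sum_(q < l) w' q * (g (p q) - c i (p q)) ^+ 2.
    by apply: sumr_ge0 => q _; rewrite mulr_ge0// sqr_ge0.
  have s2 : 0 <= \sum_(q < l) w' q * C (p q) ^+ 2.
    by apply: sumr_ge0 => q _; rewrite mulr_ge0// sqr_ge0.
  rewrite -(sqr_sqrtr s1) -(sqr_sqrtr s2) -exprMn.
  by rewrite lerXn2r ?nnegrE ?sqrtr_ge0 ?mulr_ge0 ?sqrtr_ge0.
by rewrite !sw mulrA ler_pM2r ?invr_gt0.
Qed.

End Entropy.

(** * Chaining for the localized class *)

Section Grid.
Context {R : realType}.

(** The centres are the midpoints of [N] cells of width 2 / N; [key] locates the cell of x by
    induction on its right end. *)
Lemma grid_cover (N : nat) (x : R) : (0 < N)%N -> -1 <= x <= 1 ->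
  exists i : 'I_N, `|x - (-1 + (2 * i%:R + 1) / N%:R)| <= N%:R^-1.
Proof.
move=> N0 /andP[x1 x2]; have NR : 0 < N%:R :> R by rewrite ltr0n.
have key k : (0 < k <= N)%N -> x + 1 <= 2 * k%:R / N%:R ->
    exists i : 'I_N, `|x - (-1 + (2 * i%:R + 1) / N%:R)| <= N%:R^-1.
  elim: k => // k IH /andP[_ kN] xk.
  have [/andP[k0 xk']|nk] := boolP ((0 < k)%N && (x + 1 <= 2 * k%:R / N%:R)).
    by apply: IH => //; rewrite k0 ltnW.
  exists (Ordinal kN) => /=; rewrite ler_norml.
  have lo : 2 * k%:R / N%:R <= x + 1.
    move: nk; rewrite negb_and => /orP[|]; last by rewrite -ltNge => /ltW.
    by rewrite -eqn0Ngt => /eqP ->; rewrite mulr0 mul0r; lra.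
  have N0' : N%:R != 0 :> R by rewrite gt_eqF.
  move: xk lo; rewrite (_ : 2 * k.+1%:R / N%:R = 2 * k%:R / N%:R + N%:R^-1 + N%:R^-1); last first.
    by rewrite -[k.+1%:R]natr1; field.
  rewrite (_ : (2 * k%:R + 1) / N%:R = 2 * k%:R / N%:R + N%:R^-1); last by field.
  by move=> *; apply/andP; split; lra.
by apply: (key N); rewrite ?N0 ?leqnn// -mulrA divff ?gt_eqF//; lra.
Qed.

End Grid.

Section SqrtSums.
Context {R : realType}.

Lemma sqrtrD_le (x y : R) : 0 <= x -> 0 <= y ->
  Num.sqrt (x + y) <= Num.sqrt x + Num.sqrt y.
Proof.
move=> x0 y0; rewrite -ler_sqr ?nnegrE ?addr_ge0 ?sqrtr_ge0//.
rewrite sqrrD !sqr_sqrtr ?addr_ge0//.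
by have := mulr_ge0 (sqrtr_ge0 x) (sqrtr_ge0 y); lra.
Qed.

Lemma sum_inv_pow2_le2 K : \sum_(j < K) (2 ^+ j)^-1 <= 2 :> R.
Proof.
apply: (@le_trans _ _ (\sum_(j < K) 2 * (2 ^+ j.+1)^-1)).
  apply: ler_sum => j _; rewrite exprS invfM mulrA divff ?mul1r//.
by rewrite -mulr_sumr -[leRHS]mulr1 ler_pM2l// sum_half_pow_le1.
Qed.

Lemma sum_mul_inv_pow2_le2 K : \sum_(j < K) (2 ^+ j)^-1 * j%:R <= 2 :> R.
Proof.
have -> : \sum_(j < K) (2 ^+ j)^-1 * j%:R = 2 - (K%:R + 1) * 2 / 2 ^+ K :> R.
  elim: K => [|K IH]; first by rewrite big_ord0 expr0; field.
  rewrite big_ord_recr /= IH exprS -[K.+1%:R]natr1.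
  by field; rewrite expf_neq0.
by rewrite gerBl divr_ge0 ?exprn_ge0// mulr_ge0// addr_ge0.
Qed.

End SqrtSums.

Section ClassChaining.
Context {R : realType} {m k n : nat}.
Context (G : 'rV[R]_m -> 'rV[R]_k -> R) (H : 'rV[R]_m -> R -> 'rV[R]_k -> R).
Context (U : set 'rV[R]_m) (ts : 'rV[R]_m) (L1 L2 xi X : 'rV[R]_k -> R).
Context (psi a' D A M : R) (a : nat -> R).

Hypothesis U_ts : U ts.
Hypothesis L1_ge0 : forall z, 0 <= L1 z.
Hypothesis H_lip : forall theta theta' t s z, U theta -> U theta' ->
  `|H theta t z - H theta' s z| ^+ 2
     <= L1 z ^+ 2 * `|G theta z - G theta' z| ^+ 2 + L2 z ^+ 2 * `|t - s| ^+ 2.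
Hypothesis xi_env : forall theta z, U theta -> `|G theta z - G ts z| <= xi z.
Hypothesis XE : forall z, X z ^+ 2 = Num.max (L1 z) 1 ^+ 2 * xi z ^+ 2 + L2 z ^+ 2 * D ^+ 2.
Hypothesis X_ge0 : forall z, 0 <= X z.
Hypothesis D_gt0 : 0 < D.
Hypothesis a'_ge0 : 0 <= a'.
Hypothesis a'D : a' <= A * D.
Hypothesis A_ge1 : 1 <= A.
Hypothesis a_ge0 : forall j, 0 <= a j.
Hypothesis a_sum : forall K, \sum_(j < K) (2 ^+ j)^-1 * a j <= 16 * M.
Hypothesis a_cover : forall j l (w : nat -> R) (p : nat -> 'rV[R]_k),
  (forall i, 0 < w i) -> (0 < l)%N ->
  exists N (c : 'I_N -> 'rV[R]_m), [/\ (0 < N)%N, forall i, U (c i),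
    ln (2 * N%:R) <= a j ^+ 2 &
    forall theta, U theta -> exists i,
      \sum_(q < l) w q * (G theta (p q) - G (c i) (p q)) ^+ 2 <=
      ((2 ^+ (j + 3))^-1) ^+ 2 * \sum_(q < l) w q * xi (p q) ^+ 2].

Definition local_index : set ('rV[R]_m * R * R) :=
  [set p | [/\ U p.1.1, -1 <= p.1.2 <= 1 & -1 <= p.2 <= 1]].

(* [psi + a' * p.1.2] ranges over the possible sample means of [G ts], and
   [D * p.2] over their possible increments from [ts] to [p.1.1]. *)
Definition local_fun (p : 'rV[R]_m * R * R) (z : 'rV[R]_k) : R :=
  H p.1.1 (psi + a' * p.1.2 + D * p.2) z - H ts (psi + a' * p.1.2) z.

(** The shift a' q occurs in both terms, so the second arguments differ by D r only and the envelope
    does not involve a'. *)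
Lemma local_fun_le p z : local_index p -> `|local_fun p z| <= X z.
Proof.
move=> [Up _ p2]; rewrite -ler_sqr ?nnegrE//.
apply: le_trans (H_lip _ _ _ Up U_ts) _; rewrite XE; apply: lerD.
  apply: ler_pM; rewrite ?sqr_ge0//; rewrite lerXn2r ?nnegrE//.
  - by rewrite le_max L1_ge0.
  - by rewrite le_max lexx.
  - exact: le_trans (normr_ge0 _) (xi_env _ Up).
  - exact: xi_env.
rewrite ler_wpM2l ?sqr_ge0// (_ : _ - _ = D * p.2); last by ring.
rewrite normrM exprMn (gtr0_norm D_gt0) -[leRHS]mulr1 ler_wpM2l ?sqr_ge0//.
by rewrite -[leRHS](expr1n _ 2) lerXn2r ?nnegrE// ler_norml; move: p2; lra.
Qed.

(** The two occurrences of [H] are compared separately, whence the factors 2; the one at [ts]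
    depends on q alone. *)
Lemma local_fun_dist p p' z : local_index p -> local_index p' ->
  (local_fun p z - local_fun p' z) ^+ 2 <=
  2 * (Num.max (L1 z) 1 ^+ 2 * (G p.1.1 z - G p'.1.1 z) ^+ 2) +
  2 * (L2 z ^+ 2 * ((a' * (p.1.2 - p'.1.2) + D * (p.2 - p'.2)) ^+ 2
     + (a' * (p.1.2 - p'.1.2)) ^+ 2)).
Proof.
move=> [Up _ _] [Up' _ _].
set x := H p.1.1 (psi + a' * p.1.2 + D * p.2) z - H p'.1.1 (psi + a' * p'.1.2 + D * p'.2) z.
set y := H ts (psi + a' * p.1.2) z - H ts (psi + a' * p'.1.2) z.
have -> : local_fun p z - local_fun p' z = x - y by rewrite /local_fun /x /y; ring.
have hx : x ^+ 2 <= Num.max (L1 z) 1 ^+ 2 * (G p.1.1 z - G p'.1.1 z) ^+ 2 +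
    L2 z ^+ 2 * (a' * (p.1.2 - p'.1.2) + D * (p.2 - p'.2)) ^+ 2.
  rewrite -real_normK ?num_real//; apply: le_trans (H_lip _ _ _ Up Up') _.
  rewrite !real_normK ?num_real//; apply: lerD.
    rewrite ler_wpM2r ?sqr_ge0// lerXn2r ?nnegrE// ?le_max ?L1_ge0// lexx//.
  by rewrite (_ : _ - _ = a' * (p.1.2 - p'.1.2) + D * (p.2 - p'.2))//; ring.
have hy : y ^+ 2 <= L2 z ^+ 2 * (a' * (p.1.2 - p'.1.2)) ^+ 2.
  rewrite -real_normK ?num_real//; apply: le_trans (H_lip _ _ _ U_ts U_ts) _.
  rewrite subrr normr0 expr0n/= mulr0 add0r real_normK ?num_real//.
  by rewrite (_ : _ - _ = a' * (p.1.2 - p'.1.2))//; ring.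
have := sqr_ge0 (x + y); nra.
Qed.

(** One sequence of 2 n points, first components before second ones: a single cover has to serve
    both samples. *)
Definition pair_point (u : n.-tuple ('rV[R]_k * 'rV[R]_k)) (q : nat) : 'rV[R]_k :=
  if (q < n)%N then (nth (0, 0) u q).1 else (nth (0, 0) u (q - n)).2.

Lemma sum_pair_point u (F : 'rV[R]_k -> R) :
  \sum_(q < n + n) F (pair_point u q) = \sum_(j < n) (F (tnth u j).1 + F (tnth u j).2).
Proof.
rewrite big_split_ord big_split /=; congr (_ + _); apply: eq_bigr => j _.
  by rewrite /pair_point ltn_ord (tnth_nth (0, 0)).
by rewrite /pair_point ltnNge leq_addr /= addKn (tnth_nth (0, 0)).
Qed.

Let e (j : nat) : R := (2 ^+ (j + 3))^-1.

Let e_gt0 j : 0 < e j. Proof. by rewrite invr_gt0 exprn_gt0. Qed.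

(** A cover for [G], with weights (L_1 v 1)^2, is multiplied by grids of 2^(j+3) cells for r and
    about A 2^(j+3) cells for q, so that D / N2 and a' / N1 are at most D 2^-(j+3). The grids have
    at most 128 A 4^j points together. The factor 10 is twice the 5 of [dab]. *)
Lemma class_cover (u : n.-tuple ('rV[R]_k * 'rV[R]_k)) (j : nat) : (0 < n)%N ->
  exists N (c : 'I_N -> 'rV[R]_m * R * R),
    [/\ (0 < N)%N, forall i, local_index (c i),
      ln (2 * N%:R) <= a j ^+ 2 + ln (128 * A * 4 ^+ j) &
      forall p, local_index p -> exists i,
        \sum_(q < n + n) (local_fun p (pair_point u q) - local_fun (c i) (pair_point u q)) ^+ 2
        <= 10 * e j ^+ 2 * \sum_(q < n + n) X (pair_point u q) ^+ 2].
Proof.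
move=> n0.
have mx0 z : 0 < Num.max (L1 z) 1 ^+ 2 by rewrite exprn_gt0// lt_max ltr01 orbT.
have nn0 : (0 < n + n)%N by rewrite addn_gt0 n0.
have [NG [cG [NG0 UcG lnG covG]]] := a_cover j (pair_point u) (fun q => mx0 (pair_point u q)) nn0.
pose N2 := (2 ^ (j + 3))%N.
pose N1 := (Num.truncn (A * 2 ^+ (j + 3))).+1.
have N1lo : A * 2 ^+ (j + 3) <= N1%:R.
  by rewrite ltW//; apply: truncnS_gt.
have N1hi : N1%:R <= A * 2 ^+ (j + 4).
  rewrite /N1 -natr1 (addnS j 3) exprS mulrCA mulr2n mulrDl mul1r lerD//.
    by rewrite truncn_le// mulr_ge0 ?exprn_ge0// (le_trans ler01).
  have h2 : 1 <= 2 ^+ (j + 3) :> R by rewrite exprn_ege1//; lra.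
  by have := A_ge1; nra.
have N20 : (0 < N2)%N by rewrite expn_gt0.
pose T3 := ('I_NG * 'I_N1 * 'I_N2)%type.
pose gr (N : nat) (i : 'I_N) : R := -1 + (2 * i%:R + 1) / N%:R.
have gr_in N (i : 'I_N) : -1 <= gr N i <= 1.
  have NR : 0 < N%:R :> R by rewrite ltr0n; case: i => i; case: N.
  have iN : i%:R + 1 <= N%:R :> R by rewrite natr1 ler_nat.
  have i0 : 0 <= i%:R :> R by [].
  have h0 : 0 <= (2 * i%:R + 1) / N%:R :> R by apply: divr_ge0; [lra|exact: ltW].
  have h1 : (2 * i%:R + 1) / N%:R <= 2 :> R by rewrite ler_pdivrMr//; lra.
  by rewrite /gr; apply/andP; split; lra.
pose f (x : T3) := (cG x.1.1, gr N1 x.1.2, gr N2 x.2).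
exists #|{: T3}|, (fun i => f (enum_val i)); split.
- by rewrite !card_prod !card_ord !muln_gt0 NG0 N20.
- by move=> i; split; rewrite /f /=; [exact: UcG|exact: gr_in|exact: gr_in].
- rewrite !card_prod !card_ord.
  have hN : (NG * N1 * N2)%:R <= NG%:R * (128 * A * 4 ^+ j) :> R.
    rewrite !natrM -mulrA ler_wpM2l//.
    rewrite (_ : 128 * A * 4 ^+ j = (A * 2 ^+ (j + 4)) * 2 ^+ (j + 3)); last first.
      rewrite (_ : 4 ^+ j = 2 ^+ j * 2 ^+ j); last by rewrite -exprMn; congr (_ ^+ _); ring.
      by rewrite !exprD; ring.
    by rewrite /N2 natrX ler_wpM2r// exprn_ge0.
  have A0 : 0 < 128 * A * 4 ^+ j by rewrite !mulr_gt0 ?exprn_gt0// (lt_le_trans ltr01 A_ge1).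
  have NG0R : 0 < 2 * NG%:R :> R by rewrite mulr_gt0// ltr0n.
  have N3R : 0 < 2 * (NG * N1 * N2)%:R :> R.
    by rewrite mulr_gt0// ltr0n !muln_gt0 NG0 N20.
  apply: (@le_trans _ _ (ln ((2 * NG%:R) * (128 * A * 4 ^+ j)))).
    rewrite ler_ln ?posrE//; last exact: mulr_gt0.
    by rewrite -[leRHS]mulrA ler_pM2l.
  by rewrite lnM ?posrE// lerD2r.
move=> p pI; have [Up p1 p2] := pI.
have [iG hG] := covG _ Up.
have [i1 h1] := grid_cover (ltn0Sn _ : (0 < N1)%N) p1.
have [i2 h2] := grid_cover N20 p2.
exists (enum_rank (iG, i1, i2)); rewrite enum_rankK /f /=.
have fI : local_index (cG iG, gr N1 i1, gr N2 i2).
  by split => /=; [exact: UcG|exact: gr_in|exact: gr_in].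
have d1 : `|a' * (p.1.2 - gr N1 i1)| <= e j * D.
  rewrite normrM ger0_norm//.
  have A0 : 0 < A by exact: lt_le_trans A_ge1.
  apply: (@le_trans _ _ (A * D * N1%:R^-1)).
    by apply: ler_pM.
  rewrite mulrAC ler_pM2r// ler_pdivrMr ?ltr0n// /e mulrC ler_pdivlMr ?exprn_gt0//.
have d2 : `|D * (p.2 - gr N2 i2)| <= e j * D.
  rewrite normrM gtr0_norm// mulrC ler_pM2r//.
  by rewrite /e -natrX; exact: h2.
pose da := a' * (p.1.2 - gr N1 i1); pose db := D * (p.2 - gr N2 i2).
have dab : (da + db) ^+ 2 + da ^+ 2 <= 5 * (e j * D) ^+ 2.
  have h3 : da ^+ 2 <= (e j * D) ^+ 2.
    by rewrite -real_normK ?num_real// lerXn2r ?nnegrE ?mulr_ge0 ?(ltW (e_gt0 j)) ?(ltW D_gt0).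
  have h4 : db ^+ 2 <= (e j * D) ^+ 2.
    by rewrite -real_normK ?num_real// lerXn2r ?nnegrE ?mulr_ge0 ?(ltW (e_gt0 j)) ?(ltW D_gt0).
  have := sqr_ge0 (da - db); nra.
apply: (@le_trans _ _ (\sum_(q < n + n)
   (2 * (Num.max (L1 (pair_point u q)) 1 ^+ 2 * (G p.1.1 (pair_point u q) - G (cG iG) (pair_point u q)) ^+ 2)
    + 2 * (L2 (pair_point u q) ^+ 2 * (5 * (e j * D) ^+ 2))))).
  apply: ler_sum => q _; apply: le_trans (local_fun_dist _ pI fI) _.
  by rewrite /= lerD2l ler_pM2l// ler_wpM2l ?sqr_ge0.
rewrite big_split -mulr_sumr /=.
apply: (@le_trans _ _ (2 * (e j ^+ 2 * (\sum_(q < n + n) Num.max (L1 (pair_point u q)) 1 ^+ 2 * xi (pair_point u q) ^+ 2))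
  + \sum_(q < n + n) 2 * (L2 (pair_point u q) ^+ 2 * (5 * (e j * D) ^+ 2)))).
  by rewrite lerD2r ler_pM2l//.
rewrite !mulr_sumr -big_split /=; apply: ler_sum => q _; rewrite XE exprMn.
set P1 := Num.max _ _ ^+ 2; set P2 := xi _ ^+ 2; set P3 := L2 _ ^+ 2.
have P12 : 0 <= P1 * P2 by rewrite mulr_ge0 ?sqr_ge0.
have := mulr_ge0 (sqr_ge0 (e j)) P12; lra.
Qed.

(** The square root in each threshold is split into the entropy, a part independent of the level and
    a part linear in the level. The last two are summed by the series of 2^-j and of j 2^-j, both at
    most 2. *)
Lemma class_chaining (u : n.-tuple ('rV[R]_k * 'rV[R]_k)) (V tau : R) :
  (0 < n)%N -> 0 <= tau -> 0 < V ->
  2 * \sum_(j < n) (X (tnth u j).1 ^+ 2 + X (tnth u j).2 ^+ 2) <= V ->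
  #|[set sg : {ffun 'I_n -> bool} | `[< exists2 p, local_index p &
     Num.sqrt V * (Num.sqrt 2 * (16 * M + 2 * Num.sqrt (ln (256 * A) + tau) + 2 * Num.sqrt (ln 8)))
     < `|rsum (fun j => local_fun p (tnth u j).1 - local_fun p (tnth u j).2) sg| >]]%SET|%:R
  <= 2 ^+ n * expR (- tau) :> R.
Proof.
move=> n0 tau0 V0 XV; set B := Num.sqrt 2 * _.
pose I := {p | local_index p}.
pose x (i : I) (j : 'I_n) := local_fun (sval i) (tnth u j).1 - local_fun (sval i) (tnth u j).2.
have XVs : 2 * \sum_(q < n + n) X (pair_point u q) ^+ 2 <= V.
  by rewrite (sum_pair_point u (fun z => X z ^+ 2)).
have sqB (y z : R) : (y - z) ^+ 2 <= 2 * (y ^+ 2 + z ^+ 2).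
  by have := sqr_ge0 (y + z); nra.
have xV i : \sum_(j < n) x i j ^+ 2 <= V.
  apply: le_trans XV; rewrite mulr_sumr; apply: ler_sum => j _.
  apply: (le_trans (sqB _ _)); rewrite ler_pM2l// -!(real_normK (num_real (local_fun _ _))).
  by apply: lerD; rewrite lerXn2r ?nnegrE//; apply: local_fun_le; exact: (svalP i).
have cc j : {N : nat & {c : 'I_N -> I | [/\ (0 < N)%N,
      ln (2 * N%:R) <= a j ^+ 2 + ln (128 * A * 4 ^+ j) &
      forall i, exists l, \sum_(q < n) (x i q - x (c l) q) ^+ 2 <= V * (4 ^+ j.+1)^-1]}}.
  have /cid[N /cid[c [N0 cI lnN cov]]] := class_cover u j n0.
  exists N; exists (fun i => exist _ (c i) (cI i)); split => // i.
  have [l hl] := cov _ (svalP i); exists l.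
  apply: (@le_trans _ _ (2 * \sum_(q < n + n) (local_fun (sval i) (pair_point u q) - local_fun (c l) (pair_point u q)) ^+ 2)).
    rewrite (sum_pair_point u (fun z => (local_fun (sval i) z - local_fun (c l) z) ^+ 2)).
    rewrite mulr_sumr; apply: ler_sum => q _; rewrite /x /=.
    by apply: le_trans (sqB _ _); rewrite le_eqVlt; apply/orP; left; apply/eqP; ring.
  (* 10 e_j^2 = (10 / 64) 4^-j lies below the 4^-(j+1) that chaining asks for; this is where
     starting the entropy integral at 1/8 pays. *)
  apply: (@le_trans _ _ (10 * e j ^+ 2 * V)).
    have e20 : 0 <= 10 * e j ^+ 2 by rewrite mulr_ge0// sqr_ge0.
    apply: le_trans (ler_wpM2l e20 XVs).
    by rewrite mulrCA ler_pM2l.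
  have p4 : 0 < (4 ^+ j)^-1 :> R by rewrite invr_gt0 exprn_gt0.
  have -> : e j ^+ 2 = (4 ^+ j)^-1 / 64.
    have -> : 4 = 2 * 2 :> R by ring.
    by rewrite /e exprD exprMn; field; rewrite expf_neq0.
  have -> : V / 4 ^+ j.+1 = V * ((4 ^+ j)^-1 / 4) by rewrite exprS invfM [4^-1 * _]mulrC.
  by have := mulr_gt0 V0 p4; lra.
pose N j := projT1 (cc j).
pose c j : 'I_(N j) -> I := sval (projT2 (cc j)).
have N0 j : (0 < N j)%N by case: (svalP (projT2 (cc j))).
have lnN j : ln (2 * (N j)%:R) <= a j ^+ 2 + ln (128 * A * 4 ^+ j).
  by case: (svalP (projT2 (cc j))).
have cov j i : exists l : 'I_(N j), \sum_(q < n) (x i q - x (c j l) q) ^+ 2 <= V * (4 ^+ j.+1)^-1.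
  by have [_ _] := svalP (projT2 (cc j)); apply.
(* Chosen so that the tail condition becomes an equality: the summands account for the factor 2 N_j
   of the union bound, for e^-tau and for 2^-(j+1). *)
pose E j := ln (2 * (N j)%:R) + tau + j.+1%:R * ln 2.
have N0R j : 0 < 2 * (N j)%:R :> R by rewrite mulr_gt0// ltr0n.
have ln20 : 0 < ln 2 :> R by rewrite ln_gt0// ltr1n.
have E0 j : 0 <= E j.
  rewrite /E !addr_ge0// ?mulr_ge0// ?(ltW ln20)// ln_ge0//.
  by have : 1 <= (N j)%:R :> R; [rewrite ler1n|lra].
pose b j := (2 ^+ j)^-1 * (Num.sqrt 2 * Num.sqrt (E j)).
have b0 j : 0 <= b j by rewrite /b !mulr_ge0 ?sqrtr_ge0// invr_ge0 exprn_ge0.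
have b_tail j : (N j)%:R * (2 * expR (- (b j ^+ 2 * 4 ^+ j / 2))) <= expR (- tau) * (2 ^+ j.+1)^-1.
  have -> : b j ^+ 2 * 4 ^+ j / 2 = E j.
    rewrite /b !exprMn !sqr_sqrtr// exprVn -exprM mulnC exprM (_ : 2 ^+ 2 = 4 :> R); last by ring.
    by field; rewrite expf_neq0//; apply/eqP; lra.
  have eE : expR (E j) = 2 * (N j)%:R * expR tau * 2 ^+ j.+1.
    by rewrite /E !expRD expRM_natl !lnK ?posrE.
  rewrite !expRN eE le_eqVlt; apply/orP; left; apply/eqP; field.
  by rewrite !gt_eqF ?expR_gt0 ?exprn_gt0// ltr0n.
have b_sum K : \sum_(j < K) b j <= B.
  have A0 : 0 < A by exact: lt_le_trans A_ge1.
  have ln80 : 0 <= ln 8 :> R by rewrite ln_ge0//; lra.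
  have lA0 : 0 <= ln (256 * A) + tau by rewrite addr_ge0// ln_ge0//; have := A_ge1; lra.
  pose L := Num.sqrt (ln (256 * A) + tau).
  apply: (@le_trans _ _ (\sum_(j < K) Num.sqrt 2 * ((2 ^+ j)^-1 * a j + (2 ^+ j)^-1 * L + (2 ^+ j)^-1 * j%:R * Num.sqrt (ln 8)))).
    apply: ler_sum => j _; rewrite /b mulrCA ler_pM2l ?sqrtr_gt0// -mulrA -!mulrDr.
    rewrite ler_pM2l ?invr_gt0 ?exprn_gt0//.
    have EE : E j <= a j ^+ 2 + (ln (256 * A) + tau) + j%:R ^+ 2 * ln 8.
      have l1 : ln (128 * A * 4 ^+ j) = ln 128 + ln A + j%:R * ln 4.
        by rewrite !lnM ?posrE ?mulr_gt0 ?exprn_gt0// lnXn// mulr_natl.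
      have l2 : ln (256 * A) = ln 128 + ln 2 + ln A.
        rewrite (_ : 256 = 128 * 2); last by ring.
        by rewrite !lnM ?posrE ?mulr_gt0.
      have l3 : ln 8 = ln 4 + ln 2 :> R by rewrite -lnM ?posrE//; congr ln; ring.
      have l4 : ln 4 = 2 * ln 2 :> R.
        by rewrite (_ : 4 = 2 * 2); [rewrite lnM ?posrE//; ring|ring].
      (* Weakened so that the square root of this part is linear in j. *)
      have jj : j%:R * ln 8 <= j%:R ^+ 2 * ln 8 :> R.
        by rewrite ler_wpM2r// expr2 -natrM ler_nat; case: (nat_of_ord j) => // j'; rewrite leq_pmulr.
      have := lnN j; rewrite /E l1 l2 -[j.+1%:R]natr1.
      move: jj; rewrite {1}l3 mulrDr; lra.
    apply: (@le_trans _ _ (Num.sqrt (a j ^+ 2 + (ln (256 * A) + tau) + j%:R ^+ 2 * ln 8))).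
      by rewrite ler_sqrt//; exact: le_trans (E0 j) EE.
    have jl0 : 0 <= j%:R ^+ 2 * ln 8 :> R by rewrite mulr_ge0// sqr_ge0.
    apply: (le_trans (sqrtrD_le (addr_ge0 (sqr_ge0 (a j)) lA0) jl0)).
    rewrite sqrtrM ?sqr_ge0// (sqrtr_sqr j%:R) (ger0_norm (ler0n _ _)) lerD2r.
    apply: (le_trans (sqrtrD_le (sqr_ge0 (a j)) lA0)).
    by rewrite sqrtr_sqr ger0_norm.
  rewrite -mulr_sumr ler_pM2l ?sqrtr_gt0// !big_split /= -!mulr_suml.
  apply: lerD; first apply: lerD; first exact: a_sum.
    by rewrite ler_wpM2r ?sqrtr_ge0// sum_inv_pow2_le2.
  by rewrite ler_wpM2r ?sqrtr_ge0// sum_mul_inv_pow2_le2.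
apply: le_trans (chaining V0 xV cov b0 b_tail b_sum).
rewrite ler_nat; apply: subset_leq_card; apply/fintype.subsetP => sg; rewrite !inE.
by move=> [p pI hp]; exists (exist _ p pI); exact: hp.
Qed.

End ClassChaining.

(** * Tail bounds for the empirical sums *)

Section Tail.
Context {R : realType} {d} {T : measurableType d} (Q : probability T R).
Context {I : Type} (S : set I) (h : I -> T -> R) (X : T -> R) (s M A : R) (n : nat).
Hypothesis S_countable : countable S.
Hypothesis mh : forall i, S i -> measurable_fun setT (h i).
Hypothesis mX : measurable_fun setT X.
Hypothesis hX : forall i z, S i -> `|h i z| <= X z.
Hypothesis s_gt0 : 0 < s.
Hypothesis Xs : (\int[Q]_z (X z ^+ 2)%:E <= (s ^+ 2)%:E)%E.
Hypothesis n_gt0 : (0 < n)%N.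
Hypothesis M_ge0 : 0 <= M.
Hypothesis A_ge1 : 1 <= A.

Let chain_bound (tau : R) :=
  Num.sqrt 2 * (16 * M + 2 * Num.sqrt (ln (256 * A) + tau) + 2 * Num.sqrt (ln 8)).

Hypothesis chain : forall (u : n.-tuple (T * T)) (V tau : R), 0 <= tau -> 0 < V ->
  2 * \sum_(j < n) (X (tnth u j).1 ^+ 2 + X (tnth u j).2 ^+ 2) <= V ->
  #|[set sg : {ffun 'I_n -> bool} | `[< exists2 p, S p &
     Num.sqrt V * (Num.sqrt 2 * (16 * M + 2 * Num.sqrt (ln (256 * A) + tau) + 2 * Num.sqrt (ln 8)))
     < `|rsum (fun j => h p (tnth u j).1 - h p (tnth u j).2) sg| >]]%SET|%:R
  <= 2 ^+ n * expR (- tau) :> R.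

(** Deviations are measured in units of sqrt(n) s, where s bounds the L^2 norm of the envelope. *)
Definition dev_event (y : R) : set (n.-tuple T) :=
  [set z | exists2 i, S i & (y * Num.sqrt n%:R * s
     < `|\sum_(j < n) (h i (tnth z j) - fine (\int[Q]_z (h i z)%:E)%E)|)%R].

Definition sqr_event (c : R) : set (n.-tuple T) :=
  [set z | (\sum_(j < n) X (tnth z j) ^+ 2 <= c * n%:R * s ^+ 2)%R].

Lemma dev_tail (c1 y tau : R) : 0 <= c1 -> 0 <= tau ->
  Num.sqrt (2 * (c1 + 2)) * chain_bound tau <= y - 2 ->
  (power_measure Q n (dev_event y `&` sqr_event c1) <= (4 * expR (- tau))%:E)%E.
Proof.
move=> c10 tau0 hy; have nR : 0 < n%:R :> R by rewrite ltr0n.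
apply: (symmetrization_tail S_countable mh mX hX s_gt0 Xs n_gt0 c10) => u uX.
pose V := 2 * ((c1 + 2) * n%:R * s ^+ 2).
have V0 : 0 < V by rewrite /V !mulr_gt0 ?exprn_gt0// ltr_wpDl.
have uV : 2 * \sum_(j < n) (X (tnth u j).1 ^+ 2 + X (tnth u j).2 ^+ 2) <= V.
  by rewrite ler_pM2l.
apply: le_trans (chain tau0 V0 uV).
rewrite ler_nat; apply: subset_leq_card; apply/fintype.subsetP => sg; rewrite !inE.
move=> [p pI hp]; exists p => //; apply: le_lt_trans hp.
have -> : Num.sqrt V = Num.sqrt (2 * (c1 + 2)) * (Num.sqrt n%:R * s).
  rewrite /V (_ : 2 * _ = (2 * (c1 + 2)) * (n%:R * s ^+ 2)); last by ring.
  rewrite sqrtrM ?mulr_ge0 ?addr_ge0// (sqrtrM (s ^+ 2) (ltW nR)) sqrtr_sqr.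
  by rewrite (gtr0_norm s_gt0).
rewrite mulrAC -[leRHS]mulrA ler_wpM2r// mulr_ge0 ?sqrtr_ge0//; exact: ltW.
Qed.

Let q := Num.sqrt (ln 24 + ln A).
Let eta := 64 * Num.sqrt 2 * M + 32 * q.

Let A_gt0 : 0 < A. Proof. exact: lt_le_trans A_ge1. Qed.

Let lnA_ge0 : 0 <= ln A. Proof. exact: ln_ge0. Qed.

(** From e^(-1/2) >= 1/2 follow e <= 4 and e^2 <= 16. *)
Let ln24_ge2 : 2 <= ln 24 :> R.
Proof.
have e2 : expR (2^-1) <= 2 :> R.
  have := @expR_ge1Dx R (- 2^-1); rewrite expRN (_ : 1 + - 2^-1 = 2^-1); last by field.
  by rewrite lef_pV2 ?posrE ?expR_gt0.
have e1 : expR 1 <= 4 :> R.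
  have -> : expR 1 = expR 2^-1 * expR 2^-1 :> R by rewrite -expRD; congr expR; field.
  by have := @expR_ge0 R 2^-1; nra.
rewrite -[leLHS]expRK ler_ln ?posrE ?expR_gt0//.
have -> : expR 2 = expR 1 * expR 1 :> R by rewrite -expRD; congr expR; ring.
by have := @expR_ge0 R 1; nra.
Qed.

Let q_ge1 : 5 / 4 <= q.
Proof.
have p0 : 0 <= 5 / 4 :> R by lra.
rewrite /q -[leLHS](ger0_norm p0) -sqrtr_sqr ler_sqrt; have := ln24_ge2; have := lnA_ge0; nra.
Qed.

Let q2 : q ^+ 2 = ln 24 + ln A.
Proof. by rewrite /q sqr_sqrtr//; have := ln24_ge2; have := lnA_ge0; lra. Qed.

Let sqrt_ln8 : Num.sqrt (ln 8) <= q :> R.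
Proof.
rewrite /q ler_sqrt; first by apply: ler_wpDr => //; rewrite ler_ln ?posrE//; lra.
by have := ln24_ge2; have := lnA_ge0; lra.
Qed.

Let ln256 : ln (256 * A) <= 2 * q ^+ 2.
Proof.
rewrite q2 lnM ?posrE//.
have : ln 256 <= ln 24 + ln 24 :> R.
  by rewrite -lnM ?posrE// ler_ln ?posrE ?mulr_gt0//; lra.
by have := lnA_ge0; lra.
Qed.

Let sqrt2_bounds : 1 <= (Num.sqrt 2 : R) <= 2.
Proof.
apply/andP; split; first by rewrite -[leLHS]sqrtr1 ler_sqrt//; lra.
by rewrite -[leRHS](@ger0_norm _ 2)// -sqrtr_sqr ler_sqrt//; lra.
Qed.

Let eta_ge : 64 * M + 32 * q <= eta.
Proof.
rewrite /eta lerD2r -mulrA ler_pM2l// -[leLHS]mul1r ler_wpM2r//.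
by case/andP: sqrt2_bounds.
Qed.

(** The choice tau = (y / 16)^2 spends y / 2 on the term with tau, and y > 1 + 2 eta leaves the
    other half for the entropy terms. For y >= 65 the resulting Gaussian bound, with its factor 4 <=
    e^4, is below e^(-y / 40). *)
Lemma dev_tail_exp (y : R) : 1 + 2 * eta < y ->
  (power_measure Q n (dev_event y `&` sqr_event 2) <= (expR (- (y / 40)))%:E)%E.
Proof.
move=> hy; have q1 := q_ge1; have e0 := eta_ge; have M0 := M_ge0.
have y65 : 65 <= y by lra.
apply: (@le_trans _ _ (4 * expR (- (y / 16) ^+ 2))%:E); last first.
  rewrite lee_fin.
  have e4 : 4 <= expR 4 :> R by have := @expR_ge1Dx R 4; lra.
  apply: le_trans (ler_wpM2r (expR_ge0 _) e4) _.
  by rewrite -expRD ler_expR; nra.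
apply: dev_tail => //; first exact: sqr_ge0.
rewrite /chain_bound mulrA -sqrtrM//.
rewrite (_ : 2 * (2 + 2) * 2 = 4 ^+ 2); last by ring.
rewrite sqrtr_sqr ger0_norm//.
have h1 : Num.sqrt (ln (256 * A) + (y / 16) ^+ 2) <= (3 / 2) * q + y / 16.
  have p0 : 0 <= (3 / 2) * q + y / 16 by lra.
  rewrite -[leRHS](ger0_norm p0) -sqrtr_sqr ler_sqrt ?sqr_ge0//.
  have := ln256; nra.
have h2 := sqrt_ln8.
by have := eta_ge; lra.
Qed.

(** With r = y / eta, the squares exceed 2 r n s^2 with probability at most 1 / (2 r) by Markov's
    inequality; elsewhere tau = ln (8 r) gives 4 / (8 r). The sum is eta / y, what Markov's
    inequality would yield from a bound eta on the mean of the normalized supremum. *)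
Lemma dev_tail_markov (y : R) : eta < y ->
  (power_measure Q n (dev_event y) <= (eta / y)%:E)%E.
Proof.
move=> hy; have q1 := q_ge1; have e0 := eta_ge; have M0 := M_ge0.
have eta0 : 0 < eta by lra.
have y0 : 0 < y by lra.
pose r := y / eta.
have r1 : 1 < r by rewrite /r ltr_pdivlMr// mul1r.
have r0 : 0 < r by lra.
have nR : 0 < n%:R :> R by rewrite ltr0n.
have msqr c : measurable (sqr_event c).
  rewrite -[X in measurable X]setTI; apply: measurable_fun_ler => //.
  apply: measurable_sum => j; apply: measurable_funX.
  by apply: (measurableT_comp mX); exact: measurable_tnth.
have mdev : measurable (dev_event y) by apply: measurable_dev.
have p1 : (power_measure Q n (dev_event y `&` sqr_event (2 * r)) <= (4 * expR (- ln (8 * r)))%:E)%E.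
  have l8 : ln (8 * r) = ln 8 + ln r by rewrite lnM ?posrE.
  have ln8 : 0 <= ln 8 :> R by rewrite ln_ge0//; lra.
  have lnr : 0 <= ln r by rewrite ln_ge0// ltW.
  apply: dev_tail; [lra| by rewrite l8 addr_ge0|].
  set w := Num.sqrt r.
  have w0 : 0 <= w by exact: sqrtr_ge0.
  have w2 : w ^+ 2 = r by rewrite /w sqr_sqrtr// ltW.
  have w1 : 1 <= w by rewrite /w -[leLHS]sqrtr1 ler_sqrt// ltW.
  have h1 : Num.sqrt (ln (256 * A) + ln (8 * r)) <= 2 * q + w.
    have p0 : 0 <= 2 * q + w by lra.
    rewrite -[leRHS](ger0_norm p0) -sqrtr_sqr ler_sqrt ?sqr_ge0//.
    have lr : ln r <= r by apply: ltW; exact: ln_sublinear.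
    have l824 : ln 8 <= q ^+ 2.
      by rewrite q2 ler_wpDr// ler_ln ?posrE//; lra.
    have q0 : 0 <= q by lra.
    rewrite l8; have := ln256; have := mulr_ge0 q0 w0; nra.
  have h2 := sqrt_ln8.
  have h3 : Num.sqrt (2 * (2 * r + 2)) * Num.sqrt 2 <= 4 * w.
    rewrite -sqrtrM; last by lra.
    have p0 : 0 <= 4 * w by lra.
    rewrite -[leRHS](ger0_norm p0) -sqrtr_sqr ler_sqrt ?sqr_ge0//.
    by rewrite exprMn w2; lra.
  rewrite /chain_bound mulrA.
  have b0 : 0 <= 16 * M + 2 * (2 * q + w) + 2 * q by lra.
  apply: (@le_trans _ _ (4 * w * (16 * M + 2 * (2 * q + w) + 2 * q))).
    apply: ler_pM => //.
    - have := sqrtr_ge0 (ln (256 * A) + ln (8 * r)); have := sqrtr_ge0 (ln 8 : R); lra.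
    by apply: lerD; [apply: lerD => //|]; rewrite ler_pM2l.
  have yE : y = r * eta by rewrite /r divfK// gt_eqF.
  have h4 : r * (64 * M + 32 * q) <= y by rewrite yE ler_pM2l.
  have wr : w <= r by rewrite -w2; nra.
  have h5 : w * M <= r * M by rewrite ler_wpM2r.
  have h6 : w * q <= r * q by rewrite ler_wpM2r//; lra.
  have h7 : r * (5 / 4) <= r * q by rewrite ler_pM2l.
  nra.
have p2 : (power_measure Q n (~` sqr_event (2 * r)) <= (1 / (2 * r))%:E)%E.
  have fin : (\int[Q]_z (X z ^+ 2)%:E)%E \is a fin_num.
    rewrite ge0_fin_numE; first exact: le_lt_trans Xs (ltry _).
    by apply: integral_ge0 => z _; rewrite lee_fin sqr_ge0.
  pose v := fine (\int[Q]_z (X z ^+ 2)%:E)%E.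
  have vE : (\int[Q]_z (X z ^+ 2)%:E = v%:E)%E by rewrite fineK.
  have vs : v <= s ^+ 2 by rewrite -lee_fin -vE.
  have i1 : (\int[power_measure Q n]_z (\sum_(j < n) X (tnth z j) ^+ 2)%:E <= (n%:R * v)%:E)%E.
    by rewrite (integral_power_sum n (measurable_funX 2 mX) (fun x => sqr_ge0 (X x)) vE).
  have mf2 : measurable_fun setT (fun z : n.-tuple T => \sum_(j < n) X (tnth z j) ^+ 2).
    apply: measurable_sum => j; apply: measurable_funX.
    by apply: (measurableT_comp mX); exact: measurable_tnth.
  have f20 (z : n.-tuple T) : 0 <= \sum_(j < n) X (tnth z j) ^+ 2.
    by apply: sumr_ge0 => j _; exact: sqr_ge0.
  have a0 : 0 < 2 * r * n%:R * s ^+ 2.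
    by apply: mulr_gt0; [apply: mulr_gt0 => //; lra|exact: exprn_gt0].
  have := markov_gt mf2 f20 a0 i1.
  rewrite (_ : [set x | _] = ~` sqr_event (2 * r)); last first.
    apply/seteqP; split => z /=; rewrite /sqr_event /=; first by rewrite ltNge => /negP.
    by move=> /negP; rewrite -ltNge.
  move=> /le_trans; apply; rewrite lee_fin ler_pdivrMr//.
  rewrite (_ : 1 / (2 * r) * (2 * r * n%:R * s ^+ 2) = n%:R * s ^+ 2); last by field; rewrite gt_eqF.
  by rewrite ler_pM2l.
have -> : dev_event y = (dev_event y `&` sqr_event (2 * r)) `|` (dev_event y `&` ~` sqr_event (2 * r)).
  by rewrite -setIUr setUv setIT.
apply: le_trans (measureU2 _ _ _) _.
- exact: measurableI.
- by apply: measurableI => //; exact: measurableC.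
apply: (@le_trans _ _ ((4 * expR (- ln (8 * r)))%:E + (1 / (2 * r))%:E)%E).
  apply: leeD p1 _; apply: le_trans p2; apply: le_measure; rewrite ?inE.
  - by apply: measurableI => //; exact: measurableC.
  - exact: measurableC.
  - exact: subIsetr.
have r8 : 0 < 8 * r by lra.
rewrite -EFinD lee_fin expRN lnK ?posrE//.
rewrite [leRHS](_ : _ = r^-1); last by rewrite /r invf_div.
by rewrite le_eqVlt; apply/orP; left; apply/eqP; field; rewrite gt_eqF.
Qed.

End Tail.

(** * Means, primitives and square-integrability *)

Section MeanLaw.
Context {R : realType} {d d'} {T : measurableType d} {T' : measurableType d'}.
Context (P : probability T R) (Q : probability T' R) (X : nat -> {RV P >-> T'}).
Hypothesis X_iid : iid_with_law P X Q.

Lemma ge0_integral_law j (f : T' -> \bar R) : measurable_fun setT f ->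
  (forall z, 0 <= f z)%E -> (\int[P]_w f (X j w) = \int[Q]_z f z)%E.
Proof.
move=> mf f0; rewrite -[LHS]/(\int[P]_w (f \o X j) w)%E -ge0_integral_distribution//.
by apply: eq_measure_integral => A mA _; case: X_iid => _; apply.
Qed.

Lemma mean_law j (f : T' -> R) : Q.-integrable setT (EFin \o f) ->
  mean P (fun w => f (X j w)) = \int[Q]_z f z.
Proof.
move=> /integrableP[mf intf].
have mf' : measurable_fun setT f by exact/measurable_EFinP.
rewrite /mean /Rintegral unlock; apply: congr1.
rewrite -[LHS]/(\int[P]_w ((EFin \o f) \o X j) w)%E -integral_distribution//.
  by apply: eq_measure_integral => A mA _; case: X_iid => _; apply.
apply/integrableP; split; first exact: measurableT_comp.
have := @ge0_integral_law j (fun z => `|(f z)%:E|%E).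
by move=> -> //; apply: measurableT_comp.
Qed.

End MeanLaw.

(** * Increments of primitives under translation *)

Section Translation.
Context {R : realType}.
Local Notation mu := (@lebesgue_measure R).

Lemma measurable_shift (c : R) : measurable_fun [set: measurableTypeR R]
  (fun u : measurableTypeR R => c + u : measurableTypeR R).
Proof. exact: measurable_funD. Qed.

Lemma lebesgue_measure_shift (c : R) (A : set (measurableTypeR R)) : measurable A ->
  mu A = mu [set u | A (c + u)].
Proof.
move=> mA.
pose phi : {mfun measurableTypeR R >-> measurableTypeR R} :=
  HB.pack (fun u => c + u : measurableTypeR R) (isMeasurableFun.Build _ _ _ _ _ (measurable_shift c)).
pose nu : {measure set (measurableTypeR R) -> \bar R} :=
  [the measure _ _ of pushforward mu phi].
pose nu' := nu (measurable_shift c).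
suff h B : ocitv B -> mu B = nu' B by exact: (lebesgue_measure_unique h).
move=> [[x y] _ <-].
rewrite /= /pushforward /= (_ : _ @^-1` _ = `]x - c, y - c]%classic).
  rewrite !lebesgue_measure_itv /= !lte_fin ltrD2r; case: ifP => // _.
  by rewrite -!EFinB; congr EFin; ring.
by apply/seteqP; split => u /=; rewrite !in_itv /= ltrBlDl lerBrDl.
Qed.

Lemma integral_shift (c s t : R) (f : R -> R) : measurable_fun setT f ->
  (\int[mu]_(u in `[(c + s)%R, (c + t)%R]) (f u)%:E)%E \is a fin_num ->
  mu.-integrable `[s, t] (fun u => (f (c + u))%:E) /\
  (\int[mu]_(u in `[(c + s)%R, (c + t)%R]) (f u)%:E = \int[mu]_(u in `[s, t]) (f (c + u))%:E)%E.
Proof.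
move=> mf fin.
pose phi : {mfun measurableTypeR R >-> measurableTypeR R} :=
  HB.pack (fun u => c + u : measurableTypeR R) (isMeasurableFun.Build _ _ _ _ _ (measurable_shift c)).
have mfc : measurable_fun setT (fun u => f (c + u)).
  exact: (measurableT_comp mf (measurable_shift c)).
have pre : phi @^-1` `[c + s, c + t] = `[s, t]%classic.
  by apply/seteqP; split => u /=; rewrite !in_itv /= !lerD2l.
have transf (g : R -> \bar R) : measurable_fun setT g -> (forall u, 0 <= g u)%E ->
    (\int[mu]_(u in `[(c + s)%R, (c + t)%R]) g u = \int[mu]_(u in `[s, t]) g (c + u)%R)%E.
  move=> mg g0.
  transitivity (\int[pushforward mu phi]_(u in `[(c + s)%R, (c + t)%R]) g u)%E.
    by apply: eq_measure_integral => A mA _; exact: lebesgue_measure_shift.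
  rewrite ge0_integral_pushforward//; first by rewrite pre.
  exact: measurable_funTS.
(* A finite value of the integral means that its positive and negative parts are both finite. *)
have fin_abs : (\int[mu]_(u in `[(c + s)%R, (c + t)%R]) `|(f u)%:E| < +oo)%E.
  by rewrite integral_fin_num_abs//; exact: measurable_funTS.
have int : mu.-integrable `[s, t] (fun u => (f (c + u))%:E).
  apply/integrableP; split; first by apply/measurable_EFinP; exact: measurable_funTS.
  rewrite -(transf (fun u => `|(f u)%:E|%E))//.
  by apply: measurableT_comp => //; exact/measurable_EFinP.
split => //.
transitivity (\int[pushforward mu phi]_(u in `[(c + s)%R, (c + t)%R]) (f u)%:E)%E.
  by apply: eq_measure_integral => A mA _; exact: lebesgue_measure_shift.
rewrite integral_pushforward//; first by rewrite pre.
- exact/measurable_EFinP.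
- by rewrite pre.
Qed.

(** Translation moves both integrals to the same interval, where the integrands are compared
    pointwise. *)
Lemma primitive_diff_le (F1 F2 f1 f2 : R -> R) (c1 c2 s t K : R) :
  measurable_fun setT f1 -> measurable_fun setT f2 -> s < t ->
  (F1 (c1 + t) - F1 (c1 + s))%:E = (\int[mu]_(u in `[(c1 + s)%R, (c1 + t)%R]) (f1 u)%:E)%E ->
  (F2 (c2 + t) - F2 (c2 + s))%:E = (\int[mu]_(u in `[(c2 + s)%R, (c2 + t)%R]) (f2 u)%:E)%E ->
  (forall x, s <= x <= t -> `|f1 (c1 + x) - f2 (c2 + x)| <= K) ->
  `|(F1 (c1 + t) - F1 (c1 + s)) - (F2 (c2 + t) - F2 (c2 + s))| <= K * (t - s).
Proof.
move=> mf1 mf2 st E1 E2 fK.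
have fin1 : (\int[mu]_(u in `[(c1 + s)%R, (c1 + t)%R]) (f1 u)%:E)%E \is a fin_num by rewrite -E1.
have fin2 : (\int[mu]_(u in `[(c2 + s)%R, (c2 + t)%R]) (f2 u)%:E)%E \is a fin_num by rewrite -E2.
have [i1 e1] := integral_shift mf1 fin1.
have [i2 e2] := integral_shift mf2 fin2.
have D1 : F1 (c1 + t) - F1 (c1 + s) = \int[mu]_(u in `[s, t]) f1 (c1 + u).
  by rewrite /Rintegral -e1 -E1.
have D2 : F2 (c2 + t) - F2 (c2 + s) = \int[mu]_(u in `[s, t]) f2 (c2 + u).
  by rewrite /Rintegral -e2 -E2.
have mst : mu `[s, t]%classic = (t - s)%:E.
  by rewrite lebesgue_measure_itv /= lte_fin st EFinB.
have iB : mu.-integrable `[s, t] (EFin \o (fun u => f1 (c1 + u) - f2 (c2 + u))).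
  rewrite (_ : EFin \o _ = (fun u => (f1 (c1 + u))%:E) \- (fun u => (f2 (c2 + u))%:E))%E//.
  exact: integrableB.
rewrite D1 D2 -RintegralB//.
apply: (le_trans (le_normr_Rintegral _ iB)) => //.
apply: (@le_trans _ _ (\int[mu]_(u in `[s, t]) K)).
  apply: le_Rintegral => //.
  - exact: (integrable_abse iB).
  - apply/integrableP; split; first exact: measurable_cst.
    have h : (\int[mu]_(x in `[s, t]) (cst `|K|%:E) x < +oo)%E.
      by rewrite integral_cst//= mst -EFinM ltry.
    by apply: le_lt_trans h; rewrite le_eqVlt; apply/orP; left; apply/eqP; apply: eq_integral.
rewrite Rintegral_cst// le_eqVlt; apply/orP; left; apply/eqP.
by apply: congr1; exact: (congr1 fine mst).
Qed.

Lemma primitive_increment_diff_le (F1 F2 f1 f2 : R -> R) (c1 c2 x K delta1 : R) :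
  measurable_fun setT f1 -> measurable_fun setT f2 -> 0 <= K ->
  (forall t s, s < t -> (F1 t - F1 s)%:E = (\int[mu]_(u in `[s, t]) (f1 u)%:E)%E) ->
  (forall t s, s < t -> (F2 t - F2 s)%:E = (\int[mu]_(u in `[s, t]) (f2 u)%:E)%E) ->
  (forall x, - delta1 <= x <= delta1 -> `|f1 (c1 + x) - f2 (c2 + x)| <= K) ->
  `|x| <= delta1 ->
  `|(F1 (c1 + x) - F1 c1) - (F2 (c2 + x) - F2 c2)| <= K * `|x|.
Proof.
move=> mf1 mf2 K0 E1 E2 fK; rewrite ler_norml => /andP[x1 x2].
have [x0|x0|->] := ltgtP x 0.
- have := @primitive_diff_le F1 F2 f1 f2 c1 c2 x 0 K mf1 mf2 x0.
  rewrite !addr0 (ltr0_norm x0) sub0r => h.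
  rewrite (_ : F1 (c1 + x) - F1 c1 - (F2 (c2 + x) - F2 c2) =
    - ((F1 c1 - F1 (c1 + x)) - (F2 c2 - F2 (c2 + x)))); last by ring.
  rewrite normrN.
  apply: h.
  + by apply: E1; lra.
  + by apply: E2; lra.
  + by move=> y /andP[y1 y2]; apply: fK; apply/andP; split; lra.
- have := @primitive_diff_le F1 F2 f1 f2 c1 c2 0 x K mf1 mf2 x0.
  rewrite !addr0 (gtr0_norm x0) subr0; apply.
  + by apply: E1; lra.
  + by apply: E2; lra.
  + by move=> y /andP[y1 y2]; apply: fK; apply/andP; split; lra.
by rewrite !addr0 !subrr normr0 mulr0.
Qed.

End Translation.

Section L2Facts.
Context {R : realType} {d} {T : measurableType d} (Q : probability T R).

Lemma integral_sqr_L2norm (f : T -> R) :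
  (\int[Q]_z (f z ^+ 2)%:E = L2norm Q f `^ 2)%E.
Proof.
rewrite /L2norm powR_Lnorm//; apply: eq_integral => z _ /=.
by rewrite powR_mulrn// real_normK ?num_real.
Qed.

Lemma integral_sqr_le (f : T -> R) (c : R) : 0 <= c -> (L2norm Q f <= c%:E)%E ->
  (\int[Q]_z (f z ^+ 2)%:E <= (c ^+ 2)%:E)%E.
Proof.
move=> c0 fc; rewrite integral_sqr_L2norm -[c ^+ 2]powR_mulrn// -poweR_EFin.
apply: gt0_ler_poweR => //; rewrite in_itv /= ?leey ?andbT ?lee_fin//.
exact: Lnorm_ge0.
Qed.

Lemma Lfun2_integral_sqr (f : T -> R) : f \in Lfun Q 2%:E ->
  (\int[Q]_z (f z ^+ 2)%:E = (fine (L2norm Q f) ^+ 2)%:E)%E.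
Proof.
move=> fL; rewrite integral_sqr_L2norm.
have fin : L2norm Q f \is a fin_num.
  rewrite ge0_fin_numE; last exact: Lnorm_ge0.
  by move: fL; rewrite inE => /andP[_]; rewrite inE.
by rewrite -{1}(fineK fin) poweR_EFin powR_mulrn// fine_ge0// Lnorm_ge0.
Qed.

Lemma Rintegral_le_L2 (f : T -> R) (c : R) : measurable_fun setT f -> 0 < c ->
  (\int[Q]_z (f z ^+ 2)%:E <= (c ^+ 2)%:E)%E ->
  Q.-integrable setT (EFin \o f) /\ \int[Q]_z f z <= c.
Proof.
move=> mf c0 fc; have [fint _ _ _] := centered_moments mf fc; split => //.
have if2 : Q.-integrable setT (EFin \o (fun z => f z ^+ 2)).
  apply/integrableP; split; first by apply/measurable_EFinP; exact: measurable_funX.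
  apply: le_lt_trans (ltry (c ^+ 2)); apply: le_trans fc.
  rewrite le_eqVlt; apply/orP; left; apply/eqP; apply: eq_integral => z _ /=.
  by rewrite ger0_norm// sqr_ge0.
have ic : Q.-integrable setT (EFin \o (fun z : T => c / 2)).
  exact: finite_measure_integrable_cst.
have if2c : Q.-integrable setT (EFin \o (fun z => (2 * c)^-1 * f z ^+ 2)).
  rewrite (_ : EFin \o _ = (fun z => ((2 * c)^-1)%:E * (EFin \o (fun z => f z ^+ 2)%R) z))%E//.
  exact: integrableZl.
apply: (@le_trans _ _ (\int[Q]_z ((2 * c)^-1 * f z ^+ 2 + c / 2))).
  apply: le_Rintegral => //.
    rewrite (_ : EFin \o _ = (EFin \o (fun z => (2 * c)^-1 * f z ^+ 2)%R) \+ (EFin \o (fun=> c / 2)%R))%E//.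
    exact: integrableD.
  move=> z _; rewrite -subr_ge0.
  rewrite (_ : _ - _ = (2 * c)^-1 * (f z - c) ^+ 2); last by field; rewrite gt_eqF.
  by rewrite mulr_ge0 ?sqr_ge0// invr_ge0 mulr_ge0// ltW.
rewrite RintegralD//.
have -> : \int[Q]_z (c / 2) = c / 2.
  by rewrite /Rintegral integral_cst//= probability_setT mule1.
rewrite RintegralZl//.
have h : \int[Q]_z (f z ^+ 2) <= c ^+ 2.
  rewrite -lee_fin; apply: le_trans fc; rewrite /Rintegral fineK//.
  exact: integrable_fin_num.
have h2 : (2 * c)^-1 * \int[Q]_z f z ^+ 2 <= (2 * c)^-1 * c ^+ 2.
  by rewrite ler_wpM2l// invr_ge0 mulr_ge0// ltW.
apply: (le_trans (lerD h2 (lexx _))); rewrite le_eqVlt; apply/orP; left; apply/eqP; field.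
by rewrite gt_eqF.
Qed.

End L2Facts.

Section EnormRow.
Context {R : realType}.

Lemma enorm_row_mx_le m (v : 'rV[R]_m) (c : R) :
  enorm (row_mx v (const_mx c : 'rV[R]_1)) <= enorm v + `|c|.
Proof.
rewrite /enorm big_split_ord /= big_ord1 row_mxEr mxE.
have -> : \sum_(i < m) row_mx v (const_mx c : 'rV[R]_1) ord0 (lshift 1 i) ^+ 2 = \sum_(i < m) v ord0 i ^+ 2.
  by apply: eq_bigr => i _; rewrite row_mxEl.
rewrite -[X in _ <= _ + X]sqrtr_sqr; apply: sqrtrD_le; last exact: sqr_ge0.
by apply: sumr_ge0 => i _; exact: sqr_ge0.
Qed.

End EnormRow.

Lemma Mbar_gt0 {R : realType} (Mlo nL2 b : R) : 0 < Mlo -> 0 <= nL2 -> 0 <= b ->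
  0 < Mbar Mlo nL2 b.
Proof.
by move=> M0 n0 b0; rewrite ltr_wpDr ?mulr_ge0// mulr_gt0// ltr_wpDr.
Qed.

(** * The localized class of the model *)

Section RationalApprox.
Context {R : realType}.

Lemma rat_approx_unit (x e : R) : -1 <= x <= 1 -> 0 < e ->
  exists r : rat, -1 <= (ratr r : R) <= 1 /\ `|x - ratr r| < e.
Proof.
move=> /andP[x1 x2] e0.
have lt : Num.max (-1) (x - e) < Num.min 1 (x + e).
  by rewrite lt_min !gt_max; apply/andP; split; apply/andP; split; lra.
have [r] := rat_in_itvoo lt; rewrite in_itv /= gt_max lt_min => /andP[/andP[h1 h2] /andP[h3 h4]].
exists r; split; first by rewrite !ltW.
by rewrite ltr_norml; apply/andP; split; lra.
Qed.

End RationalApprox.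

Section ModelFacts.
Context {R : realType} {m k : nat} (Q : probability (borel R k) R).
Context (Theta : set 'rV[R]_m).
Context (G : 'rV[R]_m -> 'rV[R]_k -> R) (H : 'rV[R]_m -> R -> 'rV[R]_k -> R).
Context (xi L1 L2 : 'rV[R]_k -> R) (pb : 'rV[R]_m -> R).
Hypothesis G_int : forall theta, Theta theta -> Q.-integrable setT (EFin \o G theta).
Hypothesis xi_L2 : (xi : borel R k -> R) \in Lfun Q 2%:E.
Hypothesis xi_bound : forall theta z, Theta theta -> `|G theta z| <= xi z.
Hypothesis mH : forall theta t, Theta theta -> measurable_fun [set: borel R k] (H theta t).
Hypothesis H_int : forall theta, Theta theta -> Q.-integrable setT (EFin \o H theta (pb theta)).
Hypothesis L1_ge0 : forall z, 0 <= L1 z.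
Hypothesis L2_ge0 : forall z, 0 <= L2 z.
Hypothesis L1_L2 : (L1 : borel R k -> R) \in Lfun Q 2%:E.
Hypothesis L2_L2 : (L2 : borel R k -> R) \in Lfun Q 2%:E.
Hypothesis H_lip : forall theta theta' t s z, Theta theta -> Theta theta' ->
  `|H theta t z - H theta' s z| ^+ 2
     <= L1 z ^+ 2 * `|G theta z - G theta' z| ^+ 2 + L2 z ^+ 2 * `|t - s| ^+ 2.

Lemma Lfun2_integrable (f : borel R k -> R) : f \in Lfun Q 2%:E -> Q.-integrable setT (EFin \o f).
Proof.
move=> fL; apply/Lfun1_integrable; move: fL; apply: Lfun_subset12.
exact: fin_num_measure.
Qed.

Lemma H_dist theta theta' t s z : Theta theta -> Theta theta' ->
  `|H theta t z - H theta' s z| <= L1 z * `|G theta z - G theta' z| + L2 z * `|t - s|.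
Proof.
move=> th th'; have a0 : 0 <= L1 z * `|G theta z - G theta' z| by rewrite mulr_ge0.
have b0 : 0 <= L2 z * `|t - s| by rewrite mulr_ge0.
rewrite -ler_sqr ?nnegrE ?addr_ge0//; apply: le_trans (H_lip _ _ _ th th') _.
by rewrite -!exprMn sqrrD; have := mulr_ge0 a0 b0; lra.
Qed.

(** Integrability at the single second argument [pb theta] spreads to all others by the Lipschitz
    condition, as L_2 is integrable. *)
Lemma H_integrable t theta : Theta theta -> Q.-integrable setT (EFin \o H theta t).
Proof.
move=> th.
apply: (@le_integrable _ _ _ _ _ measurableT _
  (fun z : borel R k => (`|H theta (pb theta) z|%:E + `|t - pb theta|%:E * (L2 z)%:E)%E)).
- by apply/measurable_EFinP; exact: mH.
- move=> z _ /=.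
  have := @H_dist theta theta t (pb theta) z th th; rewrite subrr normr0 mulr0 add0r => h.
  rewrite lee_fin [leRHS]ger0_norm ?addr_ge0 ?mulr_ge0//.
  have := ler_normD (H theta t z - H theta (pb theta) z) (H theta (pb theta) z).
  by rewrite subrK; lra.
apply: integrableD => //; first exact: (integrable_abse (H_int th)).
by apply: integrableZl => //; exact: Lfun2_integrable.
Qed.

Lemma L1_xi_integrable : Q.-integrable setT (EFin \o (fun z => L1 z * xi z)).
Proof. by apply/Lfun1_integrable; exact: Lfun2_mul_Lfun1. Qed.

Lemma G_dist_le theta theta' z : Theta theta -> Theta theta' ->
  `|G theta z - G theta' z| <= 2 * xi z.
Proof.
move=> th th'; apply: le_trans (ler_normB _ _) _.
by have := xi_bound z th; have := xi_bound z th'; lra.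
Qed.

Lemma measurable_G theta : Theta theta -> measurable_fun [set: borel R k] (G theta).
Proof. by move=> /G_int /integrableP[/measurable_EFinP]. Qed.

Let mdG theta theta' : Theta theta -> Theta theta' ->
  measurable_fun [set: borel R k] (fun z => `|G theta z - G theta' z|).
Proof. by move=> th th'; apply: measurableT_comp => //; apply: measurable_funB; exact: measurable_G. Qed.

Let mL1 : measurable_fun [set: borel R k] L1.
Proof. by have /integrableP[/measurable_EFinP] := Lfun2_integrable L1_L2. Qed.

Lemma G_dist_integrable theta theta' : Theta theta -> Theta theta' ->
  Q.-integrable setT (EFin \o (fun z => `|G theta z - G theta' z|)).
Proof.
move=> th th'; apply: (@le_integrable _ _ _ _ _ measurableT _ (fun z : borel R k => 2%:E * (xi z)%:E)%E).
- by apply/measurable_EFinP; exact: mdG.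
- move=> z _ /=; rewrite normr_id lee_fin (le_trans (G_dist_le z th th'))//.
  exact: ler_norm.
- by apply: integrableZl => //; exact: Lfun2_integrable.
Qed.

Lemma L1_G_dist_integrable theta theta' : Theta theta -> Theta theta' ->
  Q.-integrable setT (EFin \o (fun z => L1 z * `|G theta z - G theta' z|)).
Proof.
move=> th th'; apply: (@le_integrable _ _ _ _ _ measurableT _ (fun z : borel R k => 2%:E * (L1 z * xi z)%:E)%E).
- by apply/measurable_EFinP; apply: measurable_funM => //; exact: mdG.
- move=> z _ /=; rewrite lee_fin ger0_norm ?mulr_ge0//.
  apply: le_trans (ler_norm _); rewrite mulrCA ler_wpM2l//; exact: G_dist_le.
- by apply: integrableZl => //; exact: L1_xi_integrable.
Qed.

Lemma H_mean_dist theta theta' t s : Theta theta -> Theta theta' ->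
  `|\int[Q]_z H theta t z - \int[Q]_z H theta' s z| <=
  \int[Q]_z (L1 z * `|G theta z - G theta' z|) + \int[Q]_z L2 z * `|t - s|.
Proof.
move=> th th'; have i1 := H_integrable t th; have i2 := H_integrable s th'.
have iB : Q.-integrable setT (EFin \o (fun z => H theta t z - H theta' s z)).
  rewrite (_ : EFin \o _ = (EFin \o H theta t) \- (EFin \o H theta' s))%E//.
  exact: integrableB.
rewrite -RintegralB//.
apply: (le_trans (le_normr_Rintegral _ iB)) => //.
have iL2 : Q.-integrable setT (EFin \o L2) by exact: Lfun2_integrable.
have iL2t : Q.-integrable setT (EFin \o (fun z => L2 z * `|t - s|)).
  rewrite (_ : EFin \o _ = (fun z => (EFin \o L2) z * `|(t - s)%R|%:E))%E//.
  exact: integrableZr.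
have iL1g := L1_G_dist_integrable th th'.
rewrite -RintegralZr// -RintegralD//.
apply: le_Rintegral => //.
- exact: (integrable_abse iB).
- rewrite (_ : EFin \o _ = (EFin \o (fun z => L1 z * `|G theta z - G theta' z|)%R) \+ (EFin \o (fun z => L2 z * `|t - s|)%R))%E//.
  exact: integrableD.
- by move=> z _; exact: H_dist.
Qed.

(* [L1] is not bounded: split according to [L1 <= c], where the increment is at
   most [c |G - G'|], and [L1 > c], where it is at most [2 L1 xi], whose integral
   over [L1 > c] tends to 0. *)
Lemma L1_G_dist_small (e : R) : 0 < e -> exists2 c, 0 <= c &
  forall theta theta', Theta theta -> Theta theta' ->
  \int[Q]_z (L1 z * `|G theta z - G theta' z|) <=
  c * \int[Q]_z `|G theta z - G theta' z| + e.
Proof.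
move=> e0.
pose f (N : nat) (z : borel R k) : \bar R := (2 * (L1 z * xi z) * \1_[set z | N%:R < L1 z] z)%:E.
have xi0 z theta : Theta theta -> 0 <= xi z.
  by move=> th; exact: le_trans (normr_ge0 _) (xi_bound z th).
have [[th0 Th0]|noTheta] := pselect (exists theta, Theta theta); last first.
  by exists 0 => // theta theta' th; exfalso; apply: noTheta; exists theta.
have mset N : measurable ([set z : borel R k | N%:R < L1 z] : set (borel R k)).
  rewrite -[X in measurable X]setTI; exact: (measurable_fun_ltr (measurable_cst _) mL1).
have i2 : Q.-integrable setT (fun z => (2 * (L1 z * xi z))%:E).
  rewrite (_ : (fun z => _) = (fun z => 2%:E * (EFin \o (fun z => L1 z * xi z)%R) z))%E//.
  by apply: integrableZl => //; exact: L1_xi_integrable.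
have mf N : measurable_fun setT (f N).
  apply/measurable_EFinP; apply: measurable_funM => //.
  by have /integrableP[/measurable_EFinP] := i2.
have f0 N z : (0 <= f N z)%E.
  by rewrite lee_fin mulr_ge0// mulr_ge0// mulr_ge0//; exact: xi0 Th0.
have fle N z : (`|f N z| <= (2 * (L1 z * xi z))%:E)%E.
  rewrite gee0_abs// lee_fin -[leRHS]mulr1 ler_wpM2l//.
    by rewrite mulr_ge0// mulr_ge0//; exact: xi0 Th0.
(* Dominated convergence: at each z the integrand is 0 as soon as N >= L_1(z). *)
have cvgf : (\int[Q]_z f N z @[N --> \oo] --> \int[Q]_z (cst 0 z))%E.
  apply: (@dominated_cvg _ _ _ _ setT measurableT f (cst 0%E) (fun z => (2 * (L1 z * xi z))%:E)) => //.
  move=> z _; apply: cvg_near_cst; exists (Num.truncn (L1 z)).+1 => // N /= hN.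
  rewrite /f indicE memNset ?mulr0//= => /ltW.
  apply/negP; rewrite -ltNge; apply: (lt_le_trans (truncnS_gt _)).
  by rewrite ler_nat.
move: cvgf; rewrite integral0 => cvgf.
have /fine_cvgP[_ /cvgr_lt/(_ e e0) [N _ /(_ N (leqnn N)) /= hN]] := cvgf.
pose g (z : borel R k) := 2 * (L1 z * xi z) * \1_[set z | N%:R < L1 z] z.
have ig : Q.-integrable setT (EFin \o g).
  by apply: (le_integrable measurableT (mf N) _ i2) => z _; apply: (le_trans (fle N z)); exact: lee_abs.
exists N%:R => // theta theta' th th'.
have iG := G_dist_integrable th th'; have iLG := L1_G_dist_integrable th th'.
have iNG : Q.-integrable setT (EFin \o (fun z : borel R k => N%:R * `|G theta z - G theta' z|)).
  rewrite (_ : EFin \o _ = (fun z => N%:R%:E * (EFin \o (fun z => `|G theta z - G theta' z|)%R) z))%E//.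
  exact: integrableZl.
apply: (@le_trans _ _ (\int[Q]_z (N%:R * `|G theta z - G theta' z| + g z))).
  apply: le_Rintegral => //.
    rewrite (_ : EFin \o _ = (EFin \o (fun z => N%:R * `|G theta z - G theta' z|)%R) \+ (EFin \o g))%E//.
    exact: integrableD.
  move=> z _; rewrite /g indicE; have xiz := xi0 z _ th.
  have [hz|hz] := ltP N%:R (L1 z).
    rewrite mem_set//= mulr1; apply: (@le_trans _ _ (L1 z * (2 * xi z))).
      by rewrite ler_wpM2l//; exact: G_dist_le.
    by rewrite mulrCA lerDr mulr_ge0.
  rewrite memNset /=; last by rewrite ltNge hz.
  by rewrite mulr0 addr0 ler_wpM2r.
rewrite RintegralD// RintegralZl// lerD2l; exact: ltW.
Qed.

(** * Reduction to a countable index set *)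

Section Separability.
Context (U C : set 'rV[R]_m) (ts : 'rV[R]_m) (psi a' D : R) (n : nat).
Hypothesis U_Theta : U `<=` Theta.
Hypothesis CU : C `<=` U.
Hypothesis Tts : Theta ts.

Let lf := local_fun H ts psi a' D.

Definition rational_index : set ('rV[R]_m * R * R) :=
  [set p | [/\ C p.1.1, (exists2 r : rat, -1 <= (ratr r : R) <= 1 & p.1.2 = ratr r) &
               (exists2 r : rat, -1 <= (ratr r : R) <= 1 & p.2 = ratr r)]].

Lemma countable_rational_index : countable C -> countable rational_index.
Proof.
move=> Cc.
apply: (@sub_countable _ _ _ ((fun p : 'rV[R]_m * rat * rat => (p.1.1, ratr p.1.2 : R, ratr p.2 : R)) @` ((C `*` setT) `*` setT))).
  apply: subset_card_le => -[[x y] z] [/= Cx [r _ ->] [r' _ ->]].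
  by exists (x, r, r').
apply: card_le_trans (card_image_le _ _) _.
by apply: countableX => //; apply: countableX.
Qed.

Lemma rational_index_local : rational_index `<=` local_index U.
Proof. by move=> p [Cp [r r1 e1] [r' r1' e2]]; split; rewrite ?e1 ?e2//; exact: CU. Qed.

Lemma local_fun_measurable p : local_index U p -> measurable_fun [set: borel R k] (lf p).
Proof. by move=> [Up _ _]; apply: measurable_funB; apply: mH => //; exact: U_Theta. Qed.

Lemma local_fun_mean p : local_index U p ->
  \int[Q]_z lf p z = \int[Q]_z H p.1.1 (psi + a' * p.1.2 + D * p.2) z - \int[Q]_z H ts (psi + a' * p.1.2) z.
Proof.
by move=> [/U_Theta Up _ _]; rewrite -RintegralB//; exact: H_integrable.
Qed.

(** q moves the second argument of both occurrences of [H], r only that of the first; hence the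
    factor 2 on the q part. *)
Lemma local_fun_increment p p' z : local_index U p -> local_index U p' ->
  `|lf p z - lf p' z| <= L1 z * `|G p.1.1 z - G p'.1.1 z|
    + L2 z * (2 * (`|a'| * `|p.1.2 - p'.1.2|) + `|D| * `|p.2 - p'.2|) /\
  `|\int[Q]_z lf p z - \int[Q]_z lf p' z| <=
    \int[Q]_z (L1 z * `|G p.1.1 z - G p'.1.1 z|)
    + \int[Q]_z L2 z * (2 * (`|a'| * `|p.1.2 - p'.1.2|) + `|D| * `|p.2 - p'.2|).
Proof.
move=> pI p'I; have [/U_Theta Up _ _] := pI; have [/U_Theta Up' _ _] := p'I.
have d1 : `|(psi + a' * p.1.2) - (psi + a' * p'.1.2)| = `|a'| * `|p.1.2 - p'.1.2|.
  by rewrite -normrM; congr `| _ |; ring.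
have d2 : `|(psi + a' * p.1.2 + D * p.2) - (psi + a' * p'.1.2 + D * p'.2)| <=
    `|a'| * `|p.1.2 - p'.1.2| + `|D| * `|p.2 - p'.2|.
  rewrite -!normrM; apply: le_trans (ler_normD _ _); rewrite le_eqVlt; apply/orP; left; apply/eqP.
  by congr `| _ |; ring.
have EL2 : 0 <= \int[Q]_z L2 z by apply: Rintegral_ge0.
split.
  rewrite /lf /local_fun.
  set A := H p.1.1 _ z; set A' := H p'.1.1 _ z; set B := H ts _ z; set B' := H ts _ z.
  rewrite (_ : A - B - (A' - B') = (A - A') - (B - B')); last by ring.
  apply: le_trans (ler_normB _ _) _.
  have h1 := H_dist (psi + a' * p.1.2 + D * p.2) (psi + a' * p'.1.2 + D * p'.2) z Up Up'.
  have h2 := H_dist (psi + a' * p.1.2) (psi + a' * p'.1.2) z Tts Tts.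
  move: h2; rewrite subrr normr0 mulr0 add0r d1 -/B -/B' => h2.
  have h3 := ler_wpM2l (L2_ge0 z) d2.
  by move: h1 h2 h3; rewrite -/A -/A' !mulrDr; lra.
rewrite !local_fun_mean//.
set A := Rintegral _ _ _; set B := Rintegral _ _ _; set A' := Rintegral _ _ _; set B' := Rintegral _ _ _.
rewrite (_ : A - B - (A' - B') = (A - A') - (B - B')); last by ring.
apply: le_trans (ler_normB _ _) _.
have h1 := H_mean_dist (psi + a' * p.1.2 + D * p.2) (psi + a' * p'.1.2 + D * p'.2) Up Up'.
have h2 := H_mean_dist (psi + a' * p.1.2) (psi + a' * p'.1.2) Tts Tts.
have h0 : \int[Q]_z (L1 z * `|G ts z - G ts z|) = 0.
  rewrite (@eq_Rintegral _ _ _ _ _ (cst 0)); first by rewrite Rintegral_cst// mul0r.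
  by move=> z' _; rewrite subrr normr0 mulr0.
move: h2; rewrite h0 add0r d1 -/B -/B' => h2.
have h3 := ler_wpM2l EL2 d2.
by move: h1 h2 h3; rewrite -/A -/A' !mulrDr; lra.
Qed.

(** The expectations have to be approximated along with the values on the sample, which is what
    [L1_G_dist_small] is for. Its constant c is fixed by gamma and n before rho is chosen, so rho
    may depend on c. The errors are at most gamma / 4 for [G], gamma / 4 for q and r, and gamma / 8
    for the truncation of L_1. *)
Lemma dev_approx (z : n.-tuple 'rV[R]_k) p (gamma : R) : local_index U p -> 0 < gamma ->
  (forall rho : R, 0 < rho -> exists2 theta, C theta &
     \int[Q]_z `|G p.1.1 z - G theta z| < rho /\
     forall j, `|G p.1.1 (tnth z j) - G theta (tnth z j)| < rho) ->
  exists2 p', rational_index p' &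
    `|\sum_(j < n) (lf p (tnth z j) - \int[Q]_z lf p z)
      - \sum_(j < n) (lf p' (tnth z j) - \int[Q]_z lf p' z)| < gamma.
Proof.
move=> pI g0 dense; have [Up p1 p2] := pI.
have nR : 0 <= n%:R :> R by [].
have e10 : 0 < gamma / (8 * (n%:R + 1)) by apply: divr_gt0 => //; lra.
have [c c0 hc] := L1_G_dist_small e10.
set e1 := gamma / _ in e10 hc.
pose S1 := \sum_(j < n) L1 (tnth z j); pose S2 := \sum_(j < n) L2 (tnth z j).
have S10 : 0 <= S1 by apply: sumr_ge0.
have S20 : 0 <= S2 by apply: sumr_ge0.
pose E2 := \int[Q]_z L2 z.
have E20 : 0 <= E2 by apply: Rintegral_ge0.
pose W := S1 + n%:R * c; pose La := S2 + n%:R * E2; pose K0 := 2 * `|a'| + `|D|.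
have W0 : 0 <= W by rewrite addr_ge0// mulr_ge0.
have La0 : 0 <= La by rewrite addr_ge0// mulr_ge0.
have K00 : 0 <= K0 by rewrite addr_ge0// mulr_ge0.
pose rho := gamma / (4 * (W + 1)); pose ka := gamma / (4 * (La * K0 + 1)).
have LK0 : 0 <= La * K0 by rewrite mulr_ge0.
have rho0 : 0 < rho by apply: divr_gt0 => //; lra.
have ka0 : 0 < ka by apply: divr_gt0 => //; lra.
have [th Cth [Eth Zth]] := dense rho rho0.
have [r1 [r1in r1p]] := rat_approx_unit p1 ka0.
have [r2 [r2in r2p]] := rat_approx_unit p2 ka0.
pose p' := (th, ratr r1 : R, ratr r2 : R).
have p'S : rational_index p' by split => //; [exists r1|exists r2].
have p'I := rational_index_local p'S.
exists p' => //.
pose B := 2 * (`|a'| * `|p.1.2 - p'.1.2|) + `|D| * `|p.2 - p'.2|.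
have BK : B <= K0 * ka.
  have h1 : `|a'| * `|p.1.2 - p'.1.2| <= `|a'| * ka by rewrite ler_wpM2l// ltW.
  have h2 : `|D| * `|p.2 - p'.2| <= `|D| * ka by rewrite ler_wpM2l// ltW.
  by move: h1 h2; rewrite /B /K0; lra.
have incr y := local_fun_increment y pI p'I.
have hE : \int[Q]_z (L1 z * `|G p.1.1 z - G th z|) <= c * rho + e1.
  apply: le_trans (hc _ _ (U_Theta Up) (U_Theta (CU Cth))) _.
  by rewrite lerD2r ler_wpM2l// ltW.
rewrite -sumrB.
apply: (@le_lt_trans _ _ (\sum_(j < n) (L1 (tnth z j) * rho + L2 (tnth z j) * (K0 * ka)
    + (c * rho + e1 + E2 * (K0 * ka))))).
  apply: (le_trans (ler_norm_sum _ _ _)); apply: ler_sum => j _.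
  rewrite (_ : _ - _ = (lf p (tnth z j) - lf p' (tnth z j)) - (\int[Q]_z lf p z - \int[Q]_z lf p' z)); last by ring.
  apply: le_trans (ler_normB _ _) _; have [i1 i2] := incr (tnth z j).
  apply: lerD.
    apply: (le_trans i1); apply: lerD; first by rewrite ler_wpM2l// ltW//; exact: Zth.
    by rewrite ler_wpM2l.
  apply: (le_trans i2); apply: lerD => //.
  by rewrite ler_wpM2l.
rewrite big_split /= big_split /= -!mulr_suml -/S1 -/S2 sumr_const card_ord -[X in _ + X < _]mulr_natl.
have h1 : W * rho <= gamma / 4.
  rewrite /rho mulrA ler_pdivrMr; last by lra.
  by have := mulr_ge0 W0 (ltW g0); lra.
have h2 : La * K0 * ka <= gamma / 4.
  rewrite /ka mulrA ler_pdivrMr; last by lra.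
  by have := mulr_ge0 LK0 (ltW g0); lra.
have h3 : n%:R * e1 <= gamma / 8.
  rewrite /e1 mulrA ler_pdivrMr; last by lra.
  by have := mulr_ge0 nR (ltW g0); lra.
move: h1 h2; rewrite /W /La; lra.
Qed.

End Separability.
End ModelFacts.

(** * From the compound process to the localized class *)

Section Assembly.
Context {R : realType} {m k : nat} {disp : measure_display} {Omega : measurableType disp}.
Context (P : probability Omega R) (PZ : probability (borel R k) R) (Z : nat -> {RV P >-> borel R k}).
Hypothesis Z_iid : iid_with_law P Z PZ.
Context (Theta : set 'rV[R]_m).
Context (G : 'rV[R]_m -> 'rV[R]_k -> R) (H : 'rV[R]_m -> R -> 'rV[R]_k -> R).
Hypothesis G_integrable : forall theta, Theta theta -> PZ.-integrable setT (EFin \o G theta).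
Context (xi : 'rV[R]_k -> R).
Hypothesis xi_L2 : (xi : borel R k -> R) \in Lfun PZ 2%:E.
Hypothesis xi_bound : forall theta z, Theta theta -> `|G theta z| <= xi z.
Hypothesis H_measurable : forall theta t, Theta theta ->
  measurable_fun [set: borel R k] (H theta t).
Hypothesis H_integrable0 : forall theta, Theta theta ->
  PZ.-integrable setT (EFin \o H theta (psibar Z G theta)).
Context (L1 L2 : 'rV[R]_k -> R).
Hypothesis L1_ge0 : forall z, 0 <= L1 z.
Hypothesis L2_ge0 : forall z, 0 <= L2 z.
Hypothesis L1_L2 : (L1 : borel R k -> R) \in Lfun PZ 2%:E.
Hypothesis L2_L2 : (L2 : borel R k -> R) \in Lfun PZ 2%:E.
Hypothesis H_lipschitz : forall theta theta' t s z, Theta theta -> Theta theta' ->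
  `|H theta t z - H theta' s z| ^+ 2
  <= L1 z ^+ 2 * `|G theta z - G theta' z| ^+ 2 + L2 z ^+ 2 * `|t - s| ^+ 2.
Context (thetas : 'rV[R]_m) (thetas_in : Theta thetas).
Context (beta Mlo Mup : R) (beta_gt0 : 0 < beta) (beta_le1 : beta <= 1).
Hypothesis Mlo_gt0 : 0 < Mlo.
Hypothesis Mup_gt0 : 0 < Mup.
Context (xid : 'rV[R]_k -> R) (delta : R).
Hypothesis delta_gt0 : 0 < delta.
Hypothesis delta_le : delta <= diam Theta.
Hypothesis xid_envelope : pos_envelope (centered_class G Theta thetas delta) xid.
Hypothesis xid_norm : (L2norm PZ (fun z => Num.max (L1 z) 1 * xid z)%R <= (Mlo * delta `^ beta)%:E)%E.
Hypothesis entropy_bound : (entropy_integral (centered_class G Theta thetas delta) xid (1 / 8)%R <= Mup%:E)%E.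
Context (delta1 K : R) (mH : 'rV[R]_m -> R -> R).
Hypothesis K_ge0 : 0 <= K.
Hypothesis mH_measurable : forall theta, Theta theta -> measurable_fun setT (mH theta).
Hypothesis mH_lipschitz : forall theta (x : R), Theta theta -> - delta1 <= x <= delta1 ->
  `|mH theta (psibar Z G theta + x) - mH thetas (psibar Z G thetas + x)|
  <= K * enorm (row_mx (theta - thetas)
                  (const_mx (psibar Z G theta - psibar Z G thetas) : 'rV[R]_1)).
Hypothesis mH_primitive : forall theta (t s : R), Theta theta -> s < t ->
  (mean P (fun w => H theta t (Z 0%N w)) - mean P (fun w => H theta s (Z 0%N w)))%:E
  = (\int[lebesgue_measure]_(u in `[s, t]) (mH theta u)%:E)%E.
Context (a b : R) (n : nat).
Hypothesis a_gt0 : 0 < a.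
Hypothesis b_gt0 : 0 < b.
Hypothesis n_gt0 : (0 < n)%N.

Let EL2 := \int[PZ]_z L2 z.
Let l2 : R := if 0 < EL2 then 1 else 0.
Let Mb := Mbar Mlo (fine (L2norm PZ L2)) b.
Let Mab := M_ab K (diam Theta) beta Mlo EL2 a b.

Hypothesis n_large : l2 * a ^+ 2 / delta1 ^+ 2 <= n%:R.
Hypothesis delta1_gt0 : 0 < delta1.

Let U := nbhd Theta thetas delta.
Let D := (b + Mlo) * delta `^ beta.
Let a' := a / Num.sqrt n%:R.
(** Compares the range a' of q with the scale b delta^beta of the local increments; ln A is the
    positive part in [etabar]. *)
Let A := Num.max 1 (a / b / (Num.sqrt n%:R * delta `^ beta)).
Let X := xi_ab L1 L2 xid Mlo beta b delta.
Let s := Mb * delta `^ beta.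
Let pb := psibar Z G.

Let n_gt0R : 0 < n%:R :> R. Proof. by rewrite ltr0n. Qed.
Let sqn_gt0 : 0 < Num.sqrt n%:R :> R. Proof. by rewrite sqrtr_gt0. Qed.
Let sqn_ge1 : 1 <= Num.sqrt n%:R :> R.
Proof. by rewrite -[leLHS]sqrtr1 ler_sqrt// ler1n. Qed.
Let db_gt0 : 0 < delta `^ beta. Proof. exact: powR_gt0. Qed.
Let nL2_ge0 : 0 <= fine (L2norm PZ L2). Proof. by rewrite fine_ge0// Lnorm_ge0. Qed.

Let Mb_gt0 : 0 < Mb. Proof. by apply: Mbar_gt0 => //; exact: ltW. Qed.
Let s_gt0 : 0 < s. Proof. by rewrite mulr_gt0. Qed.
Let D_gt0 : 0 < D. Proof. by rewrite mulr_gt0// addr_gt0. Qed.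

Let XE z : X z ^+ 2 = Num.max (L1 z) 1 ^+ 2 * xid z ^+ 2 + L2 z ^+ 2 * D ^+ 2.
Proof.
rewrite /X /xi_ab sqr_sqrtr; last first.
  apply: addr_ge0; first by apply: mulr_ge0; exact: sqr_ge0.
  by apply: mulr_ge0; [apply: mulr_ge0; exact: sqr_ge0|exact: powR_ge0].
by rewrite /D [2 * beta]mulrC powRrM powR_mulrn ?powR_ge0//; ring.
Qed.

Let mL1 : measurable_fun [set: borel R k] L1.
Proof. by have /integrableP[/measurable_EFinP] := Lfun2_integrable L1_L2. Qed.

Let mL2 : measurable_fun [set: borel R k] L2.
Proof. by have /integrableP[/measurable_EFinP] := Lfun2_integrable L2_L2. Qed.

Let mxid : measurable_fun [set: borel R k] xid.
Proof. by case: xid_envelope. Qed.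

Let mLxid : measurable_fun [set: borel R k] (fun z => Num.max (L1 z) 1 * xid z).
Proof. by apply: measurable_funM => //; apply: measurable_maxr => //. Qed.

Lemma measurable_xi_ab : measurable_fun [set: borel R k] X.
Proof.
apply: (measurableT_comp (continuous_measurable_fun (@sqrt_continuous R))).
apply: measurable_funD; apply: measurable_funM => //.
- by apply: measurable_funX; apply: measurable_maxr.
- by apply: measurable_funX.
- by apply: measurable_funM => //; apply: measurable_funX.
Qed.

Let Lxid_sqr : (\int[PZ]_z ((Num.max (L1 z) 1 * xid z) ^+ 2)%:E <= ((Mlo * delta `^ beta) ^+ 2)%:E)%E.
Proof.
apply: (integral_sqr_le (T := borel R k) (f := fun z => Num.max (L1 z) 1 * xid z)) => //.
by rewrite mulr_ge0// ?powR_ge0// ltW.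
Qed.

(** With nL the norm of L_2, the two parts contribute Mlo^2 and ((b + Mlo) nL)^2, in units of
    delta^(2 beta); their sum is at most the square of Mlo + (b + Mlo) nL, which is [Mb]. *)
Lemma xi_ab_sqr_le : (\int[PZ]_z (X z ^+ 2)%:E <= (s ^+ 2)%:E)%E.
Proof.
rewrite (eq_integral (fun z : borel R k => ((Num.max (L1 z) 1 * xid z) ^+ 2)%:E + (D ^+ 2)%:E * (L2 z ^+ 2)%:E)%E); last first.
  by move=> z _; rewrite XE -EFinM -EFinD; congr EFin; ring.
have m1 : measurable_fun [set: borel R k] (fun z => ((Num.max (L1 z) 1 * xid z) ^+ 2)%:E).
  by apply/measurable_EFinP; apply: measurable_funX.
have m2 : measurable_fun [set: borel R k] (fun z => (L2 z ^+ 2)%:E).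
  by apply/measurable_EFinP; apply: measurable_funX.
rewrite ge0_integralD//; last 3 first.
- by move=> z _; rewrite lee_fin sqr_ge0.
- by move=> z _; rewrite mule_ge0// lee_fin sqr_ge0.
- exact: emeasurable_funM.
rewrite ge0_integralZl_EFin ?sqr_ge0//; last by move=> z _; rewrite lee_fin sqr_ge0.
rewrite (Lfun2_integral_sqr L2_L2).
apply: le_trans (leeD2r _ Lxid_sqr) _; rewrite -EFinM -EFinD lee_fin.
have := nL2_ge0; set nL := fine _ => nL0.
rewrite /s /Mb /Mbar /D -/nL.
have h0 : 0 <= (delta `^ beta) ^+ 2 by rewrite sqr_ge0.
have h1 : 0 <= Mlo * ((b + Mlo) * nL) by rewrite !mulr_ge0 ?addr_ge0// ltW.
have := mulr_ge0 h0 h1; nra.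
Qed.

Lemma event_square_sub w : event_square Z n X w ->
  \sum_(j < n) X (Z j w) ^+ 2 <= 2 * n%:R * s ^+ 2.
Proof.
rewrite /event_square /= => h.
have iX : PZ.-integrable setT (EFin \o (fun z : borel R k => X z ^+ 2)).
  apply/integrableP; split; first by apply/measurable_EFinP; apply: measurable_funX; exact: measurable_xi_ab.
  apply: le_lt_trans (ltry (s ^+ 2)); apply: le_trans xi_ab_sqr_le.
  rewrite le_eqVlt; apply/orP; left; apply/eqP; apply: eq_integral => z _ /=.
  by rewrite ger0_norm// sqr_ge0.
have := mean_law Z_iid 0 iX => /= e; rewrite e in h.
have h1 : \int[PZ]_z (X z ^+ 2) <= s ^+ 2.
  rewrite -lee_fin; apply: le_trans xi_ab_sqr_le; rewrite /Rintegral fineK//.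
  exact: (integrable_fin_num _ iX).
move: h; rewrite ler_pdivrMl// => h; apply: (le_trans h).
rewrite [leRHS](_ : _ = n%:R * (2 * s ^+ 2)); last by ring.
by rewrite ler_pM2l// ler_pM2l.
Qed.

Let U_Theta : U `<=` Theta. Proof. by move=> t []. Qed.

Let U_ts : U thetas.
Proof.
split => //; rewrite /enorm subrr big1 ?sqrtr0 ?ltW// => i _.
by rewrite mxE expr0n.
Qed.

Let xid_bound theta z : U theta -> `|G theta z - G thetas z| <= xid z.
Proof. by move=> Ut; case: xid_envelope => _ _ /(_ (fun z => G theta z - G thetas z) z); apply; exists theta. Qed.

Lemma psibarE theta : Theta theta -> pb theta = \int[PZ]_z G theta z.
Proof. by move=> /G_integrable; exact: mean_law. Qed.

Let Hi theta t : Theta theta -> PZ.-integrable setT (EFin \o H theta t).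
Proof.
by apply: (H_integrable H_measurable H_integrable0 L1_ge0 L2_ge0 L2_L2 H_lipschitz).
Qed.

Lemma meanHE theta t : Theta theta ->
  mean P (fun w => H theta t (Z 0%N w)) = \int[PZ]_z H theta t z.
Proof. by move=> Tt; apply: (mean_law Z_iid 0 (Hi t Tt)). Qed.

(** The mean increment is at most the mean of [xid], which the factor L_1 v 1 only increases, and a
    mean is at most an L^2 norm. *)
Lemma psibar_dist theta : U theta -> `|pb theta - pb thetas| <= Mlo * delta `^ beta.
Proof.
move=> Ut; have Tt := U_Theta Ut.
rewrite !psibarE// -RintegralB//; try exact: G_integrable.
have iB : PZ.-integrable setT (EFin \o (fun z => G theta z - G thetas z)).
  rewrite (_ : EFin \o _ = (EFin \o G theta) \- (EFin \o G thetas))%E//.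
  by apply: integrableB => //; exact: G_integrable.
apply: (le_trans (le_normr_Rintegral _ iB)) => //.
have c0 : 0 < Mlo * delta `^ beta by rewrite mulr_gt0.
have [iL leL] := Rintegral_le_L2 mLxid c0 Lxid_sqr.
apply: le_trans leL; apply: le_Rintegral => //; first exact: (integrable_abse iB).
move=> z _; apply: (le_trans (xid_bound z Ut)).
have xid0 : 0 <= xid z by exact: le_trans (normr_ge0 _) (xid_bound z Ut).
by rewrite ler_peMl// le_max lexx orbT.
Qed.

(** Split at the common shift x. Passing from theta to thetas with x fixed costs at most [ka] |x|,
    by the condition on [mH]; passing from x to x' at thetas costs E[L_2] |x - x'|. Multiplied by
    sqrt(n), these give the two summands of [Mab]. *)
Lemma drift_le theta x x' : U theta -> `|x| <= a' -> `|x - x'| <= b * delta `^ beta / Num.sqrt n%:R ->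
  Num.sqrt n%:R * `|(\int[PZ]_z H theta (pb theta + x) z - \int[PZ]_z H theta (pb theta) z)
     - (\int[PZ]_z H thetas (pb thetas + x') z - \int[PZ]_z H thetas (pb thetas) z)|
  <= l2 * Mab * delta `^ beta.
Proof.
move=> Ut xa xx; have Tt := U_Theta Ut.
have EL20 : 0 <= EL2 by apply: Rintegral_ge0.
have lip th t t' : Theta th -> `|\int[PZ]_z H th t z - \int[PZ]_z H th t' z| <= EL2 * `|t - t'|.
  move=> Tth.
  have := H_mean_dist G_integrable xi_L2 xi_bound H_measurable H_integrable0 L1_ge0 L2_ge0 L1_L2 L2_L2 H_lipschitz t t' Tth Tth.
  rewrite (_ : \int[PZ]_z (L1 z * `|G th z - G th z|) = 0) ?add0r//.
  rewrite (@eq_Rintegral _ _ _ _ _ (cst 0)); first by rewrite /Rintegral integral0.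
  by move=> z _; rewrite subrr normr0 mulr0.
(* If E[L_2] = 0, the means of [H] do not depend on the second argument and the drift vanishes.
   Otherwise l_2 = 1, and the lower bound on n gives a' <= delta1. *)
rewrite /l2; case: ifPn => [EL2p|EL2n]; last first.
  have E0 : EL2 = 0 by apply/eqP; rewrite eq_le EL20 andbT leNgt.
  rewrite !mul0r.
  set B1 := _ - Rintegral _ _ _; set B2 := _ - Rintegral _ _ _.
  have b1 : `|B1| <= 0 by apply: le_trans (lip _ _ _ Tt) _; rewrite E0 mul0r.
  have b2 : `|B2| <= 0 by apply: le_trans (lip _ _ _ thetas_in) _; rewrite E0 mul0r.
  have -> : B1 = 0 by apply/normr0_eq0/eqP; rewrite eq_le b1 normr_ge0.
  have -> : B2 = 0 by apply/normr0_eq0/eqP; rewrite eq_le b2 normr_ge0.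
  by rewrite subrr normr0 mulr0.
have ad : a' <= delta1.
  move: n_large; rewrite /l2 EL2p mul1r => h.
  rewrite /a' ler_pdivrMr// -ler_sqr ?nnegrE ?(ltW a_gt0) ?(mulr_ge0 (ltW delta1_gt0) (sqrtr_ge0 _))//.
  rewrite exprMn sqr_sqrtr ?ler0n// mulrC -ler_pdivrMr ?exprn_gt0//.
have xd : `|x| <= delta1 by exact: le_trans xa ad.
(* delta = delta^beta delta^(1 - beta), and the second factor is at most the diameter to the power 1
   - beta; this brings the distance to the scale delta^beta. *)
pose ka := K * (delta `^ beta * (diam Theta `^ (1 - beta) + Mlo)).
have kab y : - delta1 <= y <= delta1 -> `|mH theta (pb theta + y) - mH thetas (pb thetas + y)| <= ka.
  move=> yd; apply: le_trans (mH_lipschitz Tt yd) _; rewrite ler_wpM2l//.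
  apply: le_trans (enorm_row_mx_le _ _) _; rewrite mulrDr; apply: lerD.
    case: Ut => _ /le_trans; apply.
    have de : delta = delta `^ beta * delta `^ (1 - beta).
      rewrite -powRD; first by rewrite addrC subrK powRr1// ltW.
      by rewrite (gt_eqF delta_gt0) implybT.
    rewrite {1}de ler_pM2l//; apply: ge0_ler_powR; rewrite ?nnegrE ?subr_ge0//; first exact: ltW.
    by apply: le_trans delta_le; exact: ltW.
  by rewrite mulrC; exact: psibar_dist.
have ka0 : 0 <= ka by rewrite !mulr_ge0 ?addr_ge0 ?powR_ge0// ltW.
pose F th t := \int[PZ]_z H th t z.
have prim th t t' : Theta th -> t' < t -> (F th t - F th t')%:E = (\int[lebesgue_measure]_(u in `[t', t]) (mH th u)%:E)%E.
  by move=> Tth tt; rewrite /F -!meanHE//; exact: mH_primitive.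
have h1 := primitive_increment_diff_le (mH_measurable Tt) (mH_measurable thetas_in) ka0
   (fun t t' => @prim theta t t' Tt) (fun t t' => @prim thetas t t' thetas_in) kab xd.
have h2 := lip _ (pb thetas + x) (pb thetas + x') thetas_in.
rewrite (_ : pb thetas + x - (pb thetas + x') = x - x') in h2; last by ring.
apply: (@le_trans _ _ (Num.sqrt n%:R * (ka * a' + EL2 * (b * delta `^ beta / Num.sqrt n%:R)))).
  rewrite ler_pM2l//.
  change (`|F theta (pb theta + x) - F theta (pb theta) - (F thetas (pb thetas + x') - F thetas (pb thetas))|
    <= ka * a' + EL2 * (b * delta `^ beta / Num.sqrt n%:R)).
  rewrite (_ : F theta (pb theta + x) - F theta (pb theta) - (F thetas (pb thetas + x') - F thetas (pb thetas)) =
     (F theta (pb theta + x) - F theta (pb theta) - (F thetas (pb thetas + x) - F thetas (pb thetas)))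
     + (F thetas (pb thetas + x) - F thetas (pb thetas + x'))); last by ring.
  apply: le_trans (ler_normD _ _) _; apply: lerD.
    by apply: (le_trans h1); rewrite ler_wpM2l.
  by apply: (le_trans h2); rewrite ler_wpM2l.
rewrite /ka /a' /Mab /M_ab le_eqVlt; apply/orP; left; apply/eqP; field.
by rewrite gt_eqF.
Qed.

Let lf := local_fun H thetas (pb thetas) a' D.
Let zt (w : Omega) : n.-tuple (borel R k) := [tuple Z j w | j < n].

Lemma empirical_devE theta w : Theta theta ->
  empirical_dev Z n (G theta) w = n%:R^-1 * (\sum_(j < n) G theta (Z j w)) - pb theta.
Proof.
move=> Tt; rewrite /empirical_dev sumrB mulrBr; congr (_ - _).
rewrite (eq_bigr (fun=> pb theta)); last first.
  by move=> j _; rewrite psibarE// -(mean_law Z_iid j (G_integrable Tt)).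
by rewrite sumr_const card_ord -[pb theta *+ n]mulr_natl mulrA mulVf ?mul1r// gt_eqF.
Qed.

Lemma empirical_devB theta w : U theta ->
  empirical_dev Z n (fun z => G theta z - G thetas z) w =
  empirical_dev Z n (G theta) w - empirical_dev Z n (G thetas) w.
Proof.
move=> Ut; have Tt := U_Theta Ut.
rewrite /empirical_dev -mulrBr -sumrB; congr (_ * _); apply: eq_bigr => j _.
have iB : PZ.-integrable setT (EFin \o (fun z : borel R k => G theta z - G thetas z)).
  rewrite (_ : EFin \o _ = (EFin \o G theta) \- (EFin \o G thetas))%E//.
  by apply: integrableB => //; exact: G_integrable.
have e1 := mean_law Z_iid j iB; have e2 := mean_law Z_iid j (G_integrable Tt).
have e3 := mean_law Z_iid j (G_integrable thetas_in).
rewrite (_ : mean P ((fun z => G theta z - G thetas z) \o Z j) = mean P (G theta \o Z j) - mean P (G thetas \o Z j)).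
  by ring.
rewrite [LHS]e1 [X in _ = X - _]e2 [X in _ = _ - X]e3 RintegralB//; exact: G_integrable.
Qed.

(** The level x is y s plus the bound on the drift, so the centred sum strictly exceeds y sqrt(n) s.
    The strict gap leaves room to pass to a rational index. *)
Lemma deviation_inclusion (C : set 'rV[R]_m) (x y : R) w : C `<=` U ->
  (forall theta, U theta -> forall rho : R, 0 < rho -> exists2 theta', C theta' &
     \int[PZ]_z `|G theta z - G theta' z| < rho /\
     forall j, `|G theta (tnth (zt w) j) - G theta' (tnth (zt w) j)| < rho) ->
  y * s = x - l2 * Mab * delta `^ beta ->
  (x%:E < ereal_sup [set `|compound_process Z G H n theta w
       - compound_process Z G H n thetas w|%:E | theta in U])%E ->
  event_global Z G Theta n a w -> event_local Z G Theta thetas beta n delta b w ->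
  dev_event PZ (rational_index C) lf s y (zt w).
Proof.
move=> CU dense ys /ereal_sup_gt[_ [theta Ut <-]]; rewrite lte_fin => big glob loc.
have Tt := U_Theta Ut.
have globT th : Theta th -> `|empirical_dev Z n (G th) w| <= a'.
  by move=> Tth; rewrite -lee_fin; apply: le_trans glob; apply: ereal_sup_ubound; exists th.
have locT : `|empirical_dev Z n (G theta) w - empirical_dev Z n (G thetas) w| <= b * delta `^ beta / Num.sqrt n%:R.
  by rewrite -empirical_devB// -lee_fin; apply: le_trans loc; apply: ereal_sup_ubound; exists theta.
set xt := empirical_dev Z n (G theta) w in locT.
set xs := empirical_dev Z n (G thetas) w in locT.
have a'0 : 0 < a' by rewrite divr_gt0.
(* Coordinates of the actual sample means: |q1| <= 1 is the global event, and |q2| <= 1 follows from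
   the local event, sqrt(n) >= 1 and [psibar_dist]. *)
pose q1 := xs / a'.
pose q2 := (pb theta + xt - (pb thetas + xs)) / D.
have q1E : pb thetas + a' * q1 = pb thetas + xs by rewrite /q1 mulrC divfK// gt_eqF.
have q2E : pb thetas + a' * q1 + D * q2 = pb theta + xt.
  by rewrite q1E /q2 [D * _]mulrC divfK ?gt_eqF//; ring.
have pI : local_index U (theta, q1, q2).
  split => //=; rewrite -ler_norml normrM normfV.
    by rewrite (gtr0_norm a'0) ler_pdivrMr// mul1r; exact: globT.
  rewrite (gtr0_norm D_gt0) ler_pdivrMr// mul1r.
  rewrite (_ : _ - _ = (pb theta - pb thetas) + (xt - xs)); last by ring.
  apply: le_trans (ler_normD _ _) _; rewrite /D mulrDl addrC; apply: lerD.
    apply: (le_trans locT); rewrite ler_pdivrMr// ler_peMr//.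
    by rewrite mulr_ge0 ?powR_ge0// ltW.
  exact: psibar_dist.
pose S1 := \sum_(j < n) (lf (theta, q1, q2) (tnth (zt w) j) - \int[PZ]_z lf (theta, q1, q2) z).
pose Dr := (\int[PZ]_z H theta (pb theta + xt) z - \int[PZ]_z H theta (pb theta) z)
     - (\int[PZ]_z H thetas (pb thetas + xs) z - \int[PZ]_z H thetas (pb thetas) z).
have drift : Num.sqrt n%:R * `|Dr| <= l2 * Mab * delta `^ beta.
  by apply: drift_le => //; exact: globT.
have avg th : Theta th -> n%:R^-1 * (\sum_(i < n) G th (Z i w)) = pb th + empirical_dev Z n (G th) w.
  by move=> Tth; rewrite empirical_devE//; ring.
(* With the second arguments frozen at q1 and q2, subtracting the mean of that member of the class
   leaves exactly the drift. *)
have decomp : compound_process Z G H n theta w - compound_process Z G H n thetas w =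
    (Num.sqrt n%:R)^-1 * (S1 + n%:R * Dr).
  rewrite /compound_process -mulrBr -sumrB !avg// -/xt -/xs; congr (_ * _).
  rewrite /S1 -[n%:R * Dr](_ : \sum_(j < n) Dr = _); last first.
    by rewrite sumr_const card_ord mulr_natl.
  rewrite -big_split /=; apply: eq_bigr => j _.
  rewrite tnth_mktuple /lf (local_fun_mean H_measurable H_integrable0 L1_ge0 L2_ge0 L2_L2 H_lipschitz _ _ _ U_Theta thetas_in)//.
  rewrite /local_fun /= q2E q1E /Dr /psiH.
  by rewrite !meanHE// -/(pb theta) -/(pb thetas); ring.
have S1big : y * Num.sqrt n%:R * s < `|S1|.
  move: big; rewrite decomp normrM normfV (gtr0_norm sqn_gt0) mulrC ltr_pdivlMr// => big.
  have h1 := ler_normD S1 (n%:R * Dr).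
  rewrite normrM (ger0_norm (ltW n_gt0R)) in h1.
  have nn : n%:R = Num.sqrt n%:R * Num.sqrt n%:R :> R by rewrite -expr2 sqr_sqrtr// ltW.
  have h2 : n%:R * `|Dr| <= Num.sqrt n%:R * (l2 * Mab * delta `^ beta).
    by rewrite [leLHS](_ : _ = Num.sqrt n%:R * (Num.sqrt n%:R * `|Dr|)) ?ler_pM2l// mulrA -nn.
  rewrite mulrAC ys mulrBl; lra.
have gam0 : 0 < `|S1| - y * Num.sqrt n%:R * s by rewrite subr_gt0.
have [p' p'S hp'] := dev_approx G_integrable xi_L2 xi_bound H_measurable H_integrable0 L1_ge0 L2_ge0 L1_L2 L2_L2 H_lipschitz
  (pb thetas) a' D U_Theta CU thetas_in pI gam0 (dense theta Ut).
exists p' => //.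
set S2 := \sum_(j < n) _.
have hS : `|S1 - S2| < `|S1| - y * Num.sqrt n%:R * s by exact: hp'.
have := ler_normB S1 (S1 - S2); rewrite (_ : S1 - (S1 - S2) = S2); last by ring.
have := ler_normD (S1 - S2) S2; rewrite subrK.
lra.
Qed.

Context (C : set 'rV[R]_m) (N : set (n.-tuple (borel R k))).
Hypothesis C_countable : countable C.
Hypothesis CU : C `<=` U.
Hypothesis N_null : (power_measure PZ n).-negligible N.
Hypothesis N_separable : forall theta z, U theta -> ~ N z ->
  ereal_inf
    [set (mean P (fun w => `|G theta (Z 0%N w) - G vtheta (Z 0%N w)|)
          + \big[Num.max/0]_(j < n) `|G theta (tnth z j) - G vtheta (tnth z j)|)%:E
    | vtheta in C] = 0%E.

Lemma separable_dense z : ~ N z -> forall theta, U theta -> forall rho : R, 0 < rho ->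
  exists2 theta', C theta' & \int[PZ]_z `|G theta z - G theta' z| < rho /\
     forall j, `|G theta (tnth z j) - G theta' (tnth z j)| < rho.
Proof.
move=> Nz theta Ut rho rho0.
have : (0 < rho%:E)%E by rewrite lte_fin.
rewrite -[X in (X < _)%E](N_separable Ut Nz) => /ereal_inf_lt[_ [th Cth <-]].
rewrite lte_fin => h; exists th => //.
have Tt := U_Theta Ut; have Tth := U_Theta (CU Cth).
have e := mean_law Z_iid 0 (G_dist_integrable G_integrable xi_L2 xi_bound Tt Tth).
rewrite e in h.
have i0 : 0 <= \int[PZ]_z `|G theta z - G th z| by apply: Rintegral_ge0.
have bm j : `|G theta (tnth z j) - G th (tnth z j)| <= \big[Num.max/0]_(j < n) `|G theta (tnth z j) - G th (tnth z j)|.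
  exact: (le_bigmax 0 (fun j => `|G theta (tnth z j) - G th (tnth z j)|)).
split; first by have := le_trans (normr_ge0 _) (bm (Ordinal n_gt0)); move: h; lra.
by move=> j; have := bm j; move: h; lra.
Qed.

(** The centres of a cover lie in the class, so each comes from a parameter; in differences of
    members [G thetas] cancels. *)
Lemma local_covers : exists aa : nat -> R, [/\ forall j, 0 <= aa j,
    forall K, \sum_(j < K) (2 ^+ j)^-1 * aa j <= 16 * Mup &
    forall j l (w : nat -> R) (p : nat -> 'rV[R]_k), (forall i, 0 < w i) -> (0 < l)%N ->
      exists N (c : 'I_N -> 'rV[R]_m), [/\ (0 < N)%N, forall i, U (c i),
        ln (2 * N%:R) <= aa j ^+ 2 &
        forall theta, U theta -> exists i,
          \sum_(q < l) w q * (G theta (p q) - G (c i) (p q)) ^+ 2 <=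
          ((2 ^+ (j + 3))^-1) ^+ 2 * \sum_(q < l) w q * xid (p q) ^+ 2]].
Proof.
pose F := centered_class G Theta thetas delta.
have Fm g : F g -> measurable_fun [set: borel R k] g.
  by move=> [th Uth <-]; apply: measurable_funB; apply: (measurable_G G_integrable) => //; exact: U_Theta.
have F0 : F (fun z => G thetas z - G thetas z) by exists thetas.
have [aa [aa0 aas cov]] := entropy_covers F0 Fm mxid entropy_bound.
exists aa; split => // j l w p w0 l0.
have [M [c [M0 Fc lnM covc]]] := cov j l w p w0 l0.
have cex i : exists th, U th /\ (fun z => G th z - G thetas z) = c i by have [th ? ?] := Fc i; exists th.
pose c' i := projT1 (cid (cex i)).
have c'E i z : c i z = G (c' i) z - G thetas z.
  by rewrite /c'; case: (cid _) => th /= [_ <-].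
exists M, c'; split => // [i|theta Ut]; first by rewrite /c'; case: (cid _) => th /= [].
have [|i hi] := covc (fun z => G theta z - G thetas z); first by exists theta.
exists i; apply: le_trans hi; rewrite le_eqVlt; apply/orP; left; apply/eqP.
by apply: eq_bigr => q _; rewrite c'E; congr (_ * _ ^+ 2); ring.
Qed.

Let A_ge1 : 1 <= A. Proof. by rewrite le_max lexx. Qed.

Let lnA : ln A = Num.max (ln (a / b) - ln (Num.sqrt n%:R * delta `^ beta)) 0.
Proof.
rewrite -ln_div ?posrE ?divr_gt0 ?mulr_gt0// /A.
set q := _ / (_ * _); have q0 : 0 < q by rewrite !divr_gt0 ?mulr_gt0.
have [q1|q1] := lerP q 1; first by rewrite ln1 max_r ?ln_le0.
by rewrite max_l// ln_ge0// ltW.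
Qed.

(** a' is the ratio in [A] times b delta^beta, and b <= b + Mlo. *)
Let a'D : a' <= A * D.
Proof.
apply: (@le_trans _ _ (a / b / (Num.sqrt n%:R * delta `^ beta) * D)); last first.
  by apply: ler_wpM2r; [exact: ltW|rewrite le_max lexx orbT].
rewrite /a' /D (_ : _ / _ / _ * _ = a / Num.sqrt n%:R * ((b + Mlo) / b)); last first.
  by field; rewrite !gt_eqF.
by rewrite ler_peMr ?divr_ge0 ?(ltW a_gt0) ?sqrtr_ge0// ler_pdivlMr// mul1r lerDl ltW.
Qed.

Let X_ge0 z : 0 <= X z. Proof. exact: sqrtr_ge0. Qed.

Let lip_U theta theta' t s' z : U theta -> U theta' ->
  `|H theta t z - H theta' s' z| ^+ 2
     <= L1 z ^+ 2 * `|G theta z - G theta' z| ^+ 2 + L2 z ^+ 2 * `|t - s'| ^+ 2.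
Proof. by move=> /U_Theta Ut /U_Theta Ut'; exact: H_lipschitz. Qed.

Let a'_ge0 : 0 <= a'. Proof. by rewrite divr_ge0 ?sqrtr_ge0// ltW. Qed.

Let S := rational_index C.

Let local_chain (u : n.-tuple (borel R k * borel R k)) (V tau : R) : 0 <= tau -> 0 < V ->
  2 * \sum_(j < n) (X (tnth u j).1 ^+ 2 + X (tnth u j).2 ^+ 2) <= V ->
  #|[set sg : {ffun 'I_n -> bool} | `[< exists2 p, S p &
     Num.sqrt V * (Num.sqrt 2 * (16 * Mup + 2 * Num.sqrt (ln (256 * A) + tau) + 2 * Num.sqrt (ln 8)))
     < `|rsum (fun j => lf p (tnth u j).1 - lf p (tnth u j).2) sg| >]]%SET|%:R
  <= 2 ^+ n * expR (- tau) :> R.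
Proof.
move=> tau0 V0 uV; have [aa [aa0 aas cov]] := local_covers.
have := class_chaining (pb thetas) U_ts L1_ge0 lip_U xid_bound XE X_ge0 D_gt0 a'_ge0 a'D
  A_ge1 aa0 aas cov n_gt0 tau0 V0 uV.
apply: le_trans; rewrite ler_nat; apply: subset_leq_card; apply/fintype.subsetP => sg.
by rewrite !inE => -[p /(rational_index_local CU) pI hp]; exists p.
Qed.

Let lf_measurable p : S p -> measurable_fun [set: borel R k] (lf p).
Proof.
by move=> /(rational_index_local CU); exact: (local_fun_measurable H_measurable _ _ _ U_Theta thetas_in).
Qed.

Let lf_le p z : S p -> `|lf p z| <= X z.
Proof.
by move=> /(rational_index_local CU); exact: (local_fun_le _ _ U_ts L1_ge0 lip_U xid_bound XE X_ge0 D_gt0).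
Qed.

Let etab := etabar Mup beta n a b delta.
Let etabE : etab = 64 * Num.sqrt 2 * Mup + 32 * Num.sqrt (ln 24 + ln A).
Proof. by rewrite lnA. Qed.

Let tail_event (x : R) := [set w |
       (x%:E < ereal_sup [set `|compound_process Z G H n theta w
                           - compound_process Z G H n thetas w|%:E | theta in U])%E]
     `&` event_global Z G Theta n a `&` event_local Z G Theta thetas beta n delta b.

Let dev_measurable y : measurable (dev_event PZ S lf s (n := n) y).
Proof. by apply: measurable_dev => //; exact: countable_rational_index. Qed.

Lemma tail_event_markov (x y : R) : y * s = x - l2 * Mab * delta `^ beta -> etab < y ->
  ((P^*)%mu (tail_event x) <= (etab / y)%:E)%E.
Proof.
move=> ys; rewrite etabE => ey.
have := dev_tail_markov (countable_rational_index C_countable) lf_measurable measurable_xi_ab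
  lf_le s_gt0 xi_ab_sqr_le n_gt0 (ltW Mup_gt0) A_ge1 local_chain ey.
apply: le_trans; rewrite -[leRHS]adde0 -(measure0 P).
apply: (outer_tuple_le Z_iid N_null (dev_measurable y)) => // w [[big glob] loc].
have [Nw|Nw] := pselect (N (zt w)); first exact: Or31.
by apply: Or32; apply: (deviation_inclusion CU (separable_dense Nw) ys).
Qed.

Lemma tail_event_exp (x y : R) : y * s = x - l2 * Mab * delta `^ beta -> 1 + 2 * etab < y ->
  ((P^*)%mu (tail_event x) <= (expR (- (y / 40)))%:E + P (~` event_square Z n X))%E.
Proof.
move=> ys; rewrite etabE => ey.
have h := dev_tail_exp (countable_rational_index C_countable) lf_measurable measurable_xi_ab
  lf_le s_gt0 xi_ab_sqr_le n_gt0 (ltW Mup_gt0) A_ge1 local_chain ey.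
apply: le_trans (leeD2r _ h).
have mX2 : measurable_fun [set: borel R k] (fun z => X z ^+ 2).
  by apply: measurable_funX; exact: measurable_xi_ab.
apply: (outer_tuple_le Z_iid N_null).
- apply: measurableI; first exact: dev_measurable.
  rewrite -[X in measurable X]setTI; apply: measurable_fun_ler => //.
  by apply: measurable_sum => j; apply: (measurableT_comp mX2); exact: measurable_tnth.
- apply: measurableC; rewrite -[X in measurable X]setTI; apply: measurable_fun_ler => //.
  apply: measurable_funM => //; apply: measurable_sum => j.
  by apply: (measurableT_comp mX2); exact: measurable_funPT.
- move=> w [[big glob] loc].
  have [Nw|Nw] := pselect (N (zt w)); first exact: Or31.
  (* Where the event on squares fails, the outcome is charged to the additional probability in the
     bound. *)
  have [sq|sq] := pselect (event_square Z n X w); last exact: Or33.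
  apply: Or32; split; first exact: (deviation_inclusion CU (separable_dense Nw) ys).
  rewrite /sqr_event /=; under eq_bigr do rewrite tnth_mktuple.
  exact: event_square_sub.
Qed.

End Assembly.

(** * Numerical bounds and the two claims *)

Lemma measurable_section {R : realType} (m : nat) (Theta : set 'rV[R]_m) (f : 'rV[R]_m -> R -> R) :
  compact Theta ->
  measurable_fun (Theta `*` setT : set (borel R m * R)) (fun p => f p.1 p.2) ->
  forall theta, Theta theta -> measurable_fun setT (f theta).
Proof.
move=> Theta_compact mf theta Tt.
have mTheta : measurable (Theta : set (borel R m)).
  rewrite -[X in measurable X]setCK; apply: measurableC; apply: sub_sigma_algebra.
  by apply: closed_openC; apply: compact_closed => //; exact: norm_hausdorff.
have mpair : measurable_fun setT (fun u : R => (theta : borel R m, u)).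
  exact: measurable_fun_pair.
apply: (measurable_comp _ _ mf mpair); first exact: measurableX.
by move=> _ [u _ <-].
Qed.

Lemma etabar_ge0 {R : realType} (Mup beta : R) n (a b delta : R) : 0 < Mup ->
  0 <= etabar Mup beta n a b delta.
Proof. by move=> M0; rewrite addr_ge0 ?mulr_ge0 ?sqrtr_ge0// ltW. Qed.

(** 40^-1 is the limit of [gfrak] at infinity; the denominator 8 (t + 1) (5 t + 28) exceeds 40
    t^2. *)
Lemma gfrak_le {R : realType} (t : R) : 0 < t -> gfrak t <= 40^-1.
Proof.
move=> t0; have d0 : 0 < 8 * (t + 1) * (5 * t + 28) by rewrite !mulr_gt0//; lra.
by rewrite /gfrak ler_pdivrMr// ler_pdivlMl//; have := mulr_gt0 t0 t0; nra.
Qed.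

(** The condition on delta, raised to the power beta. *)
Lemma scale_bound {R : realType} (W eps beta delta : R) (n : nat) : 0 < W -> 0 < eps ->
  0 < beta -> 0 <= delta ->
  delta < (eps / W) `^ beta^-1 * n%:R `^ (- (1 / (4 - 2 * beta))) ->
  W * delta `^ beta < eps * n%:R `^ (- (beta / (4 - 2 * beta))).
Proof.
move=> W0 e0 b0 d0 h.
have eW0 : 0 < eps / W by rewrite divr_gt0.
have := gt0_ltr_powR b0 _ _ h; rewrite !nnegrE => /(_ d0).
rewrite mulr_ge0 ?powR_ge0// => /(_ isT).
rewrite powRM ?powR_ge0// -!powRrM mulVf ?gt_eqF// powRr1 ?(ltW eW0)//.
rewrite (_ : - (1 / (4 - 2 * beta)) * beta = - (beta / (4 - 2 * beta))); last first.
  by rewrite mulNr div1r mulrC.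
by rewrite mulrAC ltr_pdivlMr// mulrC.
Qed.
(** After clearing denominators the claim is c e <= c y: adding c to both parts of s e / (s y), a
    quotient below 1, increases it. *)
Lemma ratio_le {R : realFieldType} (c s e x y : R) : 0 <= c -> 0 <= e -> e < y -> 0 < x ->
  y * s = x - c -> e / y <= (s * e + c) / x.
Proof.
move=> c0 e0 ey x0 ys; have y0 : 0 < y by exact: le_lt_trans ey.
rewrite ler_pdivlMr// mulrAC ler_pdivrMr//.
have xE : x = y * s + c by rewrite ys subrK.
rewrite xE.
have : 0 <= c * (y - e) by rewrite mulr_ge0// subr_ge0 ltW.
lra.
Qed.

Theorem theorem10p1 (R : realType) (m k : nat) (k_gt0 : (0 < k)%N)
  (disp : measure_display) (Omega : measurableType disp)
  (P : probability Omega R)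
  (P_complete : measure_is_complete P) (P_atomless : atomless P)
  (PZ : probability (borel R k) R) (Z : nat -> {RV P >-> borel R k})
  (Z_iid : iid_with_law P Z PZ)
  (Theta : set 'rV[R]_m) (Theta_compact : compact Theta)
  (diam_gt0 : 0 < diam Theta)
  (G : 'rV[R]_m -> 'rV[R]_k -> R) (H : 'rV[R]_m -> R -> 'rV[R]_k -> R)
  (* (i) *)
  (G_integrable : forall theta, Theta theta ->
     PZ.-integrable setT (EFin \o G theta))
  (G_cvg : forall (u : nat -> 'rV[R]_m) (theta : 'rV[R]_m),
     (forall i, Theta (u i)) -> Theta theta -> u @ \oo --> theta ->
     forall e : R, 0 < e ->
     PZ [set z | e < `|G (u i) z - G theta z|] @[i --> \oo] --> 0%E)
  (* (ii) *)
  (xi : 'rV[R]_k -> R)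
  (xi_gt0 : forall z, 0 < xi z)
  (xi_L2 : (xi : borel R k -> R) \in Lfun PZ 2%:E)
  (xi_bound : forall theta z, Theta theta -> `|G theta z| <= xi z)
  (* (iii) *)
  (H_measurable : forall theta t, Theta theta ->
     measurable_fun [set: borel R k] (H theta t))
  (H_integrable : forall theta, Theta theta ->
     PZ.-integrable setT (EFin \o H theta (psibar Z G theta)))
  (* (iv) *)
  (L1 L2 : 'rV[R]_k -> R)
  (L1_ge0 : forall z, 0 <= L1 z) (L2_ge0 : forall z, 0 <= L2 z)
  (L1_L2 : (L1 : borel R k -> R) \in Lfun PZ 2%:E)
  (L2_L2 : (L2 : borel R k -> R) \in Lfun PZ 2%:E)
  (H_lipschitz : forall theta theta' t s z, Theta theta -> Theta theta' ->
     `|H theta t z - H theta' s z| ^+ 2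
     <= L1 z ^+ 2 * `|G theta z - G theta' z| ^+ 2
        + L2 z ^+ 2 * `|t - s| ^+ 2)
  (* (v) *)
  (thetas : 'rV[R]_m) (thetas_in : Theta thetas)
  (thetas_min : forall theta, Theta theta ->
     psiH Z G H thetas <= psiH Z G H theta)
  (thetas_uniq : forall theta, Theta theta ->
     (forall theta', Theta theta' -> psiH Z G H theta <= psiH Z G H theta') ->
     theta = thetas)
  (* (vi) *)
  (G_separable : forall delta : R, 0 < delta ->
     exists (C : set 'rV[R]_m) (N : forall n, set (n.-tuple (borel R k))),
     [/\ countable C,
         C `<=` nbhd Theta thetas delta,
         forall n, (0 < n)%N -> (power_measure PZ n).-negligible (N n) &
         forall theta n z, nbhd Theta thetas delta theta -> (0 < n)%N ->
           ~ N n z ->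
           ereal_inf
             [set (mean P (fun w => `|G theta (Z 0%N w) - G vtheta (Z 0%N w)|)
                   + \big[Num.max/0]_(j < n)
                       `|G theta (tnth z j) - G vtheta (tnth z j)|)%:E
             | vtheta in C] = 0%E])
  (* (vii) *)
  (beta Mlo Mup : R) (beta_gt0 : 0 < beta) (beta_le1 : beta <= 1)
  (Mlo_gt0 : 0 < Mlo) (Mup_gt0 : 0 < Mup)
  (xid : R -> 'rV[R]_k -> R)
  (xid_L2 : forall delta : R, 0 < delta <= diam Theta ->
     (xid delta : borel R k -> R) \in Lfun PZ 2%:E)
  (xid_envelope : forall delta : R, 0 < delta <= diam Theta ->
     pos_envelope (centered_class G Theta thetas delta) (xid delta))
  (xid_norm : forall delta : R, 0 < delta <= diam Theta ->
     (L2norm PZ (fun z => Num.max (L1 z) 1 * xid delta z)%R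
      <= (Mlo * delta `^ beta)%:E)%E)
  (entropy_bound : forall delta : R, 0 < delta <= diam Theta ->
     (maxe
        (entropy_integral (centered_class G Theta thetas delta)
          (xid delta) (1 / 8)%R)
        (entropy_integral (param_class G Theta) xi (1 / 8)%R)
      <= Mup%:E)%E)
  (* (viii) *)
  (delta1 K : R) (delta1_gt0 : 0 < delta1) (K_ge0 : 0 <= K)
  (mH : 'rV[R]_m -> R -> R)
  (mH_measurable : measurable_fun (Theta `*` setT : set (borel R m * R))
     (fun p => mH p.1 p.2))
  (mH_lipschitz : forall theta (x : R), Theta theta -> - delta1 <= x <= delta1 ->
     `|mH theta (psibar Z G theta + x) - mH thetas (psibar Z G thetas + x)|
     <= K * enorm (row_mx (theta - thetas)
                     (const_mx (psibar Z G theta - psibar Z G thetas)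
                       : 'rV[R]_1)))
  (mH_primitive : forall theta (t s : R), Theta theta -> s < t ->
     (* an equality in \bar R with a finite left-hand side, so that
        mH theta is integrable on [s, t] *)
     (mean P (fun w => H theta t (Z 0%N w))
      - mean P (fun w => H theta s (Z 0%N w)))%:E
     = (\int[lebesgue_measure]_(u in `[s, t]) (mH theta u)%:E)%E)
  (a b eps : R) (a_gt0 : 0 < a) (b_gt0 : 0 < b) (eps_gt0 : 0 < eps)
  (n : nat) (n_gt0 : (0 < n)%N) :
  let Delta := diam Theta in
  let EL2 := mean P (fun w => L2 (Z 0%N w)) in
  let l2 : R := if 0 < EL2 then 1 else 0 in
  let Mb := Mbar Mlo (fine (L2norm PZ L2)) b in
  let Mab := M_ab K Delta beta Mlo EL2 a b in
  let p_n (delta : R) := (P^*)%mu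
    ([set w |
       ((eps * n%:R `^ (- (beta / (4 - 2 * beta))))%:E
        < ereal_sup [set `|compound_process Z G H n theta w
                           - compound_process Z G H n thetas w|%:E
                    | theta in nbhd Theta thetas delta])%E]
     `&` event_global Z G Theta n a
     `&` event_local Z G Theta thetas beta n delta b) in
  Num.max (Mb ^+ 2 * Delta `^ (2 * beta) / 2) (l2 * a ^+ 2 / delta1 ^+ 2)
    <= n%:R ->
  (forall delta : R, 0 < delta <= Delta ->
     (p_n delta
      <= ((Mb * etabar Mup beta n a b delta + l2 * Mab) * delta `^ beta
          * n%:R `^ (beta / (4 - 2 * beta)) / eps)%:E)%E)
  /\
  (forall delta t : R, 0 < delta <= Delta -> 0 < t ->
     delta < (eps / (l2 * Mab + Mb * eta_t Mup beta t n a b delta)) `^ beta^-1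
             * n%:R `^ (- (1 / (4 - 2 * beta))) ->
     (p_n delta
      <= (expR (l2 * Mab * gfrak t / Mb)
          * expR (- (eps * gfrak t
                     / (n%:R `^ (beta / (4 - 2 * beta)) * delta `^ beta * Mb))))%:E
         + P (~` event_square Z n (xi_ab L1 L2 (xid delta) Mlo beta b delta)))%E).

Proof.
move=> Delta EL2 l2 Mb Mab p_n n_large.
have EL2E : EL2 = \int[PZ]_z L2 z by exact: (mean_law Z_iid 0 (Lfun2_integrable L2_L2)).
have n_l2 : l2 * a ^+ 2 / delta1 ^+ 2 <= n%:R.
  by apply: le_trans n_large; rewrite le_max lexx orbT.
have mHm := measurable_section Theta_compact mH_measurable.
pose tail delta x := [set w | (x%:E
        < ereal_sup [set `|compound_process Z G H n theta w
                           - compound_process Z G H n thetas w|%:E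
                    | theta in nbhd Theta thetas delta])%E]
     `&` event_global Z G Theta n a
     `&` event_local Z G Theta thetas beta n delta b.
(* Here y is what remains of the level x after the drift, in units of [Mb] delta^beta; both claims
   start from this reduction. *)
have key delta : 0 < delta <= Delta -> forall x y : R,
    y * (Mb * delta `^ beta) = x - l2 * Mab * delta `^ beta ->
    (etabar Mup beta n a b delta < y ->
      ((P^*)%mu (tail delta x) <= (etabar Mup beta n a b delta / y)%:E)%E) /\
    (1 + 2 * etabar Mup beta n a b delta < y ->
      ((P^*)%mu (tail delta x) <= (expR (- (y / 40)))%:E
         + P (~` event_square Z n (xi_ab L1 L2 (xid delta) Mlo beta b delta)))%E).
  move=> dD x y ys; have /andP[d0 dle] := dD.
  have [C [N [Cc CU Nnull Nsep]]] := G_separable delta d0.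
  have := entropy_bound delta dD; rewrite ge_max => /andP[ent _].
  have Nsep' theta z := Nsep theta n z ^~ n_gt0.
  move: ys n_l2; rewrite /Mab /l2 EL2E => ys n_l2.
  split=> h.
    by apply: (tail_event_markov Z_iid G_integrable xi_L2 xi_bound H_measurable H_integrable
      L1_ge0 L2_ge0 L1_L2 L2_L2 H_lipschitz thetas_in beta_le1 Mlo_gt0 Mup_gt0 d0 dle
      (xid_envelope delta dD) (xid_norm delta dD) ent K_ge0 mHm mH_lipschitz mH_primitive a_gt0 b_gt0 n_gt0
      n_l2 delta1_gt0 Cc CU (Nnull n n_gt0) _ ys).
  by apply: (tail_event_exp Z_iid G_integrable xi_L2 xi_bound H_measurable H_integrable
    L1_ge0 L2_ge0 L1_L2 L2_L2 H_lipschitz thetas_in beta_le1 Mlo_gt0 Mup_gt0 d0 dle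
    (xid_envelope delta dD) (xid_norm delta dD) ent K_ge0 mHm mH_lipschitz mH_primitive a_gt0 b_gt0 n_gt0
    n_l2 delta1_gt0 Cc CU (Nnull n n_gt0) _ ys).
have nL2 : 0 <= fine (L2norm PZ L2) by rewrite fine_ge0// Lnorm_ge0.
have Mb0 : 0 < Mb by apply: Mbar_gt0 => //; exact: ltW.
have lM0 : 0 <= l2 * Mab.
  have EL20 : 0 <= EL2 by rewrite EL2E; apply: Rintegral_ge0.
  rewrite /l2 /Mab /M_ab; case: ifP => _; rewrite ?mul0r// mul1r addr_ge0 ?mulr_ge0//; try exact: ltW.
  by rewrite addr_ge0 ?powR_ge0// ltW.
have q0 : 0 < n%:R `^ (beta / (4 - 2 * beta)) :> R by rewrite powR_gt0// ltr0n.
rewrite /p_n powRN; set q := n%:R `^ (beta / _) in q0 *.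
have x0 : 0 < eps / q by rewrite divr_gt0.
set x := eps / q in x0 *.
split=> [delta dD|delta t dD t0 dlt].
  have /andP[d0 dle] := dD; have db0 : 0 < delta `^ beta by exact: powR_gt0.
  set et := etabar _ _ _ _ _ _; have et0 : 0 <= et by exact: etabar_ge0.
  rewrite (_ : _ * q / eps = (Mb * et + l2 * Mab) * delta `^ beta / x); last first.
    by rewrite /x invfM invrK mulrA mulrAC.
  (* For x at most this quantity the claimed bound is at least 1; otherwise y exceeds [et]. *)
  have [xle|xgt] := lerP x ((Mb * et + l2 * Mab) * delta `^ beta).
    apply: (@le_trans _ _ 1%E); last by rewrite lee_fin ler_pdivlMr// mul1r.
    rewrite -(@probability_setT _ _ _ P) -measurable_mu_extE//.
    by apply: le_mu_ext.
  have s0 : 0 < Mb * delta `^ beta by rewrite mulr_gt0.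
  pose y := (x - l2 * Mab * delta `^ beta) / (Mb * delta `^ beta).
  have ys : y * (Mb * delta `^ beta) = x - l2 * Mab * delta `^ beta by rewrite /y divfK// gt_eqF.
  have ey : et < y.
    rewrite /y ltr_pdivlMr// ltrBrDr; apply: le_lt_trans xgt.
    by rewrite le_eqVlt; apply/orP; left; apply/eqP; ring.
  apply: le_trans ((key delta dD x y ys).1 ey) _; rewrite lee_fin.
  rewrite (_ : (Mb * et + l2 * Mab) * delta `^ beta = Mb * delta `^ beta * et + l2 * Mab * delta `^ beta); last by ring.
  by apply: ratio_le ys => //; apply: mulr_ge0 => //; exact: powR_ge0.
have /andP[d0 dle] := dD; have db0 : 0 < delta `^ beta by exact: powR_gt0.
have s0 : 0 < Mb * delta `^ beta by rewrite mulr_gt0.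
have et0 : 0 <= etabar Mup beta n a b delta by exact: etabar_ge0.
have eta0 : 1 + 2 * etabar Mup beta n a b delta <= eta_t Mup beta t n a b delta.
  by rewrite /eta_t lerD2l -[leRHS]mulrA ler_pM2l// ler_peMl// lerDr ltW.
have eta_gt0 : 0 < eta_t Mup beta t n a b delta.
  by apply: lt_le_trans eta0; rewrite ltr_pwDl ?mulr_ge0.
have W0 : 0 < l2 * Mab + Mb * eta_t Mup beta t n a b delta.
  by rewrite ltr_wpDl// mulr_gt0.
have := scale_bound W0 eps_gt0 beta_gt0 (ltW d0) dlt; rewrite powRN -/q -/x => Wx.
pose y := (x - l2 * Mab * delta `^ beta) / (Mb * delta `^ beta).
have ys : y * (Mb * delta `^ beta) = x - l2 * Mab * delta `^ beta by rewrite /y divfK// gt_eqF.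
have ey : eta_t Mup beta t n a b delta < y.
  rewrite /y ltr_pdivlMr// ltrBrDr; apply: le_lt_trans Wx.
  by rewrite le_eqVlt; apply/orP; left; apply/eqP; ring.
apply: le_trans ((key delta dD x y ys).2 (le_lt_trans eta0 ey)) _.
apply: leeD2r; rewrite lee_fin -expRD ler_expR.
(* The two exponents of the claim add up exactly, the first being the contribution of the drift. *)
rewrite (_ : _ + _ = - (gfrak t * y)); last by rewrite /y /x; field; rewrite !gt_eqF.
by rewrite lerN2 mulrC ler_pM2l ?gfrak_le//; exact: lt_trans ey.
Qed.
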